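(* Let $(M,F)$ be a homogeneous Finsler manifold such that $F$ is an $(\alpha_1,\alpha_2)$ metric. Then the following are equivalent: (1) $F$ has weakly isotropic S-curvature; (2) $F$ has vanishing S-curvature; (3) $F$ has isotropic E-curvature; (4) $F$ has vanishing E-curvature.
   Context: **Finsler metrics.** A Minkowski norm on a finite dimensional real vector space $\mathbf V$ is a continuous function $F:\mathbf V\to[0,+\infty)$ that is positive and smooth on $\mathbf V\setminus\{0\}$, satisfies $F(\lambda y)=\lambda F(y)$ for $\lambda\ge 0$, and for which $g_y(u,v)=\frac12\frac{\partial^2}{\partial s\partial t}F^2(y+su+tv)|_{s=t=0}$ is an inner product for every $y\neq0$. A Finsler metric on $M$ is a continuous function $F:TM\to[0,+\infty)$, smooth on $TM\setminus 0$, whose restriction to each $T_xM$ is a Minkowski norm. In standard local coordinates $x=(x^i)$, $y=y^i\partial_{x^i}$, $g_{ij}=\frac12[F^2]_{y^iy^j}$ and $(g^{ij})$ is its inverse. $(M,F)$ is homogeneous if its isometry group acts transitively on $M$. Let $n=\dim M$. **$(\alpha_1,\alpha_2)$ metrics.** Let $\alpha$ be a Riemannian metric on $M$ and $TM=\mathcal V_1+\mathcal V_2$ an $\alpha$-orthogonal decomposition into two linear subbundles of positive rank. For $y=y_1+y_2$ with $y_i\in\mathcal V_i$ put $\alpha_i(y)=\alpha(y_i)$. An $(\alpha_1,\alpha_2)$ metric is a Finsler metric of the form $F=\sqrt{L(\alpha_1^2,\alpha_2^2)}$, where $L:[0,+\infty)\times[0,+\infty)\to[0,+\infty)$ is positively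 1-homogeneous and smooth away from the origin. Convention for homogeneous $(\alpha_1,\alpha_2)$ metrics: for a presentation $M=G/H$ with $G$ a transitive Lie group of isometries and reductive decomposition $\mathfrak g=\mathfrak h+\mathfrak m$ (with $\mathfrak m$ identified with $T_o(G/H)$), $\alpha$ and the splitting are $G$-invariant, i.e. given on $\mathfrak m$ by an $\mathrm{Ad}(H)$-invariant Euclidean norm and an $\mathrm{Ad}(H)$-invariant $\alpha$-orthogonal decomposition $\mathfrak m=\mathfrak m_1+\mathfrak m_2$. **E-curvature.** The geodesic spray coefficients are $\mathbf G^i=\frac14g^{il}([F^2]_{x^ky^l}y^k-[F^2]_{x^l})$. The Berwald curvature is $B^i_{jkl}=\frac{\partial^3\mathbf G^i}{\partial y^j\partial y^k\partial y^l}$ and the E-curvature (mean Berwald curvature) is $E_{ij}=\frac12B^k_{ijk}$. $F$ has isotropic E-curvature if there is a function $c(x)$ on $M$ with $E_{ij}=\frac{n+1}{2}c(x)F^{-1}h_{ij}$, where $h_{ij}=FF_{y^iy^j}$; it has vanishing E-curvature if $E_{ij}\equiv0$. **S-curvature.** With respect to the Busemann–Hausdorff measure $dV_{BH}=\sigma(x)dx^1\cdots dx^n$, $\sigma(x)=\frac{\mathrm{Vol}(B_n(1))}{\mathrm{Vol}\{(y^i)\in\mathbb R^n\,|\,F(x,y^i\partial_{x^i})<1\}}$ (with $B_n(1)$ the Euclidean unit ball in $\mathbb R^n$), the S-curvature $S:TM\setminus0\to\mathbb R$ is $S(x,y)=\frac{\partial\mathbf G^i}{\partial y^i}(x,y)-y^i\frac{\partial}{\partial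 x^i}\ln\sigma(x)$. $F$ has weakly isotropic S-curvature if there are a function $c(x)$ and a one-form $\epsilon$ on $M$ with $S(x,y)=(n+1)c(x)F(x,y)+\epsilon(x,y)$ for all $(x,y)\in TM\setminus0$; it has vanishing S-curvature if $S\equiv0$. *)

(* Defs.v *)
From HB Require Import structures.
From mathcomp Require Import all_boot all_order all_algebra.
From mathcomp Require Import all_classical all_reals all_analysis.

Set Implicit Arguments.
Unset Strict Implicit.
Unset Printing Implicit Defensive.

Import Order.TTheory GRing.Theory Num.Theory.
Import numFieldNormedType.Exports.

Local Open Scope classical_set_scope.
Local Open Scope ring_scope.

(* C^infinity on U, meant for U open: f and all its iterated directional
   derivatives are Frechet differentiable at every point of U. *)
Definition smooth_on {R : realType} {V W : normedModType R} (U : set V)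
    (f : V -> W) : Prop :=
  forall (vs : seq V) (x : V), U x ->
    differentiable (foldr (fun v g => 'D_v g) f vs) x.

Definition inner_product {R : realType} {V : lmodType R} (b : V -> V -> R) :
    Prop :=
  [/\ forall u v, b u v = b v u,
      forall a u v w, b (a *: u + v) w = a * b u w + b v w
    & forall u, u != 0 -> 0 < b u u].

(* A homeomorphism from an open subset [cdom] of M onto an open subset [cimg]
   of R^n; the values of [cmap] and [cinv] outside of these are irrelevant. *)
Record chart (R : realType) (n : nat) (M : topologicalType) := Chart {
  cdom : set M;
  cmap :> M -> 'rV[R]_n;
  cinv : 'rV[R]_n -> M;
  cdom_open : open cdom;
  cimg_open : open (cmap @` cdom);
  cmapK : forall p, cdom p -> cinv (cmap p) = p;
  cmap_continuous : forall p, cdom p -> {for p, continuous cmap};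
  cinv_continuous : forall x, (cmap @` cdom) x -> {for x, continuous cinv}
}.

Definition cimg {R : realType} {n} {M : topologicalType} (c : chart R n M) :
  set 'rV[R]_n := c @` cdom c.

Definition compatible {R : realType} {n} {M : topologicalType}
    (c d : chart R n M) : Prop :=
  smooth_on (c @` (cdom c `&` cdom d)) (d \o cinv c) /\
  smooth_on (d @` (cdom c `&` cdom d)) (c \o cinv d).

(* [atlas] is the maximal atlas; [chart_at p] is some chart around p. *)
Record manifold (R : realType) (n : nat) := Manifold {
  carrier :> topologicalType;
  manifold_hausdorff : hausdorff_space carrier;
  manifold_second_countable : @second_countable carrier;
  atlas : set (chart R n carrier);
  chart_at : carrier -> chart R n carrier;
  atlas_chart_at : forall p, atlas (chart_at p);
  mem_chart_at : forall p, cdom (chart_at p) p;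
  atlas_compatible : forall c d, atlas c -> atlas d -> compatible c d;
  atlas_maximal : forall c, (forall d, atlas d -> compatible c d) -> atlas c
}.

Definition smooth_map {R : realType} {m n} {M : manifold R m}
    {N : manifold R n} (f : M -> N) : Prop :=
  continuous f /\
  forall c d, atlas c -> atlas d ->
    smooth_on [set x | cimg c x /\ cdom d (f (cinv c x))] (d \o f \o cinv c).

Definition smooth_map2 {R : realType} {l m n} {M : manifold R l}
    {N : manifold R m} {P : manifold R n} (f : M -> N -> P) : Prop :=
  continuous (fun z : M * N => f z.1 z.2) /\
  forall c d e, atlas c -> atlas d -> atlas e ->
    smooth_on [set z | [/\ cimg c z.1, cimg d z.2
                         & cdom e (f (cinv c z.1) (cinv d z.2))]]
      (fun z : 'rV[R]_l * 'rV[R]_m => e (f (cinv c z.1) (cinv d z.2))).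

Definition diffeomorphism {R : realType} {n} {M : manifold R n} (f : M -> M) :
    Prop :=
  smooth_map f /\ exists2 g : M -> M, smooth_map g & cancel f g /\ cancel g f.

(* The tangent space T_pM is 'rV_n, a vector being represented by its
   coordinates in the preferred chart [chart_at p]; a function on TM is a
   function M -> 'rV_n -> R. [tvec c p y] is the vector y^i d/dx^i of T_pM, for
   (x^i) the local coordinates given by the chart c around p. *)
Definition tvec {R : realType} {n} {M : manifold R n} (c : chart R n M) (p : M)
    (y : 'rV[R]_n) : 'rV[R]_n :=
  'd (chart_at p \o cinv c) (c p) y.

Definition tmap {R : realType} {m n} {M : manifold R m} {N : manifold R n}
    (f : M -> N) (p : M) (v : 'rV[R]_m) : 'rV[R]_n :=
  'd (chart_at (f p) \o f \o cinv (chart_at p)) (chart_at p p) v.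

(* F(x, y) := F(x, y^i d/dx^i) in the local coordinates of c. *)
Definition in_chart {R : realType} {n} {M : manifold R n} (c : chart R n M)
    (F : M -> 'rV[R]_n -> R) : 'rV[R]_n * 'rV[R]_n -> R :=
  fun z => F (cinv c z.1) (tvec c (cinv c z.1) z.2).

Definition one_form {R : realType} {n} {M : manifold R n}
    (eps : M -> 'rV[R]_n -> R) : Prop :=
  (forall p, scalar (eps p)) /\
  forall c, atlas c -> forall i : 'I_n,
    smooth_on (cimg c) (fun x => in_chart c eps (x, delta_mx 0 i) : R^o).

Definition riemannian_metric {R : realType} {n} {M : manifold R n}
    (a : M -> 'rV[R]_n -> 'rV[R]_n -> R) : Prop :=
  (forall p, inner_product (a p)) /\
  forall c, atlas c -> forall i j : 'I_n,
    smooth_on (cimg c)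
      (fun x => a (cinv c x) (tvec c (cinv c x) (delta_mx 0 i))
                             (tvec c (cinv c x) (delta_mx 0 j)) : R^o).

(* Linear subbundle of TM of rank k: subspaces of dimension k, locally spanned
   by k smooth vector fields (here written in the coordinates of c). *)
Definition subbundle {R : realType} {n} {M : manifold R n} (k : nat)
    (V : M -> {vspace 'rV[R]_n}) : Prop :=
  (forall p, \dim (V p) = k) /\
  forall p, exists (c : chart R n M) (U : set M)
                   (X : 'I_k -> 'rV[R]_n -> 'rV[R]_n),
    [/\ atlas c, open U, U p, U `<=` cdom c
      & (forall i, smooth_on (c @` U) (X i)) /\
        forall q, U q -> V q = <<[seq tvec c q (X i (c q)) | i : 'I_k]>>%VS].

Definition minkowski_norm {R : realType} {n} (N : 'rV[R]_n -> R) : Prop :=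
  [/\ continuous N,
      (forall y, 0 <= N y) /\ (forall y, y != 0 -> 0 < N y),
      smooth_on [set y | y != 0] (N : 'rV[R]_n -> R^o),
      forall (lambda : R) y, 0 <= lambda -> N (lambda *: y) = lambda * N y
    & forall y, y != 0 ->
        inner_product
          (fun u v => 2^-1 * 'D_u ('D_v (fun w => N w ^+ 2 : R^o)) y)].

Definition finsler_metric {R : realType} {n} {M : manifold R n}
    (F : M -> 'rV[R]_n -> R) : Prop :=
  [/\ forall p v, 0 <= F p v,
      forall c, atlas c -> forall z, cimg c z.1 ->
        {for z, continuous (in_chart c F)},
      forall c, atlas c ->
        smooth_on [set z | cimg c z.1 /\ z.2 != 0]
          (in_chart c F : _ -> R^o)
    & forall p, minkowski_norm (F p)].

Definition isometry {R : realType} {n} {M : manifold R n}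
    (F : M -> 'rV[R]_n -> R) (f : M -> M) : Prop :=
  diffeomorphism f /\ forall p v, F (f p) (tmap f p v) = F p v.

Definition homogeneous {R : realType} {n} {M : manifold R n}
    (F : M -> 'rV[R]_n -> R) : Prop :=
  forall p q, exists2 f, isometry F f & f p = q.

(* Smoothness on the closed quadrant minus the origin means, as usual for
   non-open sets, local extendability to a smooth function on an open set. *)
Definition alpha12_profile {R : realType} (L : R -> R -> R) : Prop :=
  [/\ forall s t, 0 <= s -> 0 <= t -> 0 <= L s t,
      forall lambda s t, 0 < lambda -> 0 <= s -> 0 <= t ->
        L (lambda * s) (lambda * t) = lambda * L s t
    & forall s t, 0 <= s -> 0 <= t -> (s, t) != (0, 0) ->
        exists (U : set (R^o * R^o)) (g : R^o * R^o -> R^o),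
          [/\ open U, U (s, t), smooth_on U g
            & forall z, U z -> 0 <= z.1 -> 0 <= z.2 -> L z.1 z.2 = g z]].

(* V1 and V2 have positive ranks k1 and k2; alpha(y)^2 = a p y y. *)
Record alpha12_metric {R : realType} {n} {M : manifold R n}
    (F : M -> 'rV[R]_n -> R) (a : M -> 'rV[R]_n -> 'rV[R]_n -> R)
    (V1 V2 : M -> {vspace 'rV[R]_n}) (L : R -> R -> R) : Prop :=
  Alpha12Metric {
    alpha12_riemannian : riemannian_metric a;
    alpha12_subbundle1 : exists2 k1, (0 < k1)%N & subbundle k1 V1;
    alpha12_subbundle2 : exists2 k2, (0 < k2)%N & subbundle k2 V2;
    alpha12_decomposition : forall p, (V1 p + V2 p = fullv)%VS;
    alpha12_orthogonal : forall p u v,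
      u \in V1 p -> v \in V2 p -> a p u v = 0;
    alpha12_L : alpha12_profile L;
    alpha12_F : forall p y1 y2, y1 \in V1 p -> y2 \in V2 p ->
      F p (y1 + y2) = Num.sqrt (L (a p y1 y1) (a p y2 y2))
  }.

Record lie_group (R : realType) (m : nat) := LieGroup {
  lie_manifold :> manifold R m;
  lie_one : lie_manifold;
  lie_inv : lie_manifold -> lie_manifold;
  lie_mul : lie_manifold -> lie_manifold -> lie_manifold;
  lie_mulA : associative lie_mul;
  lie_mul1 : left_id lie_one lie_mul;
  lie_mulV : left_inverse lie_one lie_inv lie_mul;
  lie_inv_smooth : smooth_map lie_inv;
  lie_mul_smooth : smooth_map2 lie_mul
}.

(* For H the stabilizer of o and hh = h, mm = m, the decomposition g = h + m is
   a direct sum with Ad(H) m in m, where g = T_1 G, h = Lie(H) is the kernel of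
   the differential at 1 of the orbit map G -> M, g |-> g o, and Ad(x) is the
   differential at 1 of the conjugation by x. *)
Definition reductive_decomposition {R : realType} {m n} {G : lie_group R m}
    {M : manifold R n} (act : G -> M -> M) (o : M)
    (hh mm : {vspace 'rV[R]_m}) : Prop :=
  [/\ forall v, (v \in hh) = (tmap (act^~ o) (lie_one G) v == 0),
      (hh + mm = fullv)%VS,
      (hh :&: mm = 0)%VS
    & forall x, act x o = o -> forall v, v \in mm ->
        tmap (fun y => lie_mul (lie_mul x y) (lie_inv x)) (lie_one G) v
          \in mm].

(* M = G/H for H the stabilizer of o, with G acting by isometries of F. *)
Record homogeneous_presentation {R : realType} {m n} {M : manifold R n}
    (F : M -> 'rV[R]_n -> R) (G : lie_group R m) (act : G -> M -> M) (o : M) :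
    Prop := HomogeneousPresentation {
  act_one : forall p, act (lie_one G) p = p;
  act_mul : forall x y p, act (lie_mul x y) p = act x (act y p);
  act_smooth : smooth_map2 act;
  act_isometry : forall x, isometry F (act x);
  act_transitive : forall p, exists x, act x o = p;
  act_reductive : exists hh mm, reductive_decomposition act o hh mm
}.

Definition homogeneous_alpha12_metric {R : realType} {n} {M : manifold R n}
    (F : M -> 'rV[R]_n -> R) : Prop :=
  exists (m : nat) (G : lie_group R m) (act : G -> M -> M) (o : M) a V1 V2 L,
    [/\ homogeneous_presentation F act o,
        alpha12_metric F a V1 V2 L,
        forall x p u v,
          a (act x p) (tmap (act x) p u) (tmap (act x) p v) = a p u v,
        forall x p v, v \in V1 p -> tmap (act x) p v \in V1 (act x p)
      & forall x p v, v \in V2 p -> tmap (act x) p v \in V2 (act x p)].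

(* Here f is a function of z = (x, y), as given by [in_chart]. *)

Definition dx {R : realType} {n} (k : 'I_n)
    (f : 'rV[R]_n * 'rV[R]_n -> R) : 'rV[R]_n * 'rV[R]_n -> R :=
  'D_(delta_mx 0 k, 0) (f : _ -> R^o).

Definition dy {R : realType} {n} (k : 'I_n)
    (f : 'rV[R]_n * 'rV[R]_n -> R) : 'rV[R]_n * 'rV[R]_n -> R :=
  'D_(0, delta_mx 0 k) (f : _ -> R^o).

Definition fundamental_tensor {R : realType} {n}
    (f : 'rV[R]_n * 'rV[R]_n -> R) (z : 'rV[R]_n * 'rV[R]_n) : 'M[R]_n :=
  \matrix_(i, j) (2^-1 * dy j (dy i (fun w => f w ^+ 2)) z).

Definition spray {R : realType} {n} (f : 'rV[R]_n * 'rV[R]_n -> R)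
    (i : 'I_n) (z : 'rV[R]_n * 'rV[R]_n) : R :=
  4^-1 * \sum_(l < n) invmx (fundamental_tensor f z) i l *
    (\sum_(k < n) dy l (dx k (fun w => f w ^+ 2)) z * z.2 0 k
     - dx l (fun w => f w ^+ 2) z).

Definition berwald_curvature {R : realType} {n}
    (f : 'rV[R]_n * 'rV[R]_n -> R) (i j k l : 'I_n) :
    'rV[R]_n * 'rV[R]_n -> R :=
  dy l (dy k (dy j (spray f i))).

Definition E_curvature {R : realType} {n} (f : 'rV[R]_n * 'rV[R]_n -> R)
    (i j : 'I_n) (z : 'rV[R]_n * 'rV[R]_n) : R :=
  2^-1 * \sum_(k < n) berwald_curvature f k i j k z.

Definition angular_tensor {R : realType} {n} (f : 'rV[R]_n * 'rV[R]_n -> R)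
    (i j : 'I_n) (z : 'rV[R]_n * 'rV[R]_n) : R :=
  f z * dy j (dy i f) z.

(* n-dimensional Lebesgue (outer) measure, for n > 0: infimum of the total
   volume of the countable covers by boxes \prod_i [a_i, b_i]. *)
Definition box {R : realType} {n} (a b : 'rV[R]_n) : set 'rV[R]_n :=
  [set y | forall i, a 0 i <= y 0 i <= b 0 i].

Definition volume {R : realType} {n} (A : set 'rV[R]_n) : \bar R :=
  ereal_inf [set v | exists a b : nat -> 'rV[R]_n,
    [/\ forall k i, a k 0 i <= b k 0 i,
        A `<=` \bigcup_k box (a k) (b k)
      & v = (\sum_(0 <= k <oo) (\prod_(i < n) (b k 0 i - a k 0 i))%:E)%E]].

(* Density of the Busemann-Hausdorff measure. *)
Definition sigma_BH {R : realType} {n} (f : 'rV[R]_n * 'rV[R]_n -> R)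
    (x : 'rV[R]_n) : R :=
  fine (volume [set y : 'rV[R]_n | \sum_(i < n) y 0 i ^+ 2 < 1]) /
  fine (volume [set y : 'rV[R]_n | f (x, y) < 1]).

Definition S_curvature {R : realType} {n} (f : 'rV[R]_n * 'rV[R]_n -> R)
    (z : 'rV[R]_n * 'rV[R]_n) : R :=
  \sum_(i < n) dy i (spray f i) z
  - \sum_(i < n) z.2 0 i *
      'D_(delta_mx 0 i) (fun x => ln (sigma_BH f x) : R^o) z.1.

(* The conditions are imposed at each (c p, y) with y != 0, for each chart c of
   the smooth structure around p. *)

Definition weakly_isotropic_S {R : realType} {n} {M : manifold R n}
    (F : M -> 'rV[R]_n -> R) : Prop :=
  exists (k : M -> R) (eps : M -> 'rV[R]_n -> R), one_form eps /\
    forall c, atlas c -> forall p, cdom c p -> forall y, y != 0 ->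
      S_curvature (in_chart c F) (c p, y) =
        n.+1%:R * k p * F p (tvec c p y) + eps p (tvec c p y).

Definition vanishing_S {R : realType} {n} {M : manifold R n}
    (F : M -> 'rV[R]_n -> R) : Prop :=
  forall c, atlas c -> forall p, cdom c p -> forall y, y != 0 ->
    S_curvature (in_chart c F) (c p, y) = 0.

Definition isotropic_E {R : realType} {n} {M : manifold R n}
    (F : M -> 'rV[R]_n -> R) : Prop :=
  exists k : M -> R,
    forall c, atlas c -> forall p, cdom c p -> forall y, y != 0 ->
    forall i j : 'I_n,
      E_curvature (in_chart c F) i j (c p, y) =
        n.+1%:R / 2 * k p * (F p (tvec c p y))^-1 *
          angular_tensor (in_chart c F) i j (c p, y).

Definition vanishing_E {R : realType} {n} {M : manifold R n}
    (F : M -> 'rV[R]_n -> R) : Prop :=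
  forall c, atlas c -> forall p, cdom c p -> forall y, y != 0 ->
    forall i j : 'I_n, E_curvature (in_chart c F) i j (c p, y) = 0.

(* Main.v *)
(* Write [F^2 = L(alpha_1^2, alpha_2^2)]. In an alpha-orthonormal frame adapted to
   [V1 + V2] the unit ball of [F] does not depend on the point, so the
   Busemann-Hausdorff density is a constant multiple of the square root of the
   Gram determinant of alpha, and [det (g_ij(x, y)) / det (a_ij(x))] is a function
   of the ratio [alpha_2(y) / alpha_1(y)] only, which is even in that ratio.
   The spray vector field differentiates [det (g_ij)] to twice itself times the
   divergence of the spray, and along the spray line through a vector of [V1] the
   ratio is O(t). As an even differentiable function has derivative 0 at 0, the
   S-curvature vanishes on [V1], and by symmetry on [V2].
   The S-curvature is odd in [y] because [F] is even. If it is weakly isotropic,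
   parity makes it a one-form, which vanishes on [V1] and on [V2], so everywhere.
   The E-curvature is the vertical Hessian of the S-curvature up to a factor: it
   vanishes with S, it is odd in [y] whereas [F^-1 h_ij] is even, and if it
   vanishes then S is affine on the lines [y1 + t y2] and [y2 + t y1]; together
   with oddness and the vanishing on [V1] and [V2] this gives [S = 0]. *)

Require Import Defs.
From HB Require Import structures.
From mathcomp Require Import all_boot all_order all_algebra all_fingroup.
From mathcomp Require Import all_classical all_reals all_analysis.
From mathcomp Require Import ring lra.

Set Implicit Arguments.
Unset Strict Implicit.
Unset Printing Implicit Defensive.

Import Order.TTheory GRing.Theory Num.Theory.
Import numFieldNormedType.Exports.

Local Open Scope classical_set_scope.
Local Open Scope ring_scope.

(** Adapted orthonormal frames are chosen separately at each point, with no regularity in the point.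
    The quotient of [\det g] by the Gram determinant is therefore never differentiated through a
    frame: it is compared, point by point, with one function [q] of a real variable attached to a
    fixed frame at a fixed point. The ratio of the two components need not be differentiable along
    the spray line either, being a quotient of norms whose numerator vanishes at the start. The
    estimates [q(r) - q(0) = o(r)] and [r = O(t)] take the place of the chain rule, and only the two
    determinants, which are smooth in a chart, are differentiated. The density formula needs a
    change of variables for [volume], which is an infimum over covers by boxes. This is proved for
    elementary matrices first. Balls must moreover have finite and positive volume, as [fine] would
    otherwise lose the value; positivity comes from counting lattice points in the unit cube. *)

Section SmoothCalculus.
Context {R : realType}.
Implicit Types V W : normedModType R.

(** * Calculus of smooth functions on open sets *)

Lemma near_eq_differentiable V W (f g : V -> W) x :
  {near x, f =1 g} -> differentiable f x -> differentiable g x.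
Proof.
move=> fg df; apply/diff_locallyP.
have gE : g \o shift x = cst (g x) + 'd f x +o_ 0 id.
  apply/eqaddoP => e e0.
  have /diff_locally/eqaddoP/(_ e e0) := df.
  have fg0 : \forall h \near (0 : V), f (h + x) = g (h + x).
    by have := fg; rewrite (near_shift 0) subr0.
  apply: filter_app; near=> h.
  have gh : g (h + x) = f (h + x) by symmetry; near: h.
  rewrite !fctE /= gh (nbhs_singleton fg).
  by [].
have dgf : 'd g x = 'd f x :> (V -> W).
  by apply: diff_unique => //; apply: diff_continuous.
split; first by rewrite dgf; apply: diff_continuous.
by rewrite -dgf in gE; exact: gE.
Unshelve. all: by end_near. Qed.

(** Smoothness of finite order supports induction on the order for all functions at once: the
    derivative of a product is a sum of products of functions of lower order, whereas [smooth_on]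
    commits to one list of directions. *)
Fixpoint Ck V W (U : set V) (k : nat) (f : V -> W) : Prop :=
  (forall x, U x -> differentiable f x) /\
  (if k is k'.+1 then forall v, Ck U k' ('D_v f) else True).

Lemma Ck_differentiable V W (U : set V) k (f : V -> W) x :
  Ck U k f -> U x -> differentiable f x.
Proof. by case: k => [|k] [+ _]; apply. Qed.

Lemma smooth_on_differentiable V W (U : set V) (f : V -> W) x :
  smooth_on U f -> U x -> differentiable f x.
Proof. by move=> /(_ [::]); apply. Qed.

Lemma smooth_on_derive V W (U : set V) (f : V -> W) v :
  smooth_on U f -> smooth_on U ('D_v f).
Proof. by move=> sf vs; move: (sf (rcons vs v)); rewrite foldr_rcons. Qed.

Lemma smooth_onP V W (U : set V) (f : V -> W) :
  smooth_on U f <-> forall k, Ck U k f.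
Proof.
split=> [sf k|Cf vs].
  elim: k f sf => [|k IH] f sf; first by split=> // x; apply: (sf [::]).
  split=> [x|v]; first exact: (sf [::]).
  exact/IH/smooth_on_derive.
(* The list is peeled from its end because its last entry is the direction differentiated first. *)
elim/last_ind: vs f Cf => [|vs v IH] f Cf x Ux.
  by have [+ _] := Cf 0%N; apply.
rewrite foldr_rcons; apply: IH => // k.
by have [_] := Cf k.+1; apply.
Qed.

Lemma smooth_on_Ck V W (U : set V) (f : V -> W) k : smooth_on U f -> Ck U k f.
Proof. by move=> /smooth_onP. Qed.

Lemma Ck_weaken V W (U : set V) k (f : V -> W) : Ck U k.+1 f -> Ck U k f.
Proof.
elim: k f => [|k IH] f; first by case.
by case=> df Df; split=> // v; apply: IH.
Qed.

Lemma near_open V (U : set V) (P : V -> Prop) x :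
  open U -> U x -> (forall y, U y -> P y) -> \forall y \near x, P y.
Proof.
move=> oU Ux UP; have : nbhs x U by apply: open_nbhs_nbhs; split.
by apply: filterS.
Qed.

Lemma eq_derive_on V W (U : set V) (f g : V -> W) v x :
  open U -> (forall y, U y -> f y = g y) -> U x -> 'D_v f x = 'D_v g x.
Proof.
by move=> oU fg Ux; apply: near_eq_derive; apply: (near_open oU Ux).
Qed.

Lemma eq_Ck V W (U : set V) k (f g : V -> W) :
  open U -> (forall y, U y -> f y = g y) -> Ck U k f -> Ck U k g.
Proof.
move=> oU; elim: k f g => [|k IH] f g fg [df Df]; split=> //.
- move=> x Ux; apply: (near_eq_differentiable _ (df x Ux)).
  by apply: (near_open oU Ux).
- move=> x Ux; apply: (near_eq_differentiable _ (df x Ux)).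
  by apply: (near_open oU Ux).
- move=> v; apply: IH (Df v) => y Uy.
  exact: eq_derive_on Uy.
Qed.

Lemma eq_smooth_on V W (U : set V) (f g : V -> W) :
  open U -> (forall y, U y -> f y = g y) -> smooth_on U f -> smooth_on U g.
Proof.
by move=> oU fg /smooth_onP Cf; apply/smooth_onP => k; apply: eq_Ck (Cf k).
Qed.

Lemma smooth_on_cst V W (U : set V) (a : W) : smooth_on U (cst a).
Proof.
apply/smooth_onP => k; elim: k a => [|k IH] a; split=> //.
move=> v; suff -> : 'D_v (cst a : V -> W) = cst 0 by apply: IH.
by apply/funext => y /=; rewrite derive_cst.
Qed.

Lemma CkD V W (U : set V) k (f g : V -> W) : open U ->
  Ck U k f -> Ck U k g -> Ck U k (f + g).
Proof.
move=> oU; elim: k f g => [|k IH] f g [df Df] [dg Dg].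
  split; last exact: I.
  by move=> x Ux; apply: differentiableD; [apply: df|apply: dg].
split=> [x Ux|v]; first by apply: differentiableD; [apply: df|apply: dg].
apply: (eq_Ck oU) (IH _ _ (Df v) (Dg v)) => y Uy.
by rewrite deriveD //; apply: diff_derivable; [apply: df|apply: dg].
Qed.

Lemma smooth_onD V W (U : set V) (f g : V -> W) : open U ->
  smooth_on U f -> smooth_on U g -> smooth_on U (f + g).
Proof.
move=> oU /smooth_onP Cf /smooth_onP Cg; apply/smooth_onP => k.
exact: CkD.
Qed.

Lemma smooth_on_sum V W (U : set V) (I : Type) (r : seq I) (P : pred I)
    (f : I -> V -> W) : open U ->
  (forall i, P i -> smooth_on U (f i)) ->
  smooth_on U (fun x => \sum_(i <- r | P i) f i x).
Proof.
move=> oU sf; rewrite -fct_sumE.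
elim/big_rec: _ => [|i g Pi sg]; first exact: smooth_on_cst.
by apply: smooth_onD => //; apply: sf.
Qed.

Lemma Ck_M V (U : set V) k (f g : V -> R^o) : open U ->
  Ck U k f -> Ck U k g -> Ck U k (fun x => f x * g x : R^o).
Proof.
move=> oU; elim: k f g => [|k IH] f g Cf Cg.
  split; last exact: I.
  move=> x Ux; apply: differentiableM; first exact: Ck_differentiable Cf Ux.
  exact: Ck_differentiable Cg Ux.
have [df Df] := Cf; have [dg Dg] := Cg.
split=> [x Ux|v]; first by apply: differentiableM; [apply: df|apply: dg].
apply: (eq_Ck oU) (CkD oU (IH _ _ (Ck_weaken Cf) (Dg v))
                          (IH _ _ (Ck_weaken Cg) (Df v))) => y Uy.
by rewrite (@deriveM _ _ f g) //; apply: diff_derivable; [apply: df|apply: dg].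
Qed.

Lemma smooth_onM V (U : set V) (f g : V -> R^o) : open U ->
  smooth_on U f -> smooth_on U g -> smooth_on U (fun x => f x * g x : R^o).
Proof.
move=> oU /smooth_onP Cf /smooth_onP Cg; apply/smooth_onP => k.
exact: Ck_M.
Qed.

Lemma smooth_on_prod V (U : set V) (I : Type) (r : seq I) (P : pred I)
    (f : I -> V -> R^o) : open U ->
  (forall i, P i -> smooth_on U (f i)) ->
  smooth_on U (fun x => \prod_(i <- r | P i) f i x : R^o).
Proof.
move=> oU sf; elim: r => [|i r IH].
  rewrite (_ : (fun _ => _) = cst 1) ; first exact: smooth_on_cst.
  by apply/funext => x; rewrite big_nil.
case Pi : (P i).
  rewrite (_ : (fun _ => _) = fun x => f i x * \prod_(j <- r | P j) f j x).
    by apply: smooth_onM => //; apply: sf.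
  by apply/funext => x; rewrite big_cons Pi.
rewrite (_ : (fun _ => _) = fun x => \prod_(j <- r | P j) f j x) //.
by apply/funext => x; rewrite big_cons Pi.
Qed.

Lemma smooth_onN V W (U : set V) (f : V -> W) : open U ->
  smooth_on U f -> smooth_on U (- f).
Proof.
move=> oU /smooth_onP Cf; apply/smooth_onP => k.
elim: k f {Cf}(Cf k) => [|k IH] f [df Df].
  by split; [move=> x Ux; apply: differentiableN; apply: df|exact: I].
split=> [x Ux|v]; first by apply: differentiableN; apply: df.
apply: (eq_Ck oU) (IH _ (Df v)) => y Uy.
by rewrite deriveN //; apply: diff_derivable; apply: df.
Qed.

Lemma smooth_onB V W (U : set V) (f g : V -> W) : open U ->
  smooth_on U f -> smooth_on U g -> smooth_on U (fun x => f x - g x).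
Proof.
by move=> oU sf sg; apply: (smooth_onD oU sf); apply: smooth_onN.
Qed.

(** The derivative [- 'D_v f / f ^ 2] contains only [1 / f] and a derivative of [f], so the
    induction on the order runs with [f] fixed. *)
Lemma smooth_onV V (U : set V) (f : V -> R^o) : open U ->
  (forall x, U x -> f x != 0) ->
  smooth_on U f -> smooth_on U (fun x => (f x)^-1 : R^o).
Proof.
move=> oU f0 sf; apply/smooth_onP => k.
have dV x : U x -> differentiable (fun x => (f x)^-1 : R^o) x.
  move=> Ux; apply: (@differentiableV _ _ f) (f0 x Ux).
  exact: smooth_on_differentiable sf Ux.
elim: k => [|k IH]; first by split; [exact: dV|exact: I].
split=> [|v]; first exact: dV.
have : Ck U k (fun x => - ('D_v f x * ((f x)^-1 * (f x)^-1)) : R^o).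
  pose h := fun x => ('D_v f x * ((f x)^-1 * (f x)^-1)) : R^o.
  have : Ck U k h.
    apply: Ck_M => //; last exact: Ck_M.
    exact/smooth_on_Ck/smooth_on_derive.
  have m1 : Ck U k (cst (-1) : V -> R^o) by apply/smooth_on_Ck/smooth_on_cst.
  move=> /(Ck_M oU m1); apply: eq_Ck => // y Uy.
  by rewrite mulN1r.
apply: eq_Ck => // y Uy.
rewrite (@deriveV _ _ f) ?f0//.
  by rewrite scaleNr /GRing.scale /= mulrC expr2 invfM.
exact/diff_derivable/(smooth_on_differentiable sf).
Qed.

Lemma smooth_on_linear V W (U : set V) (f : {linear V -> W}) :
  continuous f -> smooth_on U f.
Proof.
move=> cf; apply/smooth_onP; have df x : differentiable f x by apply: linear_differentiable.
case=> [|k]; first by split; [move=> x _; apply: df|exact: I].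
split=> [x _|v]; first exact: df.
suff -> : 'D_v f = cst (f v) by apply/smooth_on_Ck/smooth_on_cst.
by apply/funext => x; rewrite deriveE; [rewrite diff_lin|exact: df].
Qed.

Lemma derive_line V W (f : V -> W) x u s :
  (derivable (fun s : R => f (x + s *: u)) s 1 <-> derivable f (x + s *: u) u) /\
  'D_1 (fun s : R => f (x + s *: u)) s = 'D_u f (x + s *: u).
Proof.
rewrite /derivable /derive.
suff -> : (fun h : R => h^-1 *: (((fun s : R => f (x + s *: u)) \o shift s)
    (h *: 1) - f (x + s *: u))) =
  (fun h => h^-1 *: ((f \o shift (x + s *: u)) (h *: u) - f (x + s *: u))) by [].
apply/funext => h /=; congr (_ *: (f _ - _)).
by rewrite scalerDl addrCA [h%:A]mulr1.
Qed.

Lemma is_derive_line V W (f : V -> W) x u s :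
  differentiable f (x + s *: u) ->
  is_derive s 1 (fun s : R => f (x + s *: u)) ('D_u f (x + s *: u)).
Proof.
move=> df; have [h1 h2] := derive_line f x u s.
by split; [exact: (iffRL h1 (diff_derivable df))|rewrite h2].
Qed.

(* Chain rule along a linear map, an identity of difference quotients that
   needs no differentiability. *)
Lemma derive_linear V1 V2 W (L : V1 -> V2) (f : V2 -> W) v : linear L ->
  'D_v (f \o L) = ('D_(L v) f) \o L.
Proof.
move=> linL; apply/funext => x /=; rewrite /derive.
suff -> : (fun h : R => h^-1 *: (((f \o L) \o shift x) (h *: v) - (f \o L) x)) =
  (fun h => h^-1 *: ((f \o shift (L x)) (h *: L v) - f (L x))) by [].
by apply/funext => h /=; rewrite linL.
Qed.

End SmoothCalculus.

Lemma derive_slice {R : realType} {n : nat} (u : 'rV[R]_n * 'rV[R]_n -> R^o) x v y :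
  'D_(0, v) u (x, y) = 'D_v (fun w => u (x, w) : R^o) y.
Proof.
rewrite /derive.
suff -> : (fun h : R => h^-1 *: ((u \o shift (x, y)) (h *: ((0, v) : 'rV[R]_n * 'rV[R]_n)) - u (x, y))) =
  (fun h : R => h^-1 *: (((fun w => u (x, w)) \o shift y) (h *: v) - u (x, y))) by [].
apply/funext => h /=; congr (_ *: (u _ - _)).
by apply/pair_eqP/andP; split; apply/eqP; rewrite /= ?scaler0 ?add0r.
Qed.

(** * Symmetry of second derivatives *)

Section SecondDerivatives.
Context {R : realType}.
Implicit Types V W : normedModType R.

Lemma differentiable_bound V W (f : V -> W) x (e : R) : differentiable f x -> 0 < e ->
  exists2 d : R, 0 < d &
    forall k, `|k| < d -> `|f (x + k) - f x - 'd f x k| <= e * `|k|.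
Proof.
move=> /diff_locally/eqaddoP df e0; have := df e e0.
move=> /nbhs_ballP[d /= d0 dP]; exists d => // k kd.
have := dP k; rewrite -ball_normE /= sub0r normrN => /(_ kd).
by rewrite !fctE /= opprD addrA [k + x]addrC.
Qed.

Lemma open_ball_sub V (U : set V) x : open U -> U x ->
  exists2 d : R, 0 < d & forall k, `|k| < d -> U (x + k).
Proof.
move=> oU Ux; have /nbhs_ballP[d /= d0 dP] : nbhs x U by apply: open_nbhs_nbhs.
exists d => // k kd; apply: dP; rewrite -ball_normE /=.
by rewrite opprD addNKr normrN.
Qed.

(* The second difference of [f] at [x] is [h ^ 2] times the mixed derivative up
   to o(h ^ 2); its symmetry in [u] and [v] gives Schwarz's theorem. *)
Lemma second_difference V (U : set V) (f : V -> R^o) u v x (e : R) :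
  open U -> U x -> (forall y, U y -> differentiable f y) ->
  differentiable ('D_u f) x -> 0 < e ->
  exists2 d : R, 0 < d & forall h : R, 0 < h -> h < d ->
    `|f (x + h *: u + h *: v) - f (x + h *: u) - (f (x + h *: v) - f x)
      - h ^+ 2 * 'D_v ('D_u f) x| <= e * h ^+ 2.
Proof.
move=> oU Ux df dDf e0.
(* The increments used below are [h *: v + c *: u] and [c *: u] with [0 <= c <= h]; their norms add
   up to at most [h * (2 * |u| + |v|)]. The 1 makes [C] positive. *)
pose C := 2 * `|u| + `|v| + 1.
have C0 : 0 < C.
  by rewrite /C ltr_wpDl// addr_ge0// mulr_ge0.
have [d1 d10 d1P] := open_ball_sub oU Ux.
have [d2 d20 d2P] := differentiable_bound dDf (divr_gt0 e0 C0).
exists (Num.min d1 d2 / C) => [|h h0]; first by rewrite divr_gt0// lt_min d10.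
rewrite ltr_pdivlMr// lt_min => /andP[hd1 hd2].
have bnd1 (c : R) : 0 <= c -> c <= h -> `|h *: v + c *: u| <= h * (`|u| + `|v|).
  move=> c0 ch; rewrite (le_trans (ler_normD _ _))// !normrZ (gtr0_norm h0) (ger0_norm c0).
  by rewrite mulrDr [leRHS]addrC lerD2l ler_wpM2r.
have bnd2 (c : R) : 0 <= c -> c <= h -> `|c *: u| <= h * `|u|.
  by move=> c0 ch; rewrite normrZ ger0_norm// ler_wpM2r.
have small (d c : R) : h * C < d -> 0 <= c -> c <= h ->
    `|h *: v + c *: u| < d /\ `|c *: u| < d.
  move=> hCd c0 ch; split.
    apply: le_lt_trans (bnd1 c c0 ch) (le_lt_trans _ hCd).
    rewrite ler_wpM2l ?ltW// /C; have := normr_ge0 u; lra.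
  apply: le_lt_trans (bnd2 c c0 ch) (le_lt_trans _ hCd).
  rewrite ler_wpM2l ?ltW// /C; have := normr_ge0 u; have := normr_ge0 v; lra.
(* The second difference is the increment of [psi] over [[0, h]]. The mean value theorem turns it
   into a difference of values of ['D_u f], to which the first order expansion at [x] applies
   twice. *)
pose psi s : R := f (x + h *: v + s *: u) - f (x + s *: u).
have dpsi s : 0 <= s -> s <= h ->
    is_derive s 1 psi ('D_u f (x + h *: v + s *: u) - 'D_u f (x + s *: u)).
  move=> s0 sh; have [h1 h2] := small _ _ hd1 s0 sh.
  apply: is_deriveB; apply: is_derive_line; apply: df.
    by rewrite -addrA; apply: d1P.
  exact: d1P.
have [c] : exists2 c, c \in `]0, h[%R & psi h - psi 0 =
    ('D_u f (x + h *: v + c *: u) - 'D_u f (x + c *: u)) * (h - 0).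
  apply: (@MVT _ psi (fun c => 'D_u f (x + h *: v + c *: u) - 'D_u f (x + c *: u))) => //.
    by move=> s; rewrite in_itv /= => /andP[s0 s1]; apply: dpsi; apply: ltW.
  apply: derivable_within_continuous => s; rewrite in_itv /= => /andP[s0 s1].
  by have [] := dpsi s s0 s1.
rewrite in_itv /= => /andP[/ltW c0 /ltW ch].
rewrite /psi !scale0r !addr0 subr0 => psiE.
have -> : f (x + h *: u + h *: v) - f (x + h *: u) - (f (x + h *: v) - f x) =
    ('D_u f (x + h *: v + c *: u) - 'D_u f (x + c *: u)) * h.
  by rewrite -psiE (addrAC x (h *: v)) !opprB addrACA addrAC.
have [h1 h2] := small _ _ hd2 c0 ch.
have := d2P _ h1; have := d2P _ h2.
have dZ k (w : V) : 'd ('D_u f) x (k *: w) = k * ('d ('D_u f) x w : R).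
  exact: linearZ_LR.
rewrite addrA (linearD ('d ('D_u f) x)) !dZ -(deriveE v dDf).
move: ('D_u f (x + h *: v + c *: u) : R) ('D_u f (x + c *: u) : R)
  ('D_v ('D_u f) x : R) ('d ('D_u f) x u : R) ('D_u f x : R).
move=> A B D E g0 hB hA.
rewrite (_ : (A - B) * h - h ^+ 2 * D =
  h * ((A - g0 - (h * D + c * E)) - (B - g0 - c * E))); last by ring.
rewrite normrM (gtr0_norm h0).
have -> : e * h ^+ 2 = h * (e * h) by ring.
rewrite ler_wpM2l ?(ltW h0)// (le_trans (ler_normB _ _))//.
rewrite (le_trans (lerD hA hB))// -mulrDr.
rewrite -mulrA ler_wpM2l ?(ltW e0)// ler_pdivrMl//.
have := bnd1 c c0 ch; have := bnd2 c c0 ch.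
rewrite /C; nra.
Qed.

Lemma derive_comm V (U : set V) (f : V -> R^o) u v x :
  open U -> smooth_on U f -> U x -> 'D_u ('D_v f) x = 'D_v ('D_u f) x.
Proof.
move=> oU sf Ux; apply/eqP; rewrite -subr_eq0 -normr_eq0 -[_ == 0]negbK.
apply/negP; set A := 'D_u _ x; set B := 'D_v _ x => n0.
(* Two errors of a quarter each bound [|A - B|] by half of itself, a contradiction. *)
have e0 : 0 < `|A - B| / 4 by rewrite divr_gt0// lt_def n0 /=.
have df w : differentiable ('D_w f) x.
  exact: smooth_on_differentiable (smooth_on_derive _ sf) Ux.
have dfU y : U y -> differentiable f y by exact: smooth_on_differentiable.
have [d1 d10 d1P] := second_difference v oU Ux dfU (df u) e0.
have [d2 d20 d2P] := second_difference u oU Ux dfU (df v) e0.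
pose h := Num.min d1 d2 / 2.
have h0 : 0 < h by rewrite divr_gt0// lt_min d10.
have hm : h < Num.min d1 d2 by rewrite /h; have : 0 < Num.min d1 d2; [rewrite lt_min d10|lra].
move: hm; rewrite lt_min => /andP[hd1 hd2].
have := d1P h h0 hd1; have := d2P h h0 hd2.
rewrite -/A -/B.
have -> : f (x + h *: v + h *: u) - f (x + h *: v) - (f (x + h *: u) - f x) =
  f (x + h *: u + h *: v) - f (x + h *: u) - (f (x + h *: v) - f x).
  by rewrite (addrAC x (h *: v)) /=; ring.
set D := _ - _ - (_ - _) => h1 h2.
have hh : 0 < h ^+ 2 by rewrite exprn_gt0.
have : `|h ^+ 2 * (A - B)| <= `|A - B| / 4 * h ^+ 2 + `|A - B| / 4 * h ^+ 2.
  apply: le_trans (lerD h2 h1); rewrite (le_trans _ (ler_normB _ _))//.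
  rewrite le_eqVlt; apply/orP; left; apply/eqP; congr `|_|; rewrite /=; ring.
rewrite normrM (gtr0_norm hh) -mulrDl mulrC ler_pM2r//.
have : 0 < `|A - B| by rewrite lt_def n0 /=.
by move: `|A - B| => a {hh hd1 hd2 h1 h2 d1P d2P e0 df dfU}; lra.
Qed.

End SecondDerivatives.

(** * Derivatives of determinants and inverse matrices *)

Section DerivativeOfDeterminant.
Context {R : realType} {V : normedModType R}.
Implicit Types (U : set V) (x v : V).

Lemma is_derive_bigsum (I : Type) (r : seq I) (P : pred I) (h : I -> V -> R^o)
    (dh : I -> R) x v :
  (forall i, P i -> is_derive x v (h i) (dh i)) ->
  is_derive x v (fun y => \sum_(i <- r | P i) h i y : R^o)
    (\sum_(i <- r | P i) dh i).
Proof.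
move=> dhP; rewrite -(fct_sumE r P h).
elim: r => [|i r IH]; first by rewrite !big_nil; apply: is_derive_cst.
rewrite !big_cons; case: ifPn => // Pi.
by apply: is_deriveD; exact: dhP.
Qed.

Lemma is_derive_mul (u w : V -> R^o) (du dw : R) x v :
  is_derive x v u du -> is_derive x v w dw ->
  is_derive x v (fun y => u y * w y : R^o) (u x * dw + w x * du).
Proof. by move=> hu hw; apply: (@is_deriveM _ _ u w). Qed.

(** The differentiated factor is singled out by equality of indices, hence the duplicate-free
    list. *)
Lemma is_derive_bigprod (I : eqType) (r : seq I) (h : I -> V -> R^o)
    (dh : I -> R) x v : uniq r ->
  (forall i, is_derive x v (h i) (dh i)) ->
  is_derive x v (fun y => \prod_(i <- r) h i y : R^o)
    (\sum_(i <- r) \prod_(j <- r) (if j == i then dh j else h j x)).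
Proof.
move=> + dhP; elim: r => [_|k r IH /= /andP[kr ur]].
  rewrite big_nil (_ : (fun _ => _) = cst 1); first exact: is_derive_cst.
  by apply/funext => y; rewrite big_nil.
rewrite (_ : (fun _ => _) = h k * (fun y => \prod_(i <- r) h i y)); last first.
  by apply/funext => y; rewrite big_cons.
apply: (is_derive_eq (@is_deriveM _ _ (h k) (fun y => \prod_(i <- r) h i y : R)
  x v _ _ (dhP k) (IH ur))).
rewrite big_cons addrC; congr (_ + _).
  rewrite big_cons eqxx /GRing.scale /= mulrC; congr (_ * _).
  rewrite big_seq [RHS]big_seq; apply: eq_bigr => j jr.
  by case: eqP => // jk; rewrite -jk jr in kr.
rewrite /GRing.scale /= big_distrr /= big_seq [RHS]big_seq; apply: eq_bigr => i ir.
by rewrite big_cons; case: eqP => // ki; rewrite ki ir in kr.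
Qed.

(* Jacobi's formula. *)
Lemma is_derive_det n (G : V -> 'M[R]_n) (dG : 'M[R]_n) x v :
  (forall i j, is_derive x v (fun y => G y i j : R^o) (dG i j)) ->
  is_derive x v (fun y => \det (G y) : R^o)
    (\sum_i \sum_j dG i j * cofactor (G x) i j).
Proof.
move=> dGP.
(* Differentiating one row at a time: expanding [\det (H i)] along its row [i] meets only the
   cofactors of [G x]. *)
pose H i := \matrix_(k, l) (if k == i then dG k l else G x k l).
have -> : \sum_i \sum_j dG i j * cofactor (G x) i j = \sum_i \det (H i).
  apply: eq_bigr => i _; rewrite (expand_det_row _ i); apply: eq_bigr => j _.
  rewrite mxE eqxx; congr (_ * _); rewrite /cofactor; congr (_ * \det _).
  by apply/matrixP => k l; rewrite !mxE eq_sym (negPf (neq_lift _ _)).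
have -> : \sum_i \det (H i) = \sum_(s : 'S_n) (-1) ^+ s *
    \sum_i \prod_j (if j == i then dG j (s j) else G x j (s j)).
  rewrite exchange_big /=; apply: eq_bigr => s _; rewrite big_distrr /=.
  apply: eq_bigr => i _; congr (_ * _); apply: eq_bigr => j _.
  by rewrite mxE.
apply: is_derive_bigsum => s _.
pose p y := \prod_(i < n) G y i (s i) : R^o.
rewrite (_ : (fun _ => _) = (-1) ^+ s *: p) //.
apply: is_deriveZ; apply: is_derive_bigprod; exact: index_enum_uniq.
Qed.

Lemma invmx_cofactor n (A : 'M[R]_n) i j : A \in unitmx ->
  invmx A i j = (\det A)^-1 * cofactor A j i.
Proof. by move=> Au; rewrite /invmx Au mxE [in LHS]mxE. Qed.

(** The double sum is the trace of [invmx (G x) *m dG], the shape in which the divergence of the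
    spray will appear. *)
Lemma is_derive_det_invmx n (G : V -> 'M[R]_n) (dG : 'M[R]_n) x v :
  G x \in unitmx ->
  (forall i j, is_derive x v (fun y => G y i j : R^o) (dG i j)) ->
  is_derive x v (fun y => \det (G y) : R^o)
    (\det (G x) * \sum_l \sum_m invmx (G x) m l * dG l m).
Proof.
move=> Gu dGP; apply: (is_derive_eq (is_derive_det dGP)).
rewrite big_distrr /=.
apply: eq_bigr => l _; rewrite big_distrr /=; apply: eq_bigr => m _.
have detG : \det (G x) != 0 by move: Gu; rewrite unitmxE unitfE.
by rewrite (invmx_cofactor _ _ Gu) -[in RHS]mulrA mulVKf // mulrC.
Qed.

Lemma smooth_on_det n U (G : V -> 'M[R]_n) : open U ->
  (forall i j, smooth_on U (fun y => G y i j : R^o)) ->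
  smooth_on U (fun y => \det (G y) : R^o).
Proof.
move=> oU sG; rewrite /determinant; apply: smooth_on_sum => // s _.
apply: smooth_onM => //; first exact: smooth_on_cst.
by apply: smooth_on_prod.
Qed.

Lemma smooth_on_invmx n U (G : V -> 'M[R]_n) : open U ->
  (forall y, U y -> G y \in unitmx) ->
  (forall i j, smooth_on U (fun y => G y i j : R^o)) ->
  forall i j, smooth_on U (fun y => invmx (G y) i j : R^o).
Proof.
move=> oU Gu sG i j.
have sC : smooth_on U (fun y => (\det (G y))^-1 * cofactor (G y) j i : R^o).
  apply: smooth_onM => //.
    apply: smooth_onV => //; last exact: smooth_on_det.
    by move=> y /Gu; rewrite unitmxE unitfE.
  rewrite /cofactor; apply: smooth_onM => //; first exact: smooth_on_cst.
  apply: smooth_on_det => // k l.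
  by under eq_fun do rewrite !mxE; apply: sG.
apply: eq_smooth_on sC => // y Uy.
by rewrite invmx_cofactor ?Gu.
Qed.

End DerivativeOfDeterminant.

#[local] Opaque derive.

Lemma sum_mul_delta (R : pzRingType) (I : finType) (F : I -> R) m :
  \sum_k F k * (m == k)%:R = F m.
Proof.
rewrite (bigD1 m) //= eqxx mulr1 big1 ?addr0 // => k km.
by rewrite eq_sym (negPf km) mulr0.
Qed.

(** * The divergence of the spray and the determinant of the fundamental tensor *)

Section Spray.
Context {R : realType} {n : nat}.
Notation V := ('rV[R]_n * 'rV[R]_n)%type.
Variable Om : set V.
Hypothesis oOm : open Om.

Lemma smooth_on_dy k (h : V -> R) :
  smooth_on Om (h : V -> R^o) -> smooth_on Om (dy k h : V -> R^o).
Proof. exact: smooth_on_derive. Qed.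

Lemma smooth_on_dx k (h : V -> R) :
  smooth_on Om (h : V -> R^o) -> smooth_on Om (dx k h : V -> R^o).
Proof. exact: smooth_on_derive. Qed.

Lemma smooth_on_coord2 k : smooth_on Om (fun z : V => z.2 0 k : R^o).
Proof.
have lin : linear (fun z : V => z.2 0 k : R^o).
  by move=> a u v; rewrite !mxE.
pose L : {linear V -> R^o} :=
  HB.pack (fun z : V => z.2 0 k : R^o) (GRing.isLinear.Build _ _ _ _ _ lin).
apply: (@smooth_on_linear _ _ _ Om L) => z.
apply: (@continuous_comp _ _ _ snd (fun y : 'rV[R]_n => y 0 k)).
  exact: cvg_snd.
exact: coord_continuous.
Qed.

Lemma derive_coord2 k v z : 'D_v (fun z : V => z.2 0 k : R^o) z = v.2 0 k.
Proof.
have lin : linear (fun z : V => z.2 0 k : R^o) by move=> a u w; rewrite !mxE.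
have := congr1 (fun u => u z) (derive_linear (id : R^o -> R^o) v lin).
by rewrite /= derive_id => <-.
Qed.

Variable f : V -> R.
Hypothesis sf : smooth_on Om (f : V -> R^o).
Hypothesis gu : forall z, Om z -> fundamental_tensor f z \in unitmx.

Local Notation h := (fun w => f w ^+ 2).
Local Notation g := (fundamental_tensor f).

Lemma smooth_on_sq : smooth_on Om (h : V -> R^o).
Proof. exact: smooth_onM oOm sf sf. Qed.

Lemma fundamentalE z i j : g z i j = 2^-1 * dy j (dy i h) z.
Proof. by rewrite mxE. Qed.

Lemma smooth_on_fundamental i j : smooth_on Om (fun z => g z i j : R^o).
Proof.
under eq_fun do rewrite fundamentalE.
apply: smooth_onM => //; first exact: smooth_on_cst.
exact/smooth_on_dy/smooth_on_dy/smooth_on_sq.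
Qed.

Lemma fundamental_sym z : Om z -> (g z)^T = g z.
Proof.
move=> Oz; apply/matrixP => i j; rewrite mxE !fundamentalE.
have -> // : dy i (dy j h) z = dy j (dy i h) z.
exact: derive_comm oOm smooth_on_sq Oz.
Qed.

Definition spray_rhs l z :=
  \sum_(k < n) dy l (dx k h) z * z.2 0 k - dx l h z.

Lemma smooth_on_spray i : smooth_on Om (spray f i : V -> R^o).
Proof.
apply: smooth_onM => //; first exact: smooth_on_cst.
apply: smooth_on_sum => // l _; apply: smooth_onM => //.
  exact: (smooth_on_invmx oOm gu smooth_on_fundamental).
apply: smooth_onB => //; last exact/smooth_on_dx/smooth_on_sq.
apply: smooth_on_sum => // k _; apply: smooth_onM => //.
  exact/smooth_on_dy/smooth_on_dx/smooth_on_sq.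
exact: smooth_on_coord2.
Qed.

Lemma spray_eq z l : Om z -> \sum_i g z l i * spray f i z = 4^-1 * spray_rhs l z.
Proof.
move=> Oz; pose r := \col_l spray_rhs l z.
have -> : \sum_i g z l i * spray f i z =
    4^-1 * (g z *m (invmx (g z) *m r)) l 0.
  rewrite mxE big_distrr /=; apply: eq_bigr => i _.
  rewrite /spray mulrCA; congr (_ * (_ * _)); rewrite mxE.
  by apply: eq_bigr => m _; rewrite [in RHS]mxE.
by rewrite mulKVmx ?gu// mxE.
Qed.

Lemma is_derive_smooth z v (u : V -> R) : Om z -> smooth_on Om (u : V -> R^o) ->
  is_derive z v (u : V -> R^o) ('D_v (u : V -> R^o) z).
Proof.
move=> Oz su; apply: derivableP; apply: diff_derivable.
exact: smooth_on_differentiable Oz.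
Qed.

Lemma derive_fundamental a b v z : Om z ->
  'D_v (fun w => g w a b : R^o) z = 2^-1 * 'D_v (dy b (dy a h) : V -> R^o) z.
Proof.
move=> Oz.
have gE : (fun w => g w a b : R^o) = 2^-1 *: (dy b (dy a h) : V -> R^o).
  by apply/funext => w; rewrite fundamentalE.
have H := is_derive_smooth v Oz (smooth_on_dy b (smooth_on_dy a smooth_on_sq)).
by rewrite gE (@derive_val _ _ _ _ _ _ _ (is_deriveZ 2^-1 H)).
Qed.

(** Both sides are twice the Cartan tensor, a third vertical derivative of [F ^ 2], which is totally
    symmetric. *)
Lemma dy_fundamental_sym a b c z : Om z ->
  dy c (fun w => g w a b) z = dy b (fun w => g w a c) z.
Proof.
move=> Oz; have e : dy c (dy b (dy a h)) z = dy b (dy c (dy a h)) z.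
  exact: derive_comm oOm (smooth_on_dy a smooth_on_sq) Oz.
rewrite [LHS](derive_fundamental _ _ _ Oz) [RHS](derive_fundamental _ _ _ Oz).
exact: (congr1 (fun t => 2^-1 * t) e).
Qed.

Lemma dx_fundamental a b k z : Om z ->
  2 * dx k (fun w => g w a b) z = dy b (dy a (dx k h)) z.
Proof.
move=> Oz; have e1 : dx k (dy b (dy a h)) z = dy b (dx k (dy a h)) z.
  exact: derive_comm oOm (smooth_on_dy a smooth_on_sq) Oz.
have e2 : dy b (dx k (dy a h)) z = dy b (dy a (dx k h)) z.
  apply: eq_derive_on oOm _ Oz => w Ow.
  exact: derive_comm oOm smooth_on_sq Ow.
rewrite -e2 -e1.
have : dx k (fun w => g w a b) z = 2^-1 * dx k (dy b (dy a h)) z.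
  exact: derive_fundamental Oz.
by move: (dx k _ z) (dx k _ z) => s t ->; field.
Qed.

(** Differentiating the equation with lowered index, rather than [spray] itself, keeps derivatives
    of [invmx] out of the computation. The Kronecker term is the derivative of the factor [y^k]. *)
Lemma spray_eq_dy z l m : Om z ->
  \sum_i (g z l i * dy m (spray f i) z + spray f i z * dy m (fun w => g w l i) z)
  = 4^-1 * (\sum_k (dy l (dx k h) z * (m == k)%:R + z.2 0 k * dy m (dy l (dx k h)) z)
            - dy m (dx l h) z).
Proof.
move=> Oz; have sh := smooth_on_sq.
have e1 : is_derive z (0, delta_mx 0 m)
    (fun w => \sum_i g w l i * spray f i w : R^o)
    (\sum_i (g z l i * dy m (spray f i) z + spray f i z * dy m (fun w => g w l i) z)).
  apply: is_derive_bigsum => i _; apply: is_derive_mul.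
    exact/is_derive_smooth/smooth_on_fundamental.
  exact/is_derive_smooth/smooth_on_spray.
have e2 : is_derive z (0, delta_mx 0 m) (fun w => 4^-1 * spray_rhs l w : R^o)
  (4^-1 * (\sum_k (dy l (dx k h) z * (m == k)%:R + z.2 0 k * dy m (dy l (dx k h)) z)
            - dy m (dx l h) z)).
  apply: (@is_deriveZ _ _ _ (spray_rhs l)); apply: is_deriveB; last first.
    exact/is_derive_smooth/smooth_on_dx.
  apply: is_derive_bigsum => k _; apply: is_derive_mul.
    exact/is_derive_smooth/smooth_on_dy/smooth_on_dx.
  apply: is_derive_eq (is_derive_smooth _ Oz (smooth_on_coord2 k)) _.
  by rewrite derive_coord2 mxE eqxx eq_sym.
have := near_eq_is_derive (near_open oOm Oz (fun w Ow => spray_eq l Ow)) e1.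
by case=> _ <-; case: e2.
Qed.

(** The geodesic spray [y^k d/dx^k - 2 G^i d/dy^i] at [z], as a direction in the chart coordinates
    of the tangent bundle. *)
Definition spray_vector z : V := (z.2, \row_i (- (2 * spray f i z))).

Lemma derive_spray_vector z (u : V -> R^o) : differentiable u z ->
  'D_(spray_vector z) u z =
  \sum_k z.2 0 k * dx k u z - 2 * \sum_i spray f i z * dy i u z.
Proof.
move=> du; rewrite deriveE//.
have -> : spray_vector z = \sum_k z.2 0 k *: ((delta_mx 0 k, 0) : V)
    + \sum_i (- (2 * spray f i z)) *: ((0, delta_mx 0 i) : V).
  apply/pair_eqP; rewrite /spray_vector.
  have s1 (I : finType) (F : I -> V) : (\sum_i F i).1 = \sum_i (F i).1.
    by apply: (big_morph fst).
  have s2 (I : finType) (F : I -> V) : (\sum_i F i).2 = \sum_i (F i).2.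
    by apply: (big_morph snd).
  apply/andP; split; apply/eqP; rewrite /= ?s1 ?s2 /=.
    under [X in _ + X]eq_bigr do rewrite scaler0.
    by rewrite big1_eq addr0 -row_sum_delta.
  under [X in X + _]eq_bigr do rewrite scaler0.
  rewrite big1_eq add0r [LHS]row_sum_delta.
  by apply: eq_bigr => i _; rewrite mxE.
rewrite linearD !linear_sum /=; congr (_ + _).
  by apply: eq_bigr => k _; rewrite linearZ_LR /dx deriveE.
rewrite mulr_sumr -sumrN; apply: eq_bigr => k _.
by rewrite linearZ_LR /dy deriveE // -[_ *: _]/(_ * _) mulrA mulNr.
Qed.

(** Lowering an index in the matrix [N] of vertical derivatives of the spray gives [S + Q], with [S]
    antisymmetric and [Q] half the derivative of [g] along the spray. The trace against the
    symmetric inverse of [g] kills [S]. *)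
Lemma spray_divergence z : Om z ->
  \sum_i dy i (spray f i) z =
  2^-1 * \sum_l \sum_m invmx (g z) m l * 'D_(spray_vector z) (fun w => g w l m : R^o) z.
Proof.
move=> Oz; have sh := smooth_on_sq.
pose N := \matrix_(i, m) dy m (spray f i) z.
pose S := \matrix_(l, m) (4^-1 * (dy l (dx m h) z - dy m (dx l h) z)).
pose Q := \matrix_(l, m) (2^-1 * 'D_(spray_vector z) (fun w => g w l m : R^o) z).
have gN : g z *m N = S + Q.
  apply/matrixP => l m; rewrite [LHS]mxE [RHS]mxE /S [in RHS]mxE /Q [X in _ + X]mxE.
  rewrite derive_spray_vector; last first.
    exact: smooth_on_differentiable (smooth_on_fundamental l m) Oz.
  have := spray_eq_dy l m Oz; rewrite big_split /=.
  (* Symmetry of the Cartan tensor turns this sum into the vertical part of the derivative of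
     [g l m] along the spray. *)
  have -> : \sum_i spray f i z * dy m (fun w => g w l i) z =
            \sum_i spray f i z * dy i (fun w => g w l m) z.
    by apply: eq_bigr => i _; rewrite dy_fundamental_sym.
  rewrite big_split /=.
  have -> : \sum_k dy l (dx k h) z * (m == k)%:R = dy l (dx m h) z.
    exact: (sum_mul_delta (fun k => dy l (dx k h) z)).
  have -> : \sum_k z.2 0 k * dy m (dy l (dx k h)) z =
            2 * \sum_k z.2 0 k * dx k (fun w => g w l m) z.
    by rewrite mulr_sumr; apply: eq_bigr => k _; rewrite mulrCA dx_fundamental.
  have -> : \sum_i g z l i * N i m = \sum_i g z l i * dy m (spray f i) z.
    by apply: eq_bigr => i _; rewrite [N _ _]mxE.
  have lin_aux (a b c d e : R) : a + b = 4^-1 * (d + 2 * c - e) ->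
      a = 4^-1 * (d - e) + 2^-1 * (c - 2 * b) by move=> H; lra.
  exact: lin_aux.
have trN : \tr N = \tr (invmx (g z) *m S) + \tr (invmx (g z) *m Q).
  by rewrite -mxtraceD -mulmxDr -gN mulKmx ?gu.
have giS : (invmx (g z))^T = invmx (g z).
  by rewrite trmx_inv fundamental_sym.
have trS : \tr (invmx (g z) *m S) = 0.
  have ST : S^T = - S by apply/matrixP => l m; rewrite !mxE -mulrN opprB.
  have : \tr (invmx (g z) *m S) = - \tr (invmx (g z) *m S).
    by rewrite -{1}mxtrace_tr trmx_mul giS ST mxtrace_mulC mulmxN linearN.
  by move: (\tr _) => t H; lra.
have -> : \sum_i dy i (spray f i) z = \tr N.
  by apply: eq_bigr => i _; rewrite [RHS]mxE.
rewrite trN trS add0r mulr_sumr.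
transitivity (\sum_m \sum_l invmx (g z) m l * Q l m).
  by apply: eq_bigr => m _; rewrite mxE.
rewrite exchange_big; apply: eq_bigr => l _.
by rewrite mulr_sumr; apply: eq_bigr => m _; rewrite [Q _ _]mxE mulrCA.
Qed.

Lemma is_derive_det_fundamental z : Om z ->
  is_derive z (spray_vector z) (fun w => \det (g w) : R^o)
    (2 * \det (g z) * \sum_i dy i (spray f i) z).
Proof.
move=> Oz.
pose dG := \matrix_(l, m) 'D_(spray_vector z) (fun w => g w l m : R^o) z.
have dGP l m : is_derive z (spray_vector z) (fun w => g w l m : R^o) (dG l m).
  rewrite mxE; exact: is_derive_smooth Oz (smooth_on_fundamental l m).
have dv := spray_divergence Oz.
apply: is_derive_eq (is_derive_det_invmx (gu Oz) dGP) _.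
have -> : \sum_l \sum_m invmx (g z) m l * dG l m =
    2 * \sum_i dy i (spray f i) z.
  rewrite dv mulVKf ?pnatr_eq0//.
  by apply: eq_bigr => l _; apply: eq_bigr => m _; rewrite [dG _ _]mxE.
by rewrite mulrCA mulrA.
Qed.

End Spray.

(** * Parity in [y], and the E-curvature as a vertical Hessian *)

Section Parity.
Context {R : realType} {n : nat}.
Notation V := ('rV[R]_n * 'rV[R]_n)%type.

Definition flip (z : V) : V := (z.1, - z.2).

Lemma flip_linear : linear flip.
Proof.
move=> a u v; apply/pair_eqP/andP; split; apply/eqP => //=.
by rewrite opprD scalerN.
Qed.

Variable Om : set V.
Hypothesis oOm : open Om.
Hypothesis Omflip : forall z, Om z -> Om (flip z).

(** Even and odd are [e = 1] and [e = -1]; with the sign as a number, each vertical derivative just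
    negates it. *)
Definition parity (e : R) (u : V -> R) := forall z, Om z -> u (flip z) = e * u z.

Lemma derive_flip e (u : V -> R) v z : smooth_on Om (u : V -> R^o) ->
  parity e u -> Om z ->
  'D_(flip v) (u : V -> R^o) (flip z) = e * 'D_v (u : V -> R^o) z.
Proof.
move=> su pu Oz.
have := congr1 (fun w => w z) (derive_linear (u : V -> R^o) v flip_linear).
rewrite /= => <-.
have -> : 'D_v ((u : V -> R^o) \o flip) z = 'D_v (fun w => e * u w : R^o) z.
  exact: eq_derive_on oOm pu Oz.
have du := is_derive_smooth v Oz su.
exact: (@derive_val _ _ _ _ _ _ _ (is_deriveZ e du)).
Qed.

Lemma parity_dx e k u : smooth_on Om (u : V -> R^o) -> parity e u ->
  parity e (dx k u).
Proof.
move=> su pu z Oz; rewrite /dx -(derive_flip _ su pu Oz).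
by rewrite /flip /= oppr0.
Qed.

Lemma parity_dy e k u : smooth_on Om (u : V -> R^o) -> parity e u ->
  parity (- e) (dy k u).
Proof.
move=> su pu z Oz; rewrite mulNr /dy -(derive_flip _ su pu Oz).
have dz : differentiable (u : V -> R^o) (flip z).
  exact: smooth_on_differentiable (Omflip Oz).
rewrite !deriveE// -linearN; congr ('d _ _ _).
by rewrite /flip -[LHS]/(0, delta_mx 0 k) -[RHS]/(- 0, - - delta_mx 0 k) oppr0 opprK.
Qed.

Variable f : V -> R.
Hypothesis sf : smooth_on Om (f : V -> R^o).
Hypothesis gu : forall z, Om z -> fundamental_tensor f z \in unitmx.
Hypothesis evenf : forall z, f (flip z) = f z.

Local Notation h := (fun w => f w ^+ 2).
Local Notation sh := (smooth_on_sq oOm sf).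

Lemma parity_sq : parity 1 h.
Proof. by move=> z _; rewrite mul1r evenf. Qed.

Lemma fundamental_flip z : Om z ->
  fundamental_tensor f (flip z) = fundamental_tensor f z.
Proof.
move=> Oz; apply/matrixP => i j.
rewrite [LHS]fundamentalE [RHS]fundamentalE.
have sdi : smooth_on Om (dy i h : V -> R^o) by exact: smooth_on_dy sh.
have := parity_dy j sdi (parity_dy i sh parity_sq) Oz.
rewrite opprK mul1r => e; exact: (congr1 (fun t => 2^-1 * t) e).
Qed.

(** In the first sum an odd derivative in [y^l] meets the odd factor [y^k]; everything else is
    even. *)
Lemma parity_spray i : parity 1 (spray f i).
Proof.
move=> z Oz; rewrite mul1r /spray (fundamental_flip Oz); congr (_ * _).
apply: eq_bigr => l _; congr (_ * _); congr (_ - _); last first.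
  by have := parity_dx l sh parity_sq Oz; rewrite mul1r => ->.
apply: eq_bigr => k _.
have sdk : smooth_on Om (dx k h : V -> R^o) by exact: smooth_on_dx sh.
have -> := parity_dy l sdk (parity_dx k sh parity_sq) Oz.
by rewrite mxE mulrN mulN1r mulNr opprK.
Qed.

Definition spray_div z := \sum_i dy i (spray f i) z.

Lemma smooth_on_spray_div : smooth_on Om (spray_div : V -> R^o).
Proof.
apply: smooth_on_sum => // i _.
exact/smooth_on_dy/smooth_on_spray.
Qed.

Lemma parity_spray_div : parity (-1) spray_div.
Proof.
move=> z Oz; rewrite /spray_div mulr_sumr; apply: eq_bigr => i _.
exact: parity_dy (smooth_on_spray oOm sf gu i) (parity_spray i) _ Oz.
Qed.

(** Symmetry of third vertical derivatives lets the derivative in the contracted index be taken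
    first, where it produces the divergence. *)
Lemma E_curvature_spray_div i j z : Om z ->
  E_curvature f i j z = 2^-1 * dy j (dy i spray_div) z.
Proof.
move=> Oz.
have sG k := smooth_on_spray oOm sf gu k.
have dsum a (w : 'I_n -> V -> R) y : Om y ->
    (forall k, smooth_on Om (w k : V -> R^o)) ->
    dy a (fun y => \sum_k w k y) y = \sum_k dy a (w k) y.
  move=> Oy sw.
  have H : is_derive y (0, delta_mx 0 a) (fun y => \sum_k w k y : R^o)
      (\sum_k dy a (w k) y).
    by apply: is_derive_bigsum => k _; exact: is_derive_smooth Oy (sw k).
  exact: (@derive_val _ _ _ _ _ _ _ H).
have e1 y : Om y -> dy i spray_div y = \sum_k dy i (dy k (spray f k)) y.
  by move=> Oy; apply: (dsum _ _ _ Oy) => k; exact: smooth_on_dy (sG k).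
have e2 : dy j (dy i spray_div) z =
    dy j (fun y => \sum_k dy i (dy k (spray f k)) y) z.
  exact: eq_derive_on oOm e1 Oz.
have e3 : dy j (fun y => \sum_k dy i (dy k (spray f k)) y) z =
    \sum_k dy j (dy i (dy k (spray f k))) z.
  by apply: (dsum _ _ _ Oz) => k; exact: smooth_on_dy (smooth_on_dy k (sG k)).
rewrite /E_curvature e2 e3.
apply: (congr1 (fun t => 2^-1 * t)).
apply: eq_bigr => k _.
transitivity (dy j (dy k (dy i (spray f k))) z).
  exact: derive_comm oOm (smooth_on_dy i (sG k)) Oz.
apply: eq_derive_on oOm _ Oz => w Ow.
exact: derive_comm oOm (sG k) Ow.
Qed.

Lemma parity_E_curvature i j : parity (-1) (E_curvature f i j).
Proof.
move=> z Oz; rewrite !E_curvature_spray_div//; last exact: Omflip.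
have sD := smooth_on_spray_div.
have := parity_dy j (smooth_on_dy i sD) (parity_dy i sD parity_spray_div) Oz.
by rewrite opprK mulrCA => ->.
Qed.

Lemma parity_angular i j : parity 1 (angular_tensor f i j).
Proof.
move=> z Oz; rewrite mul1r.
have pf : parity 1 f by move=> y _; rewrite mul1r.
have := parity_dy j (smooth_on_dy i sf) (parity_dy i sf pf) Oz.
by rewrite opprK mul1r; apply: congr2; apply: evenf.
Qed.

Lemma derive_vertical (u : V -> R) y z : smooth_on Om (u : V -> R^o) -> Om z ->
  'D_(0, y) (u : V -> R^o) z = \sum_i y 0 i * dy i u z.
Proof.
move=> su Oz; have du := smooth_on_differentiable su Oz.
have -> : ((0, y) : V) = \sum_i y 0 i *: ((0, delta_mx 0 i) : V).
  apply/pair_eqP/andP; split; apply/eqP => /=.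
    rewrite (big_morph fst (id1 := 0) (op1 := +%R)) //= big1// => i _.
    by rewrite scaler0.
  rewrite (big_morph snd (id1 := 0) (op1 := +%R)) //=.
  exact: row_sum_delta.
rewrite deriveE// linear_sum; apply: eq_bigr => i _.
by rewrite linearZ_LR /dy deriveE.
Qed.

(** Contracting the Hessian twice with [w] gives the second derivative along the line, so the first
    derivative is a constant [b], and then [u - t * b] is constant. The whole line has to stay in
    [Om]. *)
Lemma vertical_hessian0_affine (u : V -> R) (x y w : 'rV[R]_n) :
  smooth_on Om (u : V -> R^o) ->
  (forall t : R, Om (x, y + t *: w)) ->
  (forall t : R, forall i j, dy j (dy i u) (x, y + t *: w) = 0) ->
  exists b, forall t : R, u (x, y + t *: w) = u (x, y) + t * b.
Proof.
move=> su OL HL.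
have DD t : 'D_(0, w) ('D_(0, w) (u : V -> R^o)) (x, y + t *: w) = 0.
  have sdu i : smooth_on Om (fun z => w 0 i * dy i u z : R^o).
    apply: smooth_onM => //; [exact: smooth_on_cst|exact: smooth_on_dy su].
  rewrite (@eq_derive_on _ _ _ Om _ (fun z => \sum_i w 0 i * dy i u z : R^o) _ _ oOm)//; last first.
    by move=> z Oz; apply: derive_vertical.
  have H : is_derive (x, y + t *: w) (0, w) (fun z => \sum_i w 0 i * dy i u z : R^o)
      (\sum_i w 0 i * 'D_(0, w) (dy i u : V -> R^o) (x, y + t *: w)).
    apply: is_derive_bigsum => i _; apply: (@is_deriveZ _ _ _ (dy i u : V -> R^o)).
    exact: is_derive_smooth (OL t) (smooth_on_dy i su).
  rewrite (@derive_val _ _ _ _ _ _ _ H) big1// => i _.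
  rewrite (derive_vertical _ (smooth_on_dy i su) (OL t)).
  by rewrite big1 ?mulr0// => j _; rewrite HL mulr0.
have lineE t : (x, y + t *: w) = ((x, y) : V) + t *: ((0, w) : V).
  by apply/pair_eqP/andP; split; apply/eqP; rewrite /= ?scaler0 ?addr0.
pose b := 'D_(0, w) (u : V -> R^o) (x, y).
have Db t : 'D_(0, w) (u : V -> R^o) (x, y + t *: w) = b.
  have -> : b = 'D_(0, w) (u : V -> R^o) (x, y + 0 *: w).
    by rewrite scale0r addr0.
  pose phi (s : R) : R := 'D_(0, w) (u : V -> R^o) (((x, y) : V) + s *: ((0, w) : V)).
  have := @is_derive_0_is_cst R phi t 0.
  rewrite /phi -!lineE; apply => s.
  rewrite -(DD s) lineE; apply: is_derive_line; rewrite -lineE.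
  exact: smooth_on_differentiable (smooth_on_derive _ su) (OL s).
exists b => t.
pose phi (s : R) : R := u (((x, y) : V) + s *: ((0, w) : V)) - s * b.
have : phi t = phi 0.
  apply: is_derive_0_is_cst => s.
  have H1 : is_derive s 1 (fun s : R => u (((x, y) : V) + s *: ((0, w) : V)) : R^o) b.
    rewrite -(Db s) lineE; apply: is_derive_line; rewrite -lineE.
    exact: smooth_on_differentiable su (OL s).
  have H2 : is_derive s 1 (fun s : R => s * b : R^o) b.
    apply: (is_derive_eq (@is_deriveM _ _ id (cst b) s 1 _ _
      (is_derive_id _ _) (is_derive_cst _ _ _))).
    by rewrite scaler0 add0r /GRing.scale /= mulr1.
  by rewrite -(subrr b); apply: is_deriveB.
by rewrite /phi -!lineE scale0r addr0 mul0r subr0 => <-; rewrite subrK.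
Qed.

End Parity.

(** * Covers by boxes: monotonicity and countable subadditivity of the volume *)

Section Volume.
Context {R : realType} {n : nat}.
Hypothesis n0 : (0 < n)%N.
Implicit Types (A B : set 'rV[R]_n) (a b : 'rV[R]_n) (M : 'M[R]_n).

Definition box_volume a b : R := \prod_(i < n) (b 0 i - a 0 i).

Lemma box_volume_ge0 a b : (forall i, a 0 i <= b 0 i) -> 0 <= box_volume a b.
Proof. by move=> ab; apply: prodr_ge0 => i _; rewrite subr_ge0. Qed.

Lemma box_volume_diag a : box_volume a a = 0.
Proof. by rewrite /box_volume (bigD1 (Ordinal n0)) //= subrr mul0r. Qed.

Lemma volume_cover A (a b : nat -> 'rV[R]_n) :
  (forall k i, a k 0 i <= b k 0 i) -> A `<=` \bigcup_k box (a k) (b k) ->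
  (volume A <= \sum_(0 <= k <oo) (box_volume (a k) (b k))%:E)%E.
Proof. by move=> ab Aab; apply: ereal_inf_lbound; exists a, b. Qed.

Lemma volume_ge0 A : (0 <= volume A)%E.
Proof.
apply: le_ereal_inf_tmp => _ [a [b [ab _ ->]]].
by apply: nneseries_ge0 => k _ _; rewrite lee_fin box_volume_ge0.
Qed.

Lemma le_volume A B : A `<=` B -> (volume A <= volume B)%E.
Proof.
move=> AB; apply: le_ereal_inf_tmp => _ [a [b [ab Bab ->]]].
exact: volume_cover (subset_trans AB Bab).
Qed.

Lemma volume_finite_cover A N (a b : nat -> 'rV[R]_n) :
  (forall k i, a k 0 i <= b k 0 i) ->
  (forall y, A y -> exists2 k, (k < N)%N & box (a k) (b k) y) ->
  (volume A <= (\sum_(0 <= k < N) box_volume (a k) (b k))%:E)%E.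
Proof.
(* From index [N] on the cover is padded with one-point boxes, which have volume 0 because [n] is
   positive. *)
move=> ab Aab; pose b' k := if (k < N)%N then b k else a k.
have ab' k i : a k 0 i <= b' k 0 i by rewrite /b'; case: ifP.
apply: le_trans (volume_cover ab' _) _.
  by move=> y /Aab [k kN ky]; exists k => //; rewrite /b' kN.
rewrite (nneseries_split _ N) => [|k _]; last by rewrite lee_fin box_volume_ge0.
rewrite add0n eseries0 ?adde0 => [|k Nk _]; last first.
  by rewrite /b' ltnNge Nk /= box_volume_diag.
rewrite -sumEFin big_nat [leRHS]big_nat lee_sum// => k /andP[_ kN].
by rewrite /b' kN.
Qed.

(** Each [B k] gets a cover within [e / 2 ^ (k + 1)] of its bound; such covers exist because [v k]
    is a real number. The double family of boxes is then enumerated by a bijection between naturals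
    and pairs of naturals. *)
Lemma volume_subadditive A (B : nat -> set 'rV[R]_n) (v : nat -> R) :
  A `<=` \bigcup_k B k -> (forall k, (volume (B k) <= (v k)%:E)%E) ->
  (volume A <= \sum_(0 <= k <oo) (v k)%:E)%E.
Proof.
move=> AB Bv; apply/lee_addgt0Pr => e e0.
have v0 k : (0 <= (v k)%:E)%E by apply: le_trans (volume_ge0 _) (Bv k).
apply: le_trans (epsilon_trick xpredT v0 (ltW e0)).
have ek k : 0 < e / (2 ^ k.+1)%:R by rewrite divr_gt0// ltr0n expn_gt0.
pose P k (ab : (nat -> 'rV[R]_n) * (nat -> 'rV[R]_n)) :=
  [/\ forall j i, ab.1 j 0 i <= ab.2 j 0 i,
      B k `<=` \bigcup_j box (ab.1 j) (ab.2 j)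
    & (\sum_(0 <= j <oo) (box_volume (ab.1 j) (ab.2 j))%:E
        <= (v k + e / (2 ^ k.+1)%:R)%:E)%E].
have [G PG] : {G : nat -> (nat -> 'rV[R]_n) * (nat -> 'rV[R]_n) &
    forall k, P k (G k)}.
  apply: (@choice _ _ P) => k.
  have : (volume (B k) < (v k + e / (2 ^ k.+1)%:R)%:E)%E.
    by rewrite (le_lt_trans (Bv k))// lte_fin ltrDl.
  move=> /ereal_inf_lt[_ [a [b [ab Bab ->]]]] /ltW lev.
  by exists (a, b).
have /card_esym/ppcard_eqP[f] := card_nat2.
pose w (kj : nat * nat) : \bar R := (box_volume ((G kj.1).1 kj.2) ((G kj.1).2 kj.2))%:E.
have w0 kj : (0 <= w kj)%E.
  by rewrite lee_fin box_volume_ge0// => i; case: (PG kj.1).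
apply: (@le_trans _ _ (\sum_(0 <= m <oo) w (f m))%E).
  apply: (volume_cover (a := fun m => (G (f m).1).1 (f m).2)
                       (b := fun m => (G (f m).1).2 (f m).2)).
    by move=> m i; case: (PG (f m).1).
  move=> y /AB [k _]; have [_ Bk _] := PG k.
  move=> /Bk [j _ yj]; exists (f^-1%FUN (k, j)) => //=.
  by rewrite invK ?inE.
rewrite nneseries_esumT// -(@reindex_esum _ _ _ setT setT f w); last first.
  by split.
rewrite (_ : setT = setT `*`` (fun=> setT)); last by apply/seteqP; split.
rewrite -(@esum_esum _ _ _ setT (fun=> setT) (fun k j => w (k, j)))//.
rewrite -nneseries_esumT; last by move=> k; apply: esum_ge0.
apply: lee_nneseries => [k _ _|k _]; first exact: esum_ge0.
rewrite -nneseries_esumT//.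
by have [_ _] := PG k; rewrite EFinD.
Qed.

(** The left side is the value at [t] of a polynomial, continuous at 0. This controls the volume of
    a box whose sides are slightly lengthened. *)
Lemma prod_perturb (l c : 'I_n -> R) (e : R) : 0 < e ->
  exists2 d, 0 < d & forall t, 0 <= t -> t < d ->
    \prod_i (l i + t * c i) < \prod_i l i + e.
Proof.
move=> e0; pose p : {poly R} := \prod_i ((l i)%:P + c i *: 'X).
have pE t : p.[t] = \prod_i (l i + t * c i).
  by rewrite horner_prod; apply: eq_bigr => i _; rewrite !hornerE mulrC.
have /cvgrPdist_lt/(_ e e0)/nbhs_ballP[d /= d0 dP] := @continuous_horner _ p 0.
exists d => // t t0 td.
have /dP : ball (0 : R) d t by rewrite /ball /= sub0r normrN ger0_norm.
rewrite -pE.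
have -> : p.[0] = \prod_i l i.
  by rewrite pE; apply: eq_bigr => i _; rewrite mul0r addr0.
by rewrite ltr_distlC => /andP[_]; rewrite addrC.
Qed.

End Volume.

(** * Volume under elementary linear maps *)

Section VolumeLinear.
Context {R : realType} {n : nat}.
Hypothesis n0 : (0 < n)%N.
Implicit Types (A B : set 'rV[R]_n) (a b r w : 'rV[R]_n) (M : 'M[R]_n).

(** Scalings of one coordinate and transvections are special cases, so together with transpositions
    these matrices generate all invertible ones. *)
Definition row_repl (k : 'I_n) r : 'M[R]_n :=
  \matrix_(i, j) if i == k then r 0 j else (i == j)%:R.

Lemma det_row_repl k r : \det (row_repl k r) = r 0 k.
Proof.
rewrite (expand_det_col _ k) (bigD1 k)//= big1 => [|i ik]; last first.
  by rewrite mxE (negPf ik) mul0r.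
rewrite addr0 mxE eqxx /cofactor exprD -expr2 sqrr_sign mul1r.
rewrite (_ : row' k _ = 1%:M) ?det1 ?mulr1//.
apply/matrixP => i j; rewrite !mxE eq_sym (negPf (neq_lift _ _)).
by rewrite (inj_eq lift_inj).
Qed.

Lemma mul_row_repl k r w j :
  (w *m row_repl k r) 0 j = (if j == k then 0 else w 0 j) + w 0 k * r 0 j.
Proof.
rewrite mxE (bigD1 k)//= mxE eqxx addrC; congr (_ + _).
have [->|jk] := eqVneq j k.
  by rewrite big1// => i ik; rewrite mxE (negPf ik) mulr0.
rewrite (bigD1 j)//= mxE (negPf jk) eqxx mulr1 big1 ?addr0// => i /andP[ik ij].
by rewrite mxE (negPf ik) (negPf ij) mulr0.
Qed.

Lemma nat_slice N (x : R) : (0 < N)%N -> 0 <= x -> x <= N%:R ->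
  exists2 s, (s < N)%N & s%:R <= x <= s.+1%:R.
Proof.
elim: N => // -[|N] IH _ x0 xN; first by exists 0%N => //; rewrite x0.
have [xN1|xN1] := leP x N.+1%:R; last by exists N.+1; rewrite // ltW.
by have [s sN sx] := IH isT x0 xN1; exists s => //; apply: ltnW.
Qed.

(* The box is cut in thin slices orthogonal to the [k]-th axis; the image of a
   slice is nearly a box. *)
Lemma volume_row_repl_box k r a b : (forall i, a 0 i <= b 0 i) ->
  (volume ((fun w => w *m row_repl k r) @` box a b)
     <= (`|r 0 k| * box_volume a b)%:E)%E.
Proof.
move=> ab; apply/lee_addgt0Pr => e e0.
pose l i := b 0 i - a 0 i.
have l0 i : 0 <= l i by rewrite subr_ge0.
(* A slice of thickness [dl = l k / N] has its image in a box with side [dl * |r 0 k|] along the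
   axis [k] and sides [l j + dl * |r 0 j|] otherwise. The [N] slices together give the product of
   the [l' j + c j / N]. *)
pose l' i := if i == k then l k * `|r 0 k| else l i.
pose c i := if i == k then 0 else l k * `|r 0 i|.
have [d d0 dP] := prod_perturb l' c e0.
have [m md] : exists m : nat, m.+1%:R^-1 < d :> R.
  by have [m _ /(_ m (leqnn m)) md] := near_infty_natSinv_lt (PosNum d0); exists m.
pose N := m.+1; pose dl := l k / N%:R.
have N0 : 0 < N%:R :> R by rewrite ltr0n.
have dl0 : 0 <= dl by rewrite divr_ge0// ltW.
pose cs s := a 0 k + s%:R * dl.
pose lo s : 'rV[R]_n := \row_j ((if j == k then 0 else a 0 j)
  + Num.min (cs s * r 0 j) (cs s.+1 * r 0 j)).
pose hi s : 'rV[R]_n := \row_j ((if j == k then 0 else b 0 j)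
  + Num.max (cs s * r 0 j) (cs s.+1 * r 0 j)).
have lohi s i : lo s 0 i <= hi s 0 i.
  rewrite !mxE lerD//; first by case: ifP.
  by rewrite ge_min le_max lexx.
have csS s : cs s.+1 = cs s + dl by rewrite /cs -natr1 mulrDl mul1r addrA.
have vol s : box_volume (lo s) (hi s) =
    \prod_j ((if j == k then 0 else l j) + dl * `|r 0 j|).
  apply: eq_bigr => j _; rewrite !mxE opprD addrACA; congr (_ + _).
    by case: ifP; rewrite ?subrr.
  have -> : dl * `|r 0 j| = `|cs s.+1 * r 0 j - cs s * r 0 j|.
    by rewrite csS mulrDl addrC addKr normrM ger0_norm.
  case: (leP (cs s * r 0 j) (cs s.+1 * r 0 j)) => h.
    by rewrite ger0_norm ?subr_ge0.
  by rewrite distrC ger0_norm// subr_ge0 ltW.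
apply: le_trans (volume_finite_cover n0 (N := N) lohi _) _.
  move=> _ [w wab <-].
  (* In a flat box all slices coincide and the slice number cannot be found by dividing by [dl];
     slice 0 serves. *)
  have [lk0|lk0] := eqVneq (l k) 0.
    exists 0%N => // j; rewrite mul_row_repl !mxE.
    have wk : w 0 k = cs 0%N.
      have /andP[h1 h2] := wab k; move: lk0; rewrite /l /cs mul0r addr0 => lk0.
      by apply/eqP; rewrite eq_le h1 andbT (le_trans h2)// -subr_le0 lk0.
    have -> : cs 1%N = cs 0%N by rewrite csS /dl lk0 mul0r addr0.
    rewrite minxx maxxx wk !lerD2r.
    by case: ifP; rewrite ?lexx// wab.
  have lk : 0 < l k by rewrite lt_def lk0 l0.
  have /andP[h1 h2] := wab k.
  have dlp : 0 < dl by rewrite divr_gt0.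
  have [s sN /andP[s1 s2]] : exists2 s, (s < N)%N &
      s%:R <= (w 0 k - a 0 k) / dl <= s.+1%:R.
    apply: nat_slice => //; first by rewrite divr_ge0// subr_ge0.
    rewrite ler_pdivrMr// /dl mulrCA mulfV ?mulr1 ?gt_eqF// lerD2r//.
  exists s => // j; rewrite mul_row_repl !mxE.
  have wk1 : cs s <= w 0 k by rewrite /cs -lerBrDl -ler_pdivlMr.
  have wk2 : w 0 k <= cs s.+1 by rewrite /cs -lerBlDl -ler_pdivrMr.
  apply/andP; split; apply: lerD.
  - by case: ifP => // _; case/andP: (wab j).
  - have [rj|rj] := leP 0 (r 0 j).
      by rewrite ge_min ler_wpM2r.
    by rewrite ge_min [X in _ || X]ler_wnM2r ?orbT// ltW.
  - by case: ifP => // _; case/andP: (wab j).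
  - have [rj|rj] := leP 0 (r 0 j).
      by rewrite le_max [X in _ || X]ler_wpM2r ?orbT.
    by rewrite le_max ler_wnM2r// ltW.
rewrite -EFinD lee_fin.
have -> : \sum_(0 <= s < N) box_volume (lo s) (hi s) =
    \prod_j (l' j + N%:R^-1 * c j).
  transitivity (\sum_(0 <= s < N) \prod_j ((if j == k then 0 else l j) + dl * `|r 0 j|)).
    by apply: eq_bigr => s _; apply: vol.
  rewrite sumr_const_nat subn0 -[LHS]mulr_natl.
  rewrite (bigD1 k)//= [RHS](bigD1 k)//= eqxx /l' /c eqxx mulr0 addr0 add0r.
  rewrite mulrA; congr (_ * _).
    by rewrite /dl; field; rewrite gt_eqF.
  apply: eq_bigr => j jk; rewrite (negPf jk) /dl; congr (_ + _).
  by rewrite mulrA [l k * _]mulrC.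
apply/ltW; apply: lt_le_trans (dP _ _ md) _; first by rewrite invr_ge0 ltW.
rewrite lerD2r /l' (bigD1 k)//= eqxx /box_volume [in leRHS](bigD1 k)//= -/(l k).
rewrite [l k * _]mulrC mulrA le_eqVlt; apply/orP; left; apply/eqP.
by congr (_ * _); apply: eq_bigr => j jk; rewrite (negPf jk).
Qed.

(** Covers yield only upper bounds. This half is stable under products, and the equality follows by
    applying it to the inverse matrix as well. *)
Definition volume_contract M := forall A,
  (volume ((fun w => w *m M) @` A) <= `|\det M|%:E * volume A)%E.

(** The images of the boxes covering [A] cover the image of [A]. The nonzero determinant is moved to
    the other side, so that the infimum defining [volume A] can be bounded below cover by cover. *)
Lemma volume_contract_box M :
  (forall a b, (forall i, a 0 i <= b 0 i) ->
    (volume ((fun w => w *m M) @` box a b) <= (`|\det M| * box_volume a b)%:E)%E) ->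
  \det M != 0 -> volume_contract M.
Proof.
move=> H M0 A; rewrite -lee_pdivrMl ?normr_gt0//.
apply: le_ereal_inf_tmp => _ [a [b [ab Aab ->]]].
rewrite lee_pdivrMl ?normr_gt0// -nneseriesZl; last first.
  by move=> k _; rewrite lee_fin box_volume_ge0.
apply: le_trans (volume_subadditive (B := fun k => (fun w => w *m M) @` box (a k) (b k))
  (v := fun k => `|\det M| * box_volume (a k) (b k)) _ _) _.
- by move=> _ [w /Aab[k _ wk] <-]; exists k => //; exists w.
- by move=> k; apply: H.
- by apply: lee_nneseries => k _ //; rewrite lee_fin mulr_ge0// box_volume_ge0.
Qed.

Lemma volume_contract_row_repl k r : r 0 k != 0 -> volume_contract (row_repl k r).
Proof.
move=> rk; apply: volume_contract_box; rewrite det_row_repl// => a b.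
exact: volume_row_repl_box.
Qed.

Lemma volume_contract_tperm i j : volume_contract (tperm_mx i j).
Proof.
have d1 : `|\det (tperm_mx i j : 'M[R]_n)| = 1.
  by rewrite det_perm normrX normrN1 expr1n.
apply: volume_contract_box; last by rewrite -normr_eq0 d1 oner_neq0.
move=> a b ab; rewrite d1 mul1r.
pose s := tperm i j.
have E w k : (w *m tperm_mx i j) 0 k = w 0 (s k).
  by rewrite /tperm_mx -[tperm i j in LHS]tpermV -col_permE mxE.
have -> : box_volume a b = \sum_(0 <= k < 1)
    box_volume (a *m tperm_mx i j) (b *m tperm_mx i j).
  rewrite big_nat1 /box_volume (reindex_inj (@perm_inj _ s)).
  by apply: eq_bigr => k _; rewrite !E.
apply: volume_finite_cover => // [_ k|_ [w wab <-]]; first by rewrite !E.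
by exists 0%N => // k; rewrite !E.
Qed.

Lemma volume_contractM M1 M2 :
  volume_contract M1 -> volume_contract M2 -> volume_contract (M1 *m M2).
Proof.
move=> H1 H2 A; rewrite det_mulmx normrM EFinM.
have -> : (fun w => w *m (M1 *m M2)) @` A =
    (fun w => w *m M2) @` ((fun w => w *m M1) @` A).
  by rewrite image_comp; apply: eq_imagel => w _ /=; rewrite mulmxA.
apply: le_trans (H2 _) _; rewrite [X in (X * volume A)%E]muleC -muleA.
by apply: lee_wpmul2l; [rewrite lee_fin|exact: H1].
Qed.

End VolumeLinear.

(** * Volume under invertible linear maps *)

Section VolumeUnit.
Context {R : realType} {n : nat}.
Hypothesis n0 : (0 < n)%N.
Implicit Types (A B : set 'rV[R]_n) (a b r w : 'rV[R]_n) (M : 'M[R]_n).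

Lemma row_row_repl k r M i :
  row i (row_repl k r *m M) = if i == k then r *m M else row i M.
Proof.
rewrite row_mul; case: eqP => [->|/eqP ik].
  by congr (_ *m _); apply/rowP => j; rewrite !mxE eqxx.
suff -> : row i (row_repl k r) = delta_mx 0 i by rewrite -rowE.
by apply/rowP => j; rewrite !mxE (negPf ik) eqxx eq_sym.
Qed.

(* The rows of [M] are exchanged one by one with the standard basis vectors. *)
Lemma volume_contract_unit M : M \in unitmx -> volume_contract M.
Proof.
(* Induction on the number of rows that are not yet known to be standard; the first [k] of them
   are. *)
suff H d k M' : (n - k = d)%N -> M' \in unitmx ->
    (forall i : 'I_n, (i < k)%N -> row i M' = delta_mx 0 i) -> volume_contract M'.
  by move=> Mu; apply: (H n 0%N) => //; rewrite subn0.
elim: d k M' => [|d IH] k N nk Nu Nk.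
  have -> : N = 1%:M.
    apply/row_matrixP => i; rewrite row1 Nk// (leq_trans (ltn_ord i))//.
    by rewrite -subn_eq0 nk.
  move=> A; rewrite det1 normr1 mul1e.
  by rewrite (_ : _ @` A = A)// -[RHS]image_id; apply: eq_imagel => w _; rewrite mulmx1.
have kn : (k < n)%N by rewrite -subn_gt0 nk.
pose ko := Ordinal kn; pose r : 'rV[R]_n := delta_mx 0 ko *m invmx N.
have rN : r *m N = delta_mx 0 ko by rewrite mulmxKV.
(* [r] holds the coefficients of the [k]-th basis vector in the rows of [N]. If they all vanished
   from [k] on, that vector would be a combination of the earlier basis vectors. As in the Steinitz
   exchange, row [j] can now be replaced. *)
have [j kj rj] : exists2 j : 'I_n, (k <= j)%N & r 0 j != 0.
  apply: contrapT => nj.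
  have r0 (j : 'I_n) : (k <= j)%N -> r 0 j = 0.
    by move=> kj; apply/eqP/negPn/negP => rj; apply: nj; exists j.
  have := congr1 (fun v : 'rV_n => v 0 ko) rN.
  rewrite [in RHS]mxE !eqxx mxE big1 => [/esym/eqP|j _]; first by rewrite oner_eq0.
  have [kj|jk] := leqP k j; first by rewrite r0 ?mul0r.
  have := congr1 (fun v : 'rV_n => v 0 ko) (Nk j jk).
  rewrite !mxE eqxx (_ : ko == j = false) ?andbF => [->|]; first by rewrite mulr0.
  by apply/negbTE; rewrite -val_eqE /= neq_ltn jk orbT.
pose M1 := row_repl j r *m N; pose M2 := tperm_mx j ko *m M1.
have M1u : M1 \in unitmx.
  by rewrite unitmx_mul Nu andbT unitmxE det_row_repl unitfE.
have M1E : M1 = tperm_mx j ko *m M2.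
  by rewrite mulmxA -perm_mxM tperm2 perm_mx1 mul1mx.
have cM2 : volume_contract M2.
  apply: (IH k.+1) => [||i ik]; first by rewrite subnS nk.
    by rewrite unitmx_mul unitmx_perm.
  have -> : row i M2 = row (tperm j ko i) M1.
    by rewrite /M2 -xrowE; apply/rowP => l; rewrite !mxE.
  have [iko|iko] := eqVneq i ko.
    by rewrite iko tpermR row_row_repl eqxx rN.
  have ik' : (i < k)%N by rewrite ltn_neqAle -ltnS ik andbT.
  have ij : i != j by rewrite -val_eqE neq_ltn (leq_trans ik' kj).
  by rewrite tpermD 1?eq_sym// row_row_repl (negPf ij) Nk.
(* The exchange is undone: [N] is [M1] with its row [j] put back, again a row replacement. *)
pose r' := row j N *m invmx M1.
have NE : N = row_repl j r' *m M1.
  apply/row_matrixP => i; rewrite row_row_repl; case: eqP => [->|/eqP ij].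
    by rewrite mulmxKV.
  by rewrite row_row_repl (negPf ij).
rewrite NE M1E; apply: volume_contractM.
  apply: volume_contract_row_repl => //; move: Nu.
  rewrite NE unitmx_mul M1u andbT unitmxE det_row_repl unitfE.
  by [].
by apply: volume_contractM => //; apply: volume_contract_tperm.
Qed.

Lemma volume_linear M A : M \in unitmx ->
  volume ((fun w => w *m M) @` A) = (`|\det M|%:E * volume A)%E.
Proof.
move=> Mu; apply/eqP; rewrite eq_le volume_contract_unit//=.
have M0 : \det M != 0 by move: Mu; rewrite unitmxE unitfE.
have := @volume_contract_unit (invmx M) _ ((fun w => w *m M) @` A).
rewrite image_comp (_ : (_ \o _) @` A = A) => [/(_ _)|]; last first.
  by rewrite -[RHS]image_id; apply: eq_imagel => w _ /=; rewrite mulmxK.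
rewrite unitmx_inv => /(_ Mu).
by rewrite det_inv normfV lee_pdivlMl ?normr_gt0.
Qed.

Lemma volume_box_le a b : (forall i, a 0 i <= b 0 i) ->
  (volume (box a b) <= (box_volume a b)%:E)%E.
Proof.
move=> ab; have := @volume_finite_cover R n n0 (box a b) 1 (fun=> a) (fun=> b).
by rewrite big_nat1; apply => // y yab; exists 0%N.
Qed.

(** The clamp [g] onto [[al, be + 1]] is nondecreasing and grows by exactly 1 from [j] to [j + 1]
    for each counted [j]; the increments telescope. *)
Lemma count_lattice (N : nat) (al be : R) : al <= be ->
  \sum_(j < N) ((al <= j%:R <= be)%R)%:R <= be - al + 1.
Proof.
move=> ab; pose g (x : R) := Num.min (Num.max x al) (be + 1).
have step (j : nat) : ((al <= j%:R <= be)%R)%:R <= g j.+1%:R - g j%:R.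
  rewrite /g -natr1; case: (boolP (al <= _ <= be)) => [/andP[h1 h2]|_] /=.
    have h3 : al <= j%:R + 1 by rewrite (le_trans h1)// lerDl.
    rewrite (max_idPl h1) (max_idPl h3) (min_idPl _) ?lerD2r//.
    by rewrite (min_idPl _) ?(le_trans h2) ?lerDl// addrC addKr.
  rewrite subr_ge0 le_min; apply/andP; split; last by rewrite ge_min lexx orbT.
  by rewrite ge_min ge_max !le_max lerDl ler01 lexx !orbT.
apply: le_trans (ler_sum _ (fun (j : 'I_N) _ => step j)) _.
rewrite -(big_mkord xpredT (fun j => g j.+1%:R - g j%:R)) telescope_sumr//.
have : g N%:R <= be + 1 by rewrite /g ge_min lexx orbT.
have : al <= g 0%:R.
  by rewrite /g le_min le_max lexx orbT (le_trans ab)// lerDl.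
lra.
Qed.

End VolumeUnit.

(** * The unit cube has volume at least 1 *)

Section VolumeCube.
Context {R : realType} {n : nat}.
Hypothesis n0 : (0 < n)%N.
Implicit Types (A B : set 'rV[R]_n) (a b r w : 'rV[R]_n) (M : 'M[R]_n).

Local Notation cube := (box (0 : 'rV[R]_n) (const_mx 1)).

(* A box contains at most [\prod_i (N * l i + 1)] of the [N ^ n] points of the
   cube with coordinates in [1/N * Z]. *)
Lemma cube_lattice_cover K (a b : nat -> 'rV[R]_n) m :
  (forall k i, a k 0 i <= b k 0 i) ->
  (forall y, cube y -> exists2 k, (k < K)%N & box (a k) (b k) y) ->
  1 <= \sum_(k < K) \prod_i (b k 0 i - a k 0 i + m.+1%:R^-1 * 1).
Proof.
move=> ab cov; pose N := m.+1.
have N0 : 0 < N%:R :> R by rewrite ltr0n.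
pose F k i (j : 'I_N) : R := ((N%:R * a k 0 i <= j%:R <= N%:R * b k 0 i)%R)%:R.
have F0 k i j : 0 <= F k i j by rewrite /F ler0n.
have le1 : (N ^ n)%:R <= \sum_(k < K) \prod_i (N%:R * b k 0 i - N%:R * a k 0 i + 1).
  apply: (@le_trans _ _ (\sum_(k < K) \prod_i \sum_(j < N) F k i j)).
    (* Distributing the product turns it into a sum over all maps from ['I_n] to ['I_N], which are
       the lattice points; each of them lies in some box. *)
    under eq_bigr do rewrite bigA_distr_bigA.
    rewrite exchange_big /=.
    have -> : (N ^ n)%:R = \sum_(f : {ffun 'I_n -> 'I_N}) (1 : R).
      by rewrite sumr_const card_ffun !card_ord.
    apply: ler_sum => f _.
    have [|k kK yk] := cov (\row_i ((f i)%:R / N%:R)).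
      move=> i; rewrite !mxE divr_ge0 ?ler0n//= ler_pdivrMr// mul1r ler_nat.
      exact: ltnW.
    rewrite (bigD1 (Ordinal kK)) //= (_ : \prod_i F k i (f i) = 1) ?lerDl.
      by apply: sumr_ge0 => k' _; apply: prodr_ge0.
    rewrite big1// => i _; rewrite /F; have := yk i; rewrite mxE.
    by rewrite ler_pdivlMr// ler_pdivrMr// ![_ * N%:R]mulrC => ->.
  apply: ler_sum => k _; apply: ler_prod => i _.
  by rewrite sumr_ge0//= count_lattice// ler_wpM2l// ltW.
have E : \sum_(k < K) \prod_i (N%:R * b k 0 i - N%:R * a k 0 i + 1) =
    (N ^ n)%:R * \sum_(k < K) \prod_i (b k 0 i - a k 0 i + N%:R^-1 * 1).
  rewrite mulr_sumr; apply: eq_bigr => k _.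
  have -> : (N ^ n)%:R = \prod_(i < n) (N%:R : R) by rewrite prodr_const card_ord natrX.
  rewrite -big_split /=.
  by apply: eq_bigr => i _; field; rewrite gt_eqF.
by move: le1; rewrite E -[X in X <= _]mulr1 ler_pM2l// ltr0n expn_gt0.
Qed.

(** The lattice count for a mesh tending to 0. With finitely many boxes one mesh serves all of
    them. *)
Lemma cube_finite_cover K (a b : nat -> 'rV[R]_n) :
  (forall k i, a k 0 i <= b k 0 i) ->
  (forall y, cube y -> exists2 k, (k < K)%N & box (a k) (b k) y) ->
  1 <= \sum_(k < K) box_volume (a k) (b k).
Proof.
move=> ab cov; apply/ler_addgt0Pr => e e0.
have eK : 0 < e / K.+1%:R by rewrite divr_gt0.
have [m mP] : exists m : nat, forall k : 'I_K,
    \prod_i (b k 0 i - a k 0 i + m.+1%:R^-1 * 1) < box_volume (a k) (b k) + e / K.+1%:R.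
  have : \forall m \near \oo, forall k : 'I_K,
    \prod_i (b k 0 i - a k 0 i + m.+1%:R^-1 * 1) < box_volume (a k) (b k) + e / K.+1%:R.
    apply: filter_forall => k.
    have [d d0 dP] := prod_perturb (fun i => b k 0 i - a k 0 i) (fun=> 1) eK.
    have := near_infty_natSinv_lt (PosNum d0); apply: filterS => m /= md.
    by apply: dP.
  by move=> [m _ /(_ m (leqnn m))]; exists m.
apply: le_trans (cube_lattice_cover m ab cov) _.
apply: le_trans (ler_sum _ (fun k _ => ltW (mP k))) _.
rewrite big_split /= lerD2l sumr_const card_ord -[leLHS]mulr_natl mulrCA.
by rewrite ler_piMr ?(ltW e0)// ler_pdivrMr// mul1r ler_nat.
Qed.

(** The boxes of a countable cover are thickened to open ones, at the cost of [e / 2 ^ (k + 1)] for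
    the [k]-th. Compactness of the cube leaves finitely many, to which the finite case applies. *)
Lemma volume_cube_ge1 : (1 <= volume cube)%E.
Proof.
apply: le_ereal_inf_tmp => _ [a [b [ab cov ->]]].
apply/lee_addgt0Pr => e e0.
have bv0 k : (0 <= (box_volume (a k) (b k))%:E)%E by rewrite lee_fin box_volume_ge0.
apply: le_trans (epsilon_trick xpredT bv0 (ltW e0)).
have ek k : 0 < e / (2 ^ k.+1)%:R by rewrite divr_gt0// ltr0n expn_gt0.
(* Each side grows by [eta k] at both ends, hence the factor 2. *)
have [eta etaP] : {eta : nat -> R & forall k, 0 < eta k /\
    \prod_i (b k 0 i - a k 0 i + eta k * 2) <
      box_volume (a k) (b k) + e / (2 ^ k.+1)%:R}.
  apply: (@choice _ _ (fun k t => 0 < t /\ \prod_i (b k 0 i - a k 0 i + t * 2) <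
      box_volume (a k) (b k) + e / (2 ^ k.+1)%:R)) => k.
  have [d d0 dP] := prod_perturb (fun i => b k 0 i - a k 0 i) (fun=> 2) (ek k).
  exists (d / 2); split; first by rewrite divr_gt0.
  by apply: dP; [rewrite divr_ge0// ltW|lra].
pose a' k : 'rV[R]_n := a k - const_mx (eta k).
pose b' k : 'rV[R]_n := b k + const_mx (eta k).
have ab' k i : a' k 0 i <= b' k 0 i.
  by rewrite !mxE; have := ab k i; have [+ _] := etaP k; lra.
have bv' k : box_volume (a' k) (b' k) <= box_volume (a k) (b k) + e / (2 ^ k.+1)%:R.
  apply/ltW/(le_lt_trans _ (etaP k).2); rewrite le_eqVlt; apply/orP; left; apply/eqP.
  by apply: eq_bigr => i _; rewrite !mxE; ring.
pose O k := [set y : 'rV[R]_n | forall i, a' k 0 i < y 0 i < b' k 0 i].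
have oO k : open (O k).
  rewrite openE => y yO.
  apply: (@filter_forall _ _
    (fun i (z : 'rV[R]_n) => a' k 0 i < z 0 i < b' k 0 i) _ (nbhs_filter y)) => i.
  have /andP[h1 h2] := yO i.
  have c0 := @coord_continuous R 1 n 0 i y.
  move: (@filterI _ _ (nbhs_filter y) _ _ (c0 _ (lt_nbhsr h1)) (c0 _ (lt_nbhsl h2))).
  by apply: (@filterS _ _ (nbhs_filter y)) => z [/= -> ->].
have cpt : compact cube.
  have -> : cube = [set v : 'rV[R]_n | forall i, `[(0 : R), 1]%classic (v ord0 i)].
    by apply/seteqP; split => y yc i; have := yc i; rewrite /= in_itv !mxE.
  apply: (@rV_compact _ _ (fun=> `[(0 : R), 1]%classic)) => i.
  exact: segment_compact.
have : cube `<=` cover setT O.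
  move=> y /cov[k _ yk]; exists k => // i; rewrite !mxE.
  have := yk i; have [+ _] := etaP k; lra.
move: cpt; rewrite compact_cover => cpt /(cpt nat setT O (fun k _ => oO k)) [D' _ covD].
pose K := (\max_(k <- finmap.enum_fset D') k).+1.
have : 1 <= \sum_(k < K) box_volume (a' k) (b' k).
  apply: cube_finite_cover => // y /covD [k kD yk]; exists k.
    by rewrite ltnS; apply: (@leq_bigmax_seq _ _ xpredT id).
  by move=> i; have /andP[h1 h2] := yk i; rewrite !ltW.
rewrite -lee_fin => /le_trans; apply.
apply: (@le_trans _ _ (\sum_(0 <= k < K) ((box_volume (a k) (b k))%:E + (e / (2 ^ k.+1)%:R)%:E))%E).
  rewrite -sumEFin big_mkord lee_sum// => k _.
  by rewrite -EFinD lee_fin.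
apply: nneseries_lim_ge => k _ _.
by rewrite adde_ge0// lee_fin ltW.
Qed.

(** A scaled unit cube inside and a box outside. Both bounds matter for [sigma_BH]: [fine] sends an
    infinite volume to 0, and its denominator must not be 0. *)
Lemma volume_fin_pos A (r1 r2 : R) : 0 < r1 -> 0 < r2 ->
  (forall y : 'rV[R]_n, (forall i, 0 <= y 0 i <= r1) -> A y) ->
  (forall y : 'rV[R]_n, A y -> forall i, `|y 0 i| <= r2) ->
  0 < fine (volume A) /\ volume A = (fine (volume A))%:E.
Proof.
move=> r10 r20 inA outA.
have fin : (volume A <= (box_volume (const_mx (- r2) : 'rV[R]_n) (const_mx r2))%:E)%E.
  apply: le_trans (volume_box_le n0 _); last by move=> i; rewrite !mxE; lra.
  by apply: le_volume => y /outA yA i; rewrite !mxE -ler_norml.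
have M1 : (r1%:M : 'M[R]_n) \in unitmx.
  by rewrite unitmxE det_scalar unitfE expf_neq0// gt_eqF.
have pos : (0 < volume A)%E.
  apply: (@lt_le_trans _ _ (`|\det (r1%:M : 'M[R]_n)|%:E * volume cube)%E).
    rewrite mule_gt0//; last exact: lt_le_trans volume_cube_ge1.
    by rewrite lte_fin normr_gt0; move: M1; rewrite unitmxE unitfE.
  rewrite -volume_linear//; apply: le_volume => _ [w wc <-]; apply: inA => i.
  have := wc i; rewrite mul_mx_scalar !mxE => /andP[h1 h2].
  by rewrite mulr_ge0 ?(ltW r10)//= ler_piMr// ltW.
have fv : volume A \is a fin_num.
  by rewrite ge0_fin_numE ?(ltW pos)// (le_lt_trans fin) ?ltry.
by rewrite fineK//; split=> //; rewrite fine_gt0// pos (le_lt_trans fin) ?ltry.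
Qed.

End VolumeCube.

(** * Orthonormal frames adapted to an orthogonal splitting *)

Section AdaptedFrame.
Context {R : realType} {n : nat}.
Notation V := 'rV[R]_n.
Variable b : V -> V -> R.
Hypothesis bP : inner_product b.

Lemma ipC u v : b u v = b v u. Proof. by case: bP. Qed.

Lemma ip_suml (I : Type) (r : seq I) (P : pred I) (c : I -> R) (u : I -> V) w :
  b (\sum_(i <- r | P i) c i *: u i) w = \sum_(i <- r | P i) c i * b (u i) w.
Proof.
have [_ bl _] := bP.
have b0 : b 0 w = 0.
  have := bl 1 0 0 w; rewrite scale1r addr0 mul1r => e.
  by apply: (@addrI _ (b 0 w)); rewrite addr0.
elim: r => [|i r IH]; first by rewrite !big_nil.
by rewrite !big_cons; case: ifP => // _; rewrite bl IH.
Qed.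

Lemma ip_sumr (I : Type) (r : seq I) (P : pred I) (c : I -> R) (u : I -> V) w :
  b w (\sum_(i <- r | P i) c i *: u i) = \sum_(i <- r | P i) c i * b w (u i).
Proof. by rewrite ipC ip_suml; apply: eq_bigr => i _; rewrite ipC. Qed.

Lemma ipZ c d u v : b (c *: u) (d *: v) = c * d * b u v.
Proof.
have := ip_suml [:: tt] xpredT (fun=> c) (fun=> u) (d *: v).
have := ip_sumr [:: tt] xpredT (fun=> d) (fun=> v) u.
by rewrite !big_seq1 => -> ->; rewrite mulrA.
Qed.

Lemma ipD u v w : b (u + v) w = b u w + b v w.
Proof. by have [_ bl _] := bP; rewrite -[u in LHS]scale1r bl mul1r. Qed.

Lemma ip0 u : b 0 u = 0.
Proof. by have := ipD 0 0 u; rewrite addr0 => /eqP; rewrite addrC -subr_eq subrr eq_sym => /eqP. Qed.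

Lemma ip_ge0 u : 0 <= b u u.
Proof.
have [_ _ pos] := bP; have [->|u0] := eqVneq u 0; first by rewrite ip0.
exact/ltW/pos.
Qed.

Lemma ip_eq0 u : (b u u == 0) = (u == 0).
Proof.
have [_ _ pos] := bP; have [->|u0] := eqVneq u 0; first by rewrite ip0 eqxx.
by rewrite gt_eqF// pos.
Qed.

Definition orthonormal (s : seq V) :=
  forall i j, (i < size s)%N -> (j < size s)%N -> b s`_i s`_j = (i == j)%:R.

Lemma ip_normalize u : u != 0 ->
  b ((Num.sqrt (b u u))^-1 *: u) ((Num.sqrt (b u u))^-1 *: u) = 1.
Proof.
move=> u0; rewrite ipZ -invfM -expr2 sqr_sqrtr ?ip_ge0// mulVf//.
by rewrite ip_eq0.
Qed.

Lemma orthonormal_extend (U : {vspace V}) s : orthonormal s ->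
  {subset s <= U} -> (size s < \dim U)%N ->
  exists2 v, v \in U & orthonormal (rcons s v).
Proof.
move=> os sU sd.
have /subvPn[w wU ws] : ~~ (U <= span s)%VS.
  apply: contraL sd => /dimvS Us; rewrite -leqNgt (leq_trans Us)//.
  exact: dim_span.
pose z := w - \sum_(i < size s) b w s`_i *: s`_i.
have sP (i : 'I_(size s)) : s`_i \in span s by rewrite memv_span ?mem_nth.
have z0 : z != 0.
  apply: contraNneq ws => /subr0_eq ->.
  by apply: memv_suml => i _; rewrite memvZ.
have zU : z \in U.
  rewrite memvB//; apply: memv_suml => i _; rewrite memvZ// sU//.
  by rewrite mem_nth.
have bz (j : 'I_(size s)) : b z s`_j = 0.
  rewrite /z -sumrN.
  under eq_bigr do rewrite -scaleNr.
  rewrite ipD ip_suml (bigD1 j)//= os// eqxx mulr1 big1 ?addr0 ?subrr// => i ij.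
  by rewrite os// (_ : (_ == _)%N = false) ?mulr0//; apply/negbTE.
exists ((Num.sqrt (b z z))^-1 *: z); first by rewrite memvZ.
have bzj c j : (j < size s)%N -> b (c *: z) s`_j = 0.
  by move=> js; rewrite -[s`_j]scale1r ipZ (bz (Ordinal js)) mulr0.
move=> i j; rewrite size_rcons !ltnS !nth_rcons.
rewrite leq_eqVlt => /predU1P[->|is_]; rewrite leq_eqVlt => /predU1P[->|js].
- by rewrite ltnn !eqxx ip_normalize.
- by rewrite ltnn !eqxx js bzj// gtn_eqF.
- by rewrite ltnn !eqxx is_ ipC bzj// ltn_eqF.
- by rewrite is_ js os.
Qed.

(** Gram-Schmidt started in the direction of [u]. If [u = 0] any unit vector of [U] can come first,
    its coefficient being 0. *)
Lemma orthonormal_basis (U : {vspace V}) u : u \in U -> (0 < \dim U)%N ->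
  exists s, [/\ orthonormal s, {subset s <= U}, size s = \dim U
                & u = Num.sqrt (b u u) *: s`_0].
Proof.
move=> uU dU.
have [e [oe eU ue]] : exists e, [/\ orthonormal [:: e], e \in U & u = Num.sqrt (b u u) *: e].
  have [u0|u0] := eqVneq u 0.
    have [|||v vU ov] := @orthonormal_extend U [::]; [by move=> []|by []|by []|].
    by exists v; rewrite u0 ip0 sqrtr0 scale0r.
  exists ((Num.sqrt (b u u))^-1 *: u); split; last 1 first.
  - rewrite scalerA mulfV ?scale1r// sqrtr_eq0 -ltNge lt_def ip_ge0 ip_eq0 u0//.
  - by move=> [|//] [|//] _ _; rewrite ip_normalize.
  - by rewrite memvZ.
suff H k : (k < \dim U)%N -> exists s, [/\ orthonormal s, {subset s <= U},
    size s = k.+1 & s`_0 = e].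
  have [|s [os sU ss s0]] := H (\dim U).-1; first by rewrite prednK.
  by exists s; split; rewrite ?s0// ss prednK.
elim: k => [_|k IH kU].
  by exists [:: e]; split => // x; rewrite inE => /eqP ->.
have [s [os sU ss s0]] := IH (ltnW kU).
have [|v vU ov] := orthonormal_extend os sU; first by rewrite ss.
exists (rcons s v); split => //.
- by move=> x; rewrite mem_rcons inE => /predU1P[->|/sU].
- by rewrite size_rcons ss.
- by rewrite nth_rcons ss /= s0.
Qed.

(** With [u1] and [u2] on the first axes of the two blocks, [u1 + u2] is described by its two norms
    alone. *)
Lemma adapted_frame (U1 U2 : {vspace V}) u1 u2 (i1 i2 : 'I_n) :
  (U1 + U2 = fullv)%VS -> (forall u v, u \in U1 -> v \in U2 -> b u v = 0) ->
  (0 < \dim U1)%N -> (0 < \dim U2)%N -> u1 \in U1 -> u2 \in U2 ->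
  i1 = 0%N :> nat -> i2 = \dim U1 :> nat ->
  exists E : 'M[R]_n,
  [/\ forall i : 'I_n, row i E \in (if (i < \dim U1)%N then U1 else U2),
      forall i j, b (row i E) (row j E) = (i == j)%:R,
      u1 = Num.sqrt (b u1 u1) *: row i1 E
    & u2 = Num.sqrt (b u2 u2) *: row i2 E].
Proof.
move=> U12 orth d1 d2 uU1 uU2 i1E i2E.
have dims : (\dim U1 + \dim U2)%N = n.
  have cap : (U1 :&: U2 = 0)%VS.
    apply/eqP; rewrite -subv0; apply/subvP => x; rewrite memv_cap memv0.
    by move=> /andP[x1 x2]; rewrite -ip_eq0 orth.
  by rewrite -dimv_disjoint_sum// U12 dimvf dim_matrix mul1r.
have [s1 [on1 sU1 z1 h1]] := orthonormal_basis uU1 d1.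
have [s2 [on2 sU2 z2 h2]] := orthonormal_basis uU2 d2.
pose E : 'M[R]_n := \matrix_(i < n) (s1 ++ s2)`_i.
have rE i : row i E = (s1 ++ s2)`_i by rewrite rowK.
have lt2 (i : 'I_n) : (i < \dim U1)%N = false -> (i - \dim U1 < \dim U2)%N.
  by move=> /negbT; rewrite -leqNgt => h; rewrite ltn_subLR// dims.
have m1 i : (i < \dim U1)%N -> s1`_i \in U1.
  by move=> h; apply: sU1; rewrite mem_nth ?z1.
have m2 i : (i < \dim U2)%N -> s2`_i \in U2.
  by move=> h; apply: sU2; rewrite mem_nth ?z2.
exists E; split.
- move=> i; rewrite rE nth_cat z1; case: ifP => h; first exact: m1.
  exact/m2/lt2.
- move=> i j; rewrite !rE !nth_cat z1.
  case: ifP => hi; case: ifP => hj.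
  + by rewrite on1 ?z1.
  + rewrite orth ?m1 ?m2 ?lt2// (_ : (i == j) = false)//.
    by apply: contraFF hj => /eqP <-.
  + rewrite ipC orth ?m1 ?m2 ?lt2// (_ : (i == j) = false)//.
    by apply: contraFF hi => /eqP ->.
  + rewrite on2 ?z2 ?lt2//; move: hi hj => /negbT + /negbT.
    rewrite -!leqNgt => hi hj.
    suff -> : (i - \dim U1 == j - \dim U1)%N = (i == j) by [].
    by rewrite -(eqn_add2r (\dim U1)) !subnK.
- by rewrite rE nth_cat z1 i1E d1.
- by rewrite rE nth_cat z1 i2E ltnn subnn.
Qed.

End AdaptedFrame.

(** * The fundamental tensor as a Hessian on a single tangent space *)

Section VerticalHessian.
Context {R : realType} {n : nat}.
Notation V := 'rV[R]_n.
Notation nonzero := [set y : V | y != 0].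

Lemma open_nonzero : open nonzero.
Proof.
have -> : nonzero = (fun y : V => `|y|) @^-1` [set r : R | r != 0].
  by apply/seteqP; split => y /=; rewrite normr_eq0.
apply: open_comp; last exact: open_neq.
by move=> y _; apply: norm_continuous.
Qed.

Lemma derive_row (u : V -> R^o) v y : differentiable u y ->
  'D_v u y = \sum_i v 0 i * 'D_(delta_mx 0 i) u y.
Proof.
move=> du; rewrite deriveE// [v in LHS]row_sum_delta linear_sum.
by apply: eq_bigr => i _; rewrite linearZ_LR deriveE.
Qed.

(** For [H] the square of a Minkowski norm this is the matrix of [g_y]. *)
Definition vhess (H : V -> R) (y : V) : 'M[R]_n :=
  \matrix_(i, j) (2^-1 * 'D_(delta_mx 0 j) ('D_(delta_mx 0 i) (H : V -> R^o)) y).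

Lemma vhessE H y i j :
  vhess H y i j = 2^-1 * 'D_(delta_mx 0 j) ('D_(delta_mx 0 i) (H : V -> R^o)) y.
Proof. by rewrite mxE. Qed.

Lemma derive2_vhess (H : V -> R) (u v y : V) :
  smooth_on nonzero (H : V -> R^o) -> y != 0 ->
  2^-1 * 'D_u ('D_v (H : V -> R^o)) y = \sum_i \sum_j v 0 i * u 0 j * vhess H y i j.
Proof.
move=> sH y0.
have sD i : smooth_on nonzero ('D_(delta_mx 0 i) (H : V -> R^o)).
  exact: smooth_on_derive.
have e1 : 'D_u ('D_v (H : V -> R^o)) y =
    'D_u (fun w => \sum_i v 0 i * 'D_(delta_mx 0 i) (H : V -> R^o) w : R^o) y.
  apply: (eq_derive_on u open_nonzero _ y0) => w w0.
  exact/derive_row/(smooth_on_differentiable sH).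
have D1 : is_derive y u (fun w => \sum_i v 0 i * 'D_(delta_mx 0 i) (H : V -> R^o) w : R^o)
    (\sum_i v 0 i * 'D_u ('D_(delta_mx 0 i) (H : V -> R^o)) y).
  apply: is_derive_bigsum => i _.
  apply: (@is_deriveZ _ _ _ ('D_(delta_mx 0 i) (H : V -> R^o))).
  exact/derivableP/diff_derivable/(smooth_on_differentiable (sD i)).
rewrite e1 (@derive_val _ _ _ _ _ _ _ D1) mulr_sumr; apply: eq_bigr => i _.
rewrite derive_row; last exact: smooth_on_differentiable (sD i) y0.
rewrite !mulr_sumr; apply: eq_bigr => j _.
rewrite vhessE; move: ('D_(delta_mx 0 j) _ y : R) => t.
by ring.
Qed.

Lemma vhess_mulmx (H : V -> R) (Phi : 'M[R]_n) (y : V) (lambda : R) :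
  smooth_on nonzero (H : V -> R^o) -> Phi \in unitmx -> y != 0 ->
  vhess (fun w => lambda * H (w *m Phi)) y =
    lambda *: (Phi *m vhess H (y *m Phi) *m Phi^T).
Proof.
move=> sH Pu y0.
have P0 (w : V) : w != 0 -> w *m Phi != 0.
  by apply: contra => /eqP wP; rewrite -[w](mulmxK Pu) wP mul0mx.
have lin : linear (mulmxr Phi : V -> V) by move=> a u v; rewrite linearP.
have comp u (h : V -> R^o) w : 'D_u (h \o mulmxr Phi) w = 'D_(u *m Phi) h (w *m Phi).
  exact: (congr1 (fun k => k w) (derive_linear h u lin)).
have scal u (h : V -> R^o) w : derivable h w u ->
    'D_u (lambda *: h) w = lambda * 'D_u h w.
  by move=> dh; rewrite deriveZ.
have dcomp (h : V -> R^o) u w : differentiable h (w *m Phi) ->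
    derivable (h \o mulmxr Phi) w u.
  move=> dh; have := diff_derivable (v := u *m Phi) dh.
  rewrite /derivable.
  suff -> : (fun h0 : R => h0^-1 *: ((h \o shift (w *m Phi)) (h0 *: (u *m Phi)) - h (w *m Phi))) =
    (fun h0 : R => h0^-1 *: (((h \o mulmxr Phi) \o shift w) (h0 *: u) - (h \o mulmxr Phi) w)) by [].
  by apply/funext => h0 /=; rewrite mulmxDl scalemxAl.
apply/matrixP => i j; rewrite vhessE.
have e1 : 'D_(delta_mx 0 j) ('D_(delta_mx 0 i) (fun w => lambda * H (w *m Phi) : R^o)) y =
    'D_(delta_mx 0 j) (lambda *: ('D_(delta_mx 0 i *m Phi) (H : V -> R^o) \o mulmxr Phi)) y.
  apply: (eq_derive_on _ open_nonzero _ y0) => w w0.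
  transitivity (lambda * 'D_(delta_mx 0 i) ((H : V -> R^o) \o mulmxr Phi) w).
    apply: scal; apply: dcomp.
    by apply: (smooth_on_differentiable sH); apply: P0.
  by rewrite comp.
rewrite {}e1 scal; last first.
  apply: dcomp.
  by apply: (smooth_on_differentiable (smooth_on_derive _ sH)); apply: P0.
rewrite comp mulrCA (derive2_vhess _ _ sH (P0 _ y0)).
rewrite [RHS]mxE; congr (_ * _).
rewrite mxE [RHS](eq_bigr (fun l => \sum_k (Phi i k * Phi j l * vhess H (y *m Phi) k l))).
  rewrite exchange_big; apply: eq_bigr => l _; apply: eq_bigr => k _.
  by rewrite -!rowE !mxE.
move=> l _; rewrite mxE big_distrl; apply: eq_bigr => k _ /=.
by rewrite [Phi^T l j]mxE mulrAC.
Qed.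

Lemma fundamental_vhess (f : V * V -> R) x y :
  fundamental_tensor f (x, y) = vhess (fun w => f (x, w) ^+ 2) y.
Proof.
apply/matrixP => i j; rewrite [LHS]fundamentalE [RHS]vhessE.
apply: (congr1 (fun t => 2^-1 * t)).
transitivity ('D_(delta_mx 0 j)
    (fun w => dy i (fun z => f z ^+ 2) (x, w) : R^o) y); first exact: derive_slice.
have -> // : (fun w => dy i (fun z => f z ^+ 2) (x, w) : R^o) =
  'D_(delta_mx 0 i) (fun w => f (x, w) ^+ 2 : R^o).
by apply/funext => w; exact: derive_slice.
Qed.

(** A nonzero vector in the kernel would have length 0 for the inner product [g_y]. *)
Lemma minkowski_vhess_unit (N : V -> R) y : minkowski_norm N -> y != 0 ->
  vhess (fun w => N w ^+ 2) y \in unitmx.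
Proof.
move=> [_ _ sN _ ip] y0.
have sN2 : smooth_on nonzero (fun w => N w ^+ 2 : R^o).
  exact: (smooth_onM open_nonzero sN sN).
rewrite -row_free_unit -kermx_eq0; apply/rowV0P => u /sub_kermxP uA.
apply/eqP/negPn/negP => u0.
have [_ _ /(_ u u0)] := ip y y0.
rewrite (derive2_vhess _ _ sN2 y0).
have -> : \sum_i \sum_j u 0 i * u 0 j * vhess (fun w => N w ^+ 2) y i j =
    (u *m vhess (fun w => N w ^+ 2) y *m u^T) 0 0.
  rewrite mxE exchange_big; apply: eq_bigr => j _ /=.
  rewrite [in RHS]mxE big_distrl; apply: eq_bigr => i _ /=.
  by rewrite [u^T _ _]mxE mulrAC.
by rewrite uA mul0mx mxE ltxx.
Qed.

End VerticalHessian.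

(** * Tangent vectors in charts and sections of subbundles *)

Section Charts.
Context {R : realType} {n : nat} {M : manifold R n}.
Implicit Types (c d : chart R n M) (p q : M) (x y : 'rV[R]_n).

Lemma near_chart c p (U : set M) : cdom c p -> open U -> U p ->
  \forall x \near c p, exists q, [/\ x = c q, cdom c q & U q].
Proof.
move=> cp oU Up.
have imgp : cimg c (c p) by exists p.
have n1 : nbhs (c p) (cimg c) by apply: open_nbhs_nbhs; split=> //; apply: cimg_open.
have n2 : nbhs (c p) (cinv c @^-1` U).
  apply: (cinv_continuous imgp); rewrite cmapK//.
  by apply: open_nbhs_nbhs.
apply: filterS2 n1 n2 => x [q cq <-] /=; rewrite cmapK// => Uq.
by exists q.
Qed.

Lemma near_chart_dom c p : cdom c p ->
  \forall x \near c p, exists2 q, x = c q & cdom c q.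
Proof.
move=> cp; have := near_chart cp (cdom_open c) cp.
by apply: filterS => x [q [-> cq _]]; exists q.
Qed.

Lemma differentiable_transition c d p : atlas c -> atlas d ->
  cdom c p -> cdom d p -> differentiable (d \o cinv c) (c p).
Proof.
move=> ac ad cp dp; have [sm _] := atlas_compatible ac ad.
by apply: smooth_on_differentiable sm _; exists p.
Qed.

Lemma diff_transition c d e p y : atlas c -> atlas d -> atlas e ->
  cdom c p -> cdom d p -> cdom e p ->
  'd (e \o cinv d) (d p) ('d (d \o cinv c) (c p) y) = 'd (e \o cinv c) (c p) y.
Proof.
move=> ac ad ae cp dp ep.
have d1 := differentiable_transition ac ad cp dp.
have d2 : differentiable (e \o cinv d) ((d \o cinv c) (c p)).
  by rewrite /= cmapK//; apply: differentiable_transition.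
have d3 := differentiable_transition ac ae cp ep.
have d12 : differentiable ((e \o cinv d) \o (d \o cinv c)) (c p).
  exact: differentiable_comp.
have e2 : (d \o cinv c) (c p) = d p by rewrite /= cmapK.
have e1 := congr1 (fun h : 'rV[R]_n -> 'rV[R]_n => h y) (diff_comp d1 d2).
rewrite e2 in e1; apply: etrans (esym e1) _.
apply: etrans (esym (deriveE y d12)) _; apply: etrans _ (deriveE y d3).
apply: near_eq_derive; have := near_chart cp (cdom_open d) dp.
by apply: filterS => x [q [-> cq dq]] /=; rewrite !cmapK.
Qed.

Lemma diff_chart_id c p y : cdom c p -> 'd (c \o cinv c) (c p) y = y.
Proof.
move=> cp.
have nid : {near c p, id =1 c \o cinv c}.
  have := near_chart_dom cp.
  by apply: filterS => x [q -> cq] /=; rewrite cmapK.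
have did : differentiable (@id 'rV[R]_n) (c p) by [].
rewrite -(deriveE y (near_eq_differentiable nid did)).
by rewrite -(near_eq_derive _ nid) derive_id.
Qed.

Definition tvec_inv c p y : 'rV[R]_n := 'd (c \o cinv (chart_at p)) (chart_at p p) y.

Lemma tvecK c p y : atlas c -> cdom c p -> tvec_inv c p (tvec c p y) = y.
Proof.
move=> ac cp; rewrite /tvec_inv /tvec.
rewrite (diff_transition _ ac (atlas_chart_at p) ac cp (mem_chart_at p) cp).
exact: diff_chart_id.
Qed.

Lemma tvec_invK c p y : atlas c -> cdom c p -> tvec c p (tvec_inv c p y) = y.
Proof.
move=> ac cp; rewrite /tvec_inv /tvec.
rewrite (diff_transition _ (atlas_chart_at p) ac (atlas_chart_at p))//.
- exact/diff_chart_id/mem_chart_at.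
- exact: mem_chart_at.
- exact: mem_chart_at.
Qed.

Definition tvec_mx c p : 'M[R]_n := lin1_mx ('d (chart_at p \o cinv c) (c p)).

Lemma tvecE c p y : tvec c p y = y *m tvec_mx c p.
Proof. by rewrite /tvec_mx mul_rV_lin1. Qed.

Lemma tvec_mx_unit c p : atlas c -> cdom c p -> tvec_mx c p \in unitmx.
Proof.
move=> ac cp; rewrite -row_free_unit -kermx_eq0; apply/rowV0P => u /sub_kermxP.
rewrite -tvecE => Tu; rewrite -(tvecK u ac cp) Tu.
exact: linear0.
Qed.

Lemma tvec_chart c d p y : atlas c -> atlas d -> cdom c p -> cdom d p ->
  tvec c p ('d (c \o cinv d) (d p) y) = tvec d p y.
Proof.
move=> ac ad cp dp.
exact: (diff_transition _ ad ac (atlas_chart_at p) dp cp (mem_chart_at p)).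
Qed.

Lemma differentiable_row_coord (V : normedModType R) (h : V -> 'rV[R]_n) z j :
  differentiable h z -> differentiable (fun t => h t 0 j : R^o) z.
Proof.
move=> dh.
exact: (@differentiable_comp _ _ _ _ h (fun A : 'rV[R]_n => A 0 j : R^o) _ dh
  (differentiable_coord _ _ _)).
Qed.

Lemma differentiable_bigsum (V : normedModType R) m (h : 'I_m -> V -> R^o) z :
  (forall i, differentiable (h i) z) -> differentiable (fun t => \sum_i h i t : R^o) z.
Proof. by move=> dh; rewrite -fct_sumE; apply: differentiable_sum. Qed.

(** The coefficients of [y] in a local frame of [W] are kept constant. The frame lives in some other
    chart [d], so the section is transported to [c] by the differential of the transition map. *)
Lemma subbundle_section k (W : M -> {vspace 'rV[R]_n}) c p y :
  subbundle k W -> atlas c -> cdom c p -> tvec c p y \in W p ->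
  exists v : 'rV[R]_n -> 'rV[R]_n,
  [/\ forall j, differentiable (fun x => v x 0 j : R^o) (c p),
      v (c p) = y
    & \forall x \near c p, tvec c (cinv c x) (v x) \in W (cinv c x)].
Proof.
move=> [_ /(_ p)[d [U [X [ad oU Up Ud [sX WX]]]]]] ac cp.
have dp := Ud _ Up.
rewrite (WX _ Up) span_def big_image /= => /memv_sumP[w wX yE].
have [s sE] : exists s : 'I_k -> R, forall i, w i = s i *: tvec d p (X i (d p)).
  have h i : exists t, w i = t *: tvec d p (X i (d p)).
    by have /vlineP[t ->] := wX i isT; exists t.
  by have [s sP] := choice h; exists s.
pose Y x := \sum_i s i *: X i x.
pose Phi := c \o cinv d.
pose v' x := 'd Phi x (Y x).
have DY j : differentiable (fun x => Y x 0 j : R^o) (d p).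
  rewrite (_ : (fun _ => _) = fun x => \sum_i (s i * X i x 0 j)); last first.
    by apply/funext => x; rewrite /Y summxE; apply: eq_bigr => i _; rewrite mxE.
  apply: differentiable_bigsum => i; apply: (@differentiableZ _ _ _ (fun x => X i x 0 j : R^o)).
  apply: differentiable_row_coord; apply: smooth_on_differentiable (sX i) _.
  by exists p.
have tv q : cdom c q -> U q -> tvec c q (v' (d q)) = \sum_i s i *: tvec d q (X i (d q)).
  move=> cq Uq; rewrite /v' tvec_chart//; last exact: Ud.
  by rewrite /tvec /Y linear_sum; apply: eq_bigr => i _; rewrite linearZ_LR.
exists (fun x => v' (d (cinv c x))); split.
- move=> j.
  have dq : differentiable (d \o cinv c) (c p) by apply: differentiable_transition.
  suff dv : differentiable (fun x => v' x 0 j : R^o) ((d \o cinv c) (c p)).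
    exact: (differentiable_comp dq dv).
  rewrite /= cmapK//.
  have dD l : differentiable ('D_(delta_mx 0 l) Phi) (d p).
    have [sPhi _] := atlas_compatible ad ac.
    by apply: smooth_on_differentiable (smooth_on_derive _ sPhi) _; exists p.
  (* Point and direction both vary in ['d Phi x (Y x)]; expanding [Y x] over the basis leaves
     products of differentiable functions. *)
  apply: (@near_eq_differentiable _ _ _
    (fun x => \sum_l (Y x 0 l * 'D_(delta_mx 0 l) Phi x 0 j) : R^o)); last first.
    apply: differentiable_bigsum => l; apply: differentiableM; first exact: DY.
    exact: differentiable_row_coord.
  have := near_chart dp (cdom_open c) cp.
  apply: filterS => _ [q [-> qd qc]].
  have dPhi : differentiable Phi (d q) by apply: differentiable_transition.
  rewrite /v' [in RHS](row_sum_delta (Y (d q))) linear_sum summxE.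
  by apply: eq_bigr => l _; rewrite linearZ_LR mxE deriveE.
- rewrite cmapK// -(tvecK y ac cp) -(tvecK (v' _) ac cp); congr (tvec_inv _ _ _).
  by rewrite tv// yE; apply: eq_bigr => i _.
- have := near_chart cp oU Up.
  apply: filterS => x [q [-> cq Uq]]; rewrite cmapK// tv// WX//.
  apply: memv_suml => i _; rewrite memvZ// memv_span//.
  by apply/mapP; exists i => //; rewrite mem_enum.
Qed.

End Charts.

(** * First order estimates for functions of a real variable *)

Section RealLemmas.
Context {R : realType}.
Implicit Types (h : R -> R).

Lemma is_derive_line0 (V : normedModType R) (u : V -> R^o) (x w : V) :
  differentiable u x ->
  is_derive (0 : R) 1 (fun t : R => u (x + t *: w) : R^o) ('D_w u x).
Proof.
by move=> du; have := @is_derive_line _ _ _ u x w 0; rewrite scale0r addr0; apply.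
Qed.

Lemma near0_scale_lt (C d : R) : 0 < C -> 0 < d ->
  \forall t \near (0 : R), C * `|t| < d.
Proof.
move=> C0 d0; apply/nbhs_ballP; exists (d / C); first by rewrite /= divr_gt0.
by move=> t; rewrite -ball_normE /= sub0r normrN ltr_pdivlMr// mulrC.
Qed.

Lemma derive_near_bound h (l e : R) : is_derive (0 : R) 1 h l -> 0 < e ->
  \forall t \near (0 : R), `|h t - h 0 - t * l| <= e * `|t|.
Proof.
move=> [dh lE] e0; have dh' := (derivable1_diffP _ _).1 dh.
have [d d0 dP] := differentiable_bound dh' e0.
apply/nbhs_ballP; exists d => //= t; rewrite -ball_normE /= sub0r normrN => /dP.
rewrite add0r -[X in 'd _ _ X]mulr1 (linearZ_LR ('d h 0) t 1) -deriveE// lE.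
by [].
Qed.

Lemma derive_near_lipschitz h (l : R) : is_derive (0 : R) 1 h l -> h 0 = 0 ->
  \forall t \near (0 : R), `|h t| <= (`|l| + 1) * `|t|.
Proof.
move=> dh h0; have := derive_near_bound dh ltr01; apply: filterS => t.
rewrite h0 subr0 mul1r mulrDl mul1r => H.
rewrite -[h t](subrK (t * l)) (le_trans (ler_normD _ _))// addrC lerD//.
by rewrite normrM mulrC.
Qed.

Lemma derive_near_cont h (l e : R) : is_derive (0 : R) 1 h l -> 0 < e ->
  \forall t \near (0 : R), `|h t - h 0| < e.
Proof.
move=> [dh _] e0.
have /derivable1_diffP/differentiable_continuous/cvgrPdist_lt/(_ e e0) := dh.
by apply: filterS => t; rewrite distrC.
Qed.

(** At [r] and [-r] the increment of [h] is the same while [r * l] changes sign, so the linear term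
    drops out. A bound, unlike a derivative, can be evaluated at a ratio that is merely O(t). *)
Lemma even_near_bound h (l e : R) : is_derive (0 : R) 1 h l -> 0 < e ->
  (forall r, h (- r) = h r) ->
  exists2 d, 0 < d & forall r, `|r| < d -> `|h r - h 0| <= e * `|r|.
Proof.
move=> dh e0 even; have /nbhs_ballP[d /= d0 dP] := derive_near_bound dh e0.
exists d => // r rd; have := dP r; have := dP (- r).
rewrite -!ball_normE /= !sub0r !normrN even => /(_ rd) h1 /(_ rd) h2.
move: h1 h2; rewrite !ler_norml => /andP[a1 a2] /andP[b1 b2].
by apply/andP; split; lra.
Qed.

Lemma derive_eq0 h (l : R) : is_derive (0 : R) 1 h l -> h 0 = 0 ->
  (forall e, 0 < e -> \forall t \near (0 : R), `|h t| <= e * `|t|) -> l = 0.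
Proof.
move=> dh h0 small; apply/eqP; rewrite -normr_le0; apply/ler_addgt0Pr => e e0.
have e2 : 0 < e / 2 by rewrite divr_gt0.
have /nbhs_ballP[d /= d0 dP] : \forall t \near (0 : R),
    `|h t| <= e / 2 * `|t| /\ `|h t - h 0 - t * l| <= e / 2 * `|t|.
  by apply: filterS2 (small _ e2) (derive_near_bound dh e2).
have t0 : 0 < d / 2 by rewrite divr_gt0.
have := dP (d / 2); rewrite -ball_normE /= sub0r normrN gtr0_norm//.
have -> : d / 2 < d by lra.
move=> /(_ isT)[h1 h2]; rewrite h0 subr0 in h2.
have : `|d / 2 * l| <= e / 2 * (d / 2) + e / 2 * (d / 2).
  by rewrite -[d / 2 * l]opprK normrN -[- _](addKr (h (d / 2))) (le_trans (ler_normD _ _))// normrN lerD.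
rewrite normrM (gtr0_norm t0) => H; rewrite add0r -(ler_pM2l t0) (le_trans H)//.
by rewrite -mulrDl -splitr mulrC.
Qed.

Lemma ln_sqrtr (x : R) : 0 < x -> ln (Num.sqrt x) = 2^-1 * ln x.
Proof.
move=> x0; have := lnXn 2 (_ : 0 < Num.sqrt x); rewrite sqrtr_gt0 => /(_ x0).
by rewrite sqr_sqrtr ?ltW// => ->; rewrite -[ln _ *+ 2]mulr_natl mulKf ?pnatr_eq0.
Qed.

(** The quantity to bound equals [(qr - q0) * Dt]. The denominator of the tolerance absorbs
    [|Dt| <= A + 1] and [r <= C * |t|]. *)
Lemma ratio_defect_bound (ht h0 Dt D0 A qr q0 e C r t : R) : ht * A = qr * Dt -> q0 = h0 ->
    D0 = A -> `|Dt - D0| < 1 -> 0 < A -> 0 < C -> 0 < e -> 0 <= r -> r <= C * `|t| ->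
  `|qr - q0| <= e / ((A + 1) * C) * `|r| -> `|ht * A - Dt * h0| <= e * `|t|.
Proof.
move=> hq -> -> Dt1 Ap Cp ep r0 rt qle.
have -> : ht * A - Dt * h0 = (qr - h0) * Dt by rewrite hq mulrBl [Dt * _]mulrC.
have Dle : `|Dt| <= A + 1.
  move: Dt1; rewrite ltr_norml ler_norml => /andP[D1 D2].
  by apply/andP; split; lra.
rewrite normrM; apply: (@le_trans _ _ (e / ((A + 1) * C) * (C * `|t|) * (A + 1))).
  rewrite ler_pM// (le_trans qle)// (ger0_norm r0) ler_wpM2l//.
  by rewrite divr_ge0 ?(ltW ep)// mulr_ge0// ltW// addr_gt0.
have -> : e / ((A + 1) * C) * (C * `|t|) * (A + 1) = e * `|t|; last exact: lexx.
by field; rewrite gt_eqF// gt_eqF// addr_gt0.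
Qed.

Lemma solve_linear (g s A u : R) : g != 0 -> A != 0 -> 2 * g * s * A - u * g = 0 ->
  s = 2^-1 * u / A.
Proof.
move=> gn An /subr0_eq e; have -> : u = 2 * s * A.
  by apply: (mulIf gn); rewrite -e; ring.
by field.
Qed.

End RealLemmas.

Lemma vertical_linear_hessian0 {R : realType} {n : nat}
    (Om : set ('rV[R]_n * 'rV[R]_n)) (u : 'rV[R]_n * 'rV[R]_n -> R)
    (tau : 'I_n -> 'rV[R]_n -> R) i j z : open Om ->
  (forall w, Om w -> u w = \sum_k w.2 0 k * tau k w.1) -> Om z ->
  dy j (dy i u) z = 0.
Proof.
move=> oOm uE Oz.
have diu w : Om w -> dy i u w = tau i w.1.
  move=> Ow; rewrite [LHS](eq_derive_on _ oOm uE Ow).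
  case: w Ow => x y Ow; rewrite derive_slice /=.
  rewrite -(derive_slice (fun z => \sum_k z.2 0 k * tau k x) x).
  have H : is_derive (x, y) (0, delta_mx 0 i)
      (fun z : 'rV[R]_n * 'rV[R]_n => \sum_k z.2 0 k * tau k x : R^o)
      (\sum_k (i == k)%:R * tau k x).
    apply: is_derive_bigsum => k _.
    have sk := smooth_on_coord2 k (Om := Om).
    apply: is_derive_eq (is_derive_mul (is_derive_smooth (0, delta_mx 0 i) Ow sk)
      (is_derive_cst (tau k x : R^o) _ _)) _.
    by rewrite derive_coord2 mxE eqxx mulr0 add0r mulrC eq_sym.
  rewrite (@derive_val _ _ _ _ _ _ _ H) (bigD1 i)//= eqxx mul1r big1 ?addr0// => k.
  by rewrite eq_sym => /negPf ->; rewrite mul0r.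
rewrite [LHS](eq_derive_on _ oOm diu Oz).
case: z {Oz} => x y; rewrite derive_slice /=.
exact: derive_cst.
Qed.

(** * The metric in a chart: density, spray divergence and S-curvature *)

Section AlphaMetric.
Context {R : realType} {n : nat} {M : manifold R n}.
Variables (F : M -> 'rV[R]_n -> R) (a : M -> 'rV[R]_n -> 'rV[R]_n -> R).
Variables (V1 V2 : M -> {vspace 'rV[R]_n}) (L : R -> R -> R) (k1 k2 : nat).
Hypotheses (finF : finsler_metric F) (riema : riemannian_metric a).
Hypotheses (k1_gt0 : (0 < k1)%N) (k2_gt0 : (0 < k2)%N).
Hypotheses (sub1 : subbundle k1 V1) (sub2 : subbundle k2 V2).
Hypothesis V12 : forall p, (V1 p + V2 p = fullv)%VS.
Hypothesis orthV : forall p u v, u \in V1 p -> v \in V2 p -> a p u v = 0.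
Hypothesis FE : forall p y1 y2, y1 \in V1 p -> y2 \in V2 p ->
  F p (y1 + y2) = Num.sqrt (L (a p y1 y1) (a p y2 y2)).
Implicit Types (p q : M) (x y w : 'rV[R]_n).

Let ipa p : inner_product (a p). Proof. by case: riema. Qed.

Lemma alpha_metric_even p y : F p (- y) = F p y.
Proof.
have /memv_addP[y1 yV1 [y2 yV2 ->]] : y \in (V1 p + V2 p)%VS by rewrite V12 memvf.
rewrite opprD FE ?memvN// FE//.
have e u : a p (- u) (- u) = a p u u.
  by rewrite -scaleN1r (ipZ (ipa p)) mulrNN !mul1r.
by rewrite !e.
Qed.

Lemma dim_ranks p : (k1 + k2)%N = n.
Proof.
have [[d1 _] [d2 _]] := (sub1, sub2).
have cap : (V1 p :&: V2 p = 0)%VS.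
  apply/eqP; rewrite -subv0; apply/subvP => x; rewrite memv_cap memv0.
  by move=> /andP[x1 x2]; rewrite -(ip_eq0 (ipa p)) orthV.
by rewrite -(d1 p) -(d2 p) -dimv_disjoint_sum// V12 dimvf dim_matrix mul1r.
Qed.

(** [F] in the coordinates of any adapted orthonormal frame, the first [k1] of which belong to [V1];
    it is the same at every point. *)
Definition model_norm w : R := Num.sqrt
  (L (\sum_(i < n | (i < k1)%N) w 0 i ^+ 2) (\sum_(i < n | ~~ (i < k1)%N) w 0 i ^+ 2)).

Variable c : chart R n M.
Hypothesis ac : atlas c.

Local Notation f := (in_chart c F).

Lemma in_chartE (G : M -> 'rV[R]_n -> R) p y : cdom c p ->
  in_chart c G (c p, y) = G p (tvec c p y).
Proof. by move=> cp; rewrite /in_chart /= cmapK. Qed.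

Definition gram (x : 'rV[R]_n) : 'M[R]_n := \matrix_(i, j)
  a (cinv c x) (tvec c (cinv c x) (delta_mx 0 i)) (tvec c (cinv c x) (delta_mx 0 j)).

Lemma gramE p u v : cdom c p ->
  (u *m gram (c p) *m v^T) 0 0 = a p (tvec c p u) (tvec c p v).
Proof.
move=> cp.
have tE w : tvec c p w = \sum_i w 0 i *: tvec c p (delta_mx 0 i).
  rewrite [w in LHS]row_sum_delta /tvec linear_sum; apply: eq_bigr => i _.
  by rewrite linearZ_LR.
rewrite (tE u) (tE v) (ip_suml (ipa p)) mxE.
under eq_bigr do rewrite mxE big_distrl /=.
rewrite exchange_big; apply: eq_bigr => i _ /=.
rewrite (ip_sumr (ipa p)) mulr_sumr; apply: eq_bigr => j _.
by rewrite mxE [v^T j 0]mxE cmapK// mulrAC mulrA.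
Qed.

(** An adapted frame read in the coordinates of [c]; the second clause is the determinant of
    [B *m gram (c p) *m B^T = 1%:M]. The vectors [y1] and [y2] steer the first axis of each block
    and are taken to be 0 when any frame will do. *)
Lemma chart_frame p y1 y2 (i1 i2 : 'I_n) : cdom c p ->
  i1 = 0%N :> nat -> i2 = k1 :> nat ->
  tvec c p y1 \in V1 p -> tvec c p y2 \in V2 p ->
  exists B : 'M[R]_n,
  [/\ B \in unitmx,
      \det B ^+ 2 * \det (gram (c p)) = 1,
      forall w, f (c p, w *m B) = model_norm w,
      y1 = Num.sqrt (a p (tvec c p y1) (tvec c p y1)) *: row i1 B
    & y2 = Num.sqrt (a p (tvec c p y2) (tvec c p y2)) *: row i2 B] /\
  (forall i : 'I_n, tvec c p (row i B) \in (if (i < k1)%N then V1 p else V2 p)) /\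
  (forall i j, a p (tvec c p (row i B)) (tvec c p (row j B)) = (i == j)%:R).
Proof.
move=> cp i1E i2E yV1 yV2; have [[d1 _] [d2 _]] := (sub1, sub2).
have [|||E [EV oE e1 e2]] := adapted_frame (ipa p) (i1 := i1) (i2 := i2) (V12 p)
  (orthV (p := p)) _ _ yV1 yV2 i1E; rewrite ?d1 ?d2//.
have Tu := tvec_mx_unit ac cp.
pose B := E *m invmx (tvec_mx c p).
have tB w : tvec c p (w *m B) = w *m E by rewrite tvecE mulmxA mulmxKV.
have rB i : tvec c p (row i B) = row i E by rewrite row_mul tvecE mulmxKV.
clearbody B.
have tinj y y' : tvec c p y = tvec c p y' -> y = y'.
  by move=> e; rewrite -(tvecK y ac cp) e tvecK.
have BAB : B *m gram (c p) *m B^T = 1%:M.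
  apply/matrixP => i j; rewrite [RHS]mxE -oE -!rB -(gramE _ _ cp).
  transitivity ((row i B *m gram (c p) *m B^T) 0 j).
    by rewrite -!row_mul [RHS]mxE.
  rewrite [LHS]mxE [RHS]mxE; apply: eq_bigr => l _; congr (_ * _).
  by rewrite !mxE.
have dB : \det B ^+ 2 * \det (gram (c p)) = 1.
  by have := congr1 (@determinant _ _) BAB; rewrite !det_mulmx det_tr det1 => <-; rewrite expr2 mulrAC.
have Bu : B \in unitmx.
  rewrite unitmxE unitfE; apply/eqP => B0; move: dB; rewrite B0 expr0n mul0r.
  by move/eqP; rewrite eq_sym oner_eq0.
exists B; split; [split => //|split] => [w|||i|i j].
- rewrite in_chartE// tB /model_norm.
  pose z1 := \sum_(i < n | (i < k1)%N) w 0 i *: row i E.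
  pose z2 := \sum_(i < n | ~~ (i < k1)%N) w 0 i *: row i E.
  have -> : w *m E = z1 + z2.
    by rewrite mulmx_sum_row (bigID (fun i : 'I_n => (i < k1)%N)).
  have zV1 : z1 \in V1 p.
    by apply: memv_suml => i ik; rewrite memvZ//; have := EV i; rewrite d1 ik.
  have zV2 : z2 \in V2 p.
    by apply: memv_suml => i ik; rewrite memvZ//; have := EV i; rewrite d1 (negPf ik).
  have sq (P : pred 'I_n) : a p (\sum_(i < n | P i) w 0 i *: row i E)
      (\sum_(i < n | P i) w 0 i *: row i E) = \sum_(i < n | P i) w 0 i ^+ 2.
    rewrite (ip_suml (ipa p)); apply: eq_bigr => i Pi.
    rewrite (ip_sumr (ipa p)) (bigD1 i)//= oE eqxx mulr1 big1 ?addr0// => j /andP[_ ji].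
    by rewrite oE eq_sym (negPf ji) mulr0.
  by rewrite FE// !sq.
- by apply: tinj; rewrite [RHS]tvecE -scalemxAl -tvecE rB; exact: e1.
- by apply: tinj; rewrite [RHS]tvecE -scalemxAl -tvecE rB; exact: e2.
- by rewrite rB -(d1 p); apply: EV.
- by rewrite !rB oE.
Qed.

Lemma gram_det_gt0 p : cdom c p -> 0 < \det (gram (c p)).
Proof.
move=> cp; have n0 := dim_ranks p.
have i1P : (0 < n)%N by rewrite -n0 addn_gt0 k1_gt0.
have i2P : (k1 < n)%N by rewrite -n0 -[X in (X < _)%N]addn0 ltn_add2l.
have [||B [[Bu dB _ _ _] _]] := @chart_frame p 0 0 (Ordinal i1P) (Ordinal i2P) cp erefl erefl.
- by rewrite tvecE mul0mx mem0v.
- by rewrite tvecE mul0mx mem0v.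
have B2 : 0 < \det B ^+ 2.
  by rewrite exprn_even_gt0//=; move: Bu; rewrite unitmxE unitfE.
by rewrite -(pmulr_rgt0 _ B2) dB.
Qed.

Definition chart_tangent : set ('rV[R]_n * 'rV[R]_n) :=
  [set z | cimg c z.1 /\ z.2 != 0].

Lemma open_chart_tangent : open chart_tangent.
Proof.
have -> : chart_tangent = fst @^-1` (cimg c) `&` snd @^-1` [set y | y != 0].
  by apply/seteqP; split.
apply: openI; apply: open_comp.
- by move=> z _; apply: cvg_fst.
- exact: cimg_open.
- by move=> z _; apply: cvg_snd.
- exact: open_nonzero.
Qed.

Lemma smooth_on_in_chart : smooth_on chart_tangent (f : _ -> R^o).
Proof. by case: finF => _ _ sf _; apply: sf. Qed.

Lemma smooth_on_slice p : cdom c p ->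
  smooth_on [set y : 'rV[R]_n | y != 0] (fun y => f (c p, y) ^+ 2 : R^o).
Proof.
move=> cp vs y y0.
pose u := foldr (fun v g => 'D_v g) (fun z => f z ^+ 2 : R^o)
                [seq ((0, v) : 'rV[R]_n * 'rV[R]_n) | v <- vs].
have -> : foldr (fun v g => 'D_v g) (fun y => f (c p, y) ^+ 2 : R^o) vs =
    u \o (fun w => (c p, w)).
  rewrite {}/u; elim: vs => [//|v vs /= ->].
  by apply/funext => w; rewrite /= derive_slice.
apply: differentiable_comp; first by apply: differentiable_pair.
apply: (smooth_on_sq open_chart_tangent smooth_on_in_chart).
by split=> //; exists p.
Qed.

Lemma in_chart_homog p (l : R) w : cdom c p -> 0 <= l ->
  f (c p, l *: w) = l * f (c p, w).
Proof.
move=> cp l0; rewrite !in_chartE// !tvecE -scalemxAl.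
by case: finF => _ _ _ /(_ p)[_ _ _ hom _]; apply: hom.
Qed.

(* The determinant of the fundamental tensor, normalized by the Gram
   determinant of [a], depends only on the ratio of the two components. *)
Lemma det_fundamental_star p0 p y1 y2 (i1 i2 : 'I_n) (B0 : 'M[R]_n) :
  cdom c p0 -> cdom c p -> i1 = 0%N :> nat -> i2 = k1 :> nat ->
  B0 \in unitmx -> \det B0 ^+ 2 * \det (gram (c p0)) = 1 ->
  (forall w, f (c p0, w *m B0) = model_norm w) ->
  tvec c p y1 \in V1 p -> tvec c p y2 \in V2 p -> y1 != 0 ->
  let r := Num.sqrt (a p (tvec c p y2) (tvec c p y2)) /
           Num.sqrt (a p (tvec c p y1) (tvec c p y1)) in
  \det (fundamental_tensor f (c p, y1 + y2)) * \det (gram (c p0)) =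
  \det (fundamental_tensor f (c p0, row i1 B0 + r *: row i2 B0)) * \det (gram (c p)).
Proof.
move=> cp0 cp i1E i2E B0u dB0 fB0 yV1 yV2 y10.
have [B [[Bu dB fB e1 e2] _]] := chart_frame cp i1E i2E yV1 yV2.
set al1 := Num.sqrt (a p (tvec c p y1) _); set al2 := Num.sqrt (a p (tvec c p y2) _).
rewrite -/al1 in e1; rewrite -/al2 in e2; move=> r.
have al0 : 0 < al1.
  rewrite sqrtr_gt0 lt_def (ip_eq0 (ipa p)) (ip_ge0 (ipa p)) andbT.
  by apply: contra y10 => /eqP T0; rewrite -(tvecK y1 ac cp) T0 /tvec_inv linear0.
(* [Phi] carries the frame at [p] to the one at [p0] and rescales the [V1] component to length 1.
   Hence [F] at [p] is [al1] times [F] at [p0] composed with [Phi]. *)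
pose Phi := al1^-1 *: (invmx B *m B0).
have Phiu : Phi \in unitmx.
  by rewrite unitmxZ ?unitmx_mul ?unitmx_inv ?Bu// unitfE invr_eq0 gt_eqF.
have yPhi : (y1 + y2) *m Phi = row i1 B0 + r *: row i2 B0.
  rewrite {1}e1 {1}e2 /Phi -scalemxAr mulmxA mulmxDl -!scalemxAl.
  rewrite -!row_mul mulmxV// mulmxDl -!scalemxAl !row1 -!rowE.
  by rewrite scalerDr !scalerA mulVf ?gt_eqF// scale1r mulrC.
(* The powers of [al1] cancel, reflecting that [g] is homogeneous of degree 0 in [y], and the frame
   determinants are traded for Gram determinants. *)
have key (G : 'M[R]_n) A A0 : \det B ^+ 2 * A = 1 -> \det B0 ^+ 2 * A0 = 1 ->
    \det (al1 ^+ 2 *: (Phi *m G *m Phi^T)) * A0 = \det G * A.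
  rewrite detZ !det_mulmx det_tr detZ det_mulmx det_inv.
  move: Bu B0u; rewrite !unitmxE !unitfE.
  move: (\det B) (\det B0) (\det G) => b b0 D bn b0n bA b0A.
  have -> : A = (b ^+ 2)^-1.
    by apply: (mulfI (expf_neq0 2 bn)); rewrite bA mulfV ?expf_neq0.
  have -> : A0 = (b0 ^+ 2)^-1.
    by apply: (mulfI (expf_neq0 2 b0n)); rewrite b0A mulfV ?expf_neq0.
  have an : al1 ^+ n != 0 by rewrite expf_neq0// gt_eqF.
  rewrite -exprM mulnC exprM exprVn; move: (al1 ^+ n) an => t tn.
  by field; rewrite tn bn b0n.
have f2 w : f (c p, w) ^+ 2 = al1 ^+ 2 * f (c p0, w *m Phi) ^+ 2.
  rewrite -exprMn /Phi -scalemxAr in_chart_homog ?invr_ge0 ?ltW//.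
  rewrite mulmxA fB0 mulrA mulfV ?gt_eqF// mul1r.
  by rewrite -{1}[w](mulmxKV Bu) fB.
have y0 : y1 + y2 != 0.
  apply: contra y10 => /eqP yy; rewrite -[y1](tvecK _ ac cp).
  suff -> : tvec c p y1 = 0 by rewrite /tvec_inv linear0.
  apply/eqP; rewrite -(ip_eq0 (ipa p)) -[X in a p _ X]opprK.
  have -> : - tvec c p y1 = tvec c p y2.
    by apply/eqP; rewrite eq_sym -addr_eq0 addrC !tvecE -mulmxDl yy mul0mx.
  by rewrite -[tvec c p y1]scale1r -scaleN1r (ipZ (ipa p)) orthV ?mulr0.
have -> : fundamental_tensor f (c p, y1 + y2) =
    al1 ^+ 2 *: (Phi *m fundamental_tensor f (c p0, row i1 B0 + r *: row i2 B0) *m Phi^T).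
  rewrite [LHS]fundamental_vhess fundamental_vhess -yPhi.
  rewrite -(vhess_mulmx _ (smooth_on_slice cp0) Phiu y0).
  exact: (congr1 (fun h => vhess h (y1 + y2)) (funext f2)).
exact: key dB dB0.
Qed.

Lemma row_mul_bound (w : 'rV[R]_n) (K : 'M[R]_n) (e : R) :
  (forall i, `|w 0 i| <= e) ->
  forall j, `|(w *m K) 0 j| <= e * \sum_i \sum_j `|K i j|.
Proof.
move=> we j; rewrite mxE (le_trans (ler_norm_sum _ _ _))// mulr_sumr.
apply: ler_sum => i _; rewrite normrM ler_pM//.
by rewrite (bigD1 j)//= lerDl sumr_ge0.
Qed.

Lemma row_norm_le (w : 'rV[R]_n) (e : R) : 0 <= e ->
  (`|w| <= e) <-> (forall i, `|w 0 i| <= e).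
Proof.
move=> e0; rewrite [`|w|]mx_normrE; split=> [we i|we].
  by apply: le_trans we; apply: (le_bigmax _ (fun ij => `|w ij.1 ij.2|) (0, i)).
by apply: bigmax_le => // -[i j] _; rewrite (ord1 i).
Qed.

Lemma minkowski_coercive (N : 'rV[R]_n -> R) : (0 < n)%N -> minkowski_norm N ->
  exists2 m, 0 < m & forall v, m * `|v| <= N v.
Proof.
move=> n0 [cN [N0 Npos] _ hom _].
pose S := [set v : 'rV[R]_n | `|v| = 1].
have cS : compact S.
  apply: bounded_closed_compact.
    by exists 1; split=> // x x1 v /= ->; apply: ltW.
  have -> : S = (fun v : 'rV[R]_n => `|v|) @^-1` [set r : R | r = 1] by [].
  apply: closed_comp; last exact: closed_eq.
  by move=> v _; apply: norm_continuous.
have unit0 v : v != 0 -> S (`|v|^-1 *: v).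
  move=> v0; rewrite /S /= normrZ normfV normr_id mulVf// normr_eq0//.
have S0 : S !=set0.
  exists (`|const_mx 1 : 'rV[R]_n|^-1 *: const_mx 1); apply: unit0.
  apply/eqP => /rowP /(_ (Ordinal n0)); rewrite !mxE => /eqP.
  by rewrite oner_eq0.
have [v0 v0S minv] := EVT_min_rV S0 cS (continuous_subspaceT cN).
exists (N v0).
  apply: Npos; apply/eqP => v00; move: v0S; rewrite inE /S /= v00 normr0 => /eqP.
  by rewrite eq_sym oner_eq0.
move=> v; have [->|vn0] := eqVneq v 0; first by rewrite normr0 mulr0 N0.
have vpos : 0 < `|v| by rewrite normr_gt0.
have := minv (`|v|^-1 *: v); rewrite inE => /(_ (unit0 _ vn0)).
by rewrite hom ?invr_ge0// ler_pdivlMl// mulrC.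
Qed.

Lemma minkowski_small (N : 'rV[R]_n -> R) : minkowski_norm N ->
  exists2 d, 0 < d & forall v, `|v| < d -> N v < 1.
Proof.
move=> [cN [N0 _] _ hom _].
have N00 : N 0 = 0 by have := hom 0 0 (lexx _); rewrite scale0r mul0r.
have /cvgrPdist_lt /(_ 1 ltr01) /nbhs_ballP[d /= d0 dP] := cN 0.
exists d => // v vd; have := dP v; rewrite -ball_normE /= sub0r normrN => /(_ vd).
by rewrite N00 sub0r normrN ger0_norm.
Qed.

(** The model ball is a linear image of the unit ball of [F p], which is bounded by compactness of
    the unit sphere and contains a neighbourhood of 0 by continuity. *)
Lemma model_ball_volume p : cdom c p ->
  0 < fine (volume [set w | model_norm w < 1]) /\
  volume [set w | model_norm w < 1] = (fine (volume [set w | model_norm w < 1]))%:E.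
Proof.
move=> cp; have kn := dim_ranks p.
have n0 : (0 < n)%N by rewrite -kn addn_gt0 k1_gt0.
have i2P : (k1 < n)%N by rewrite -kn -[X in (X < _)%N]addn0 ltn_add2l.
have [||B [[Bu dB fB _ _] _]] := @chart_frame p 0 0 (Ordinal n0) (Ordinal i2P) cp erefl erefl.
- by rewrite tvecE mul0mx mem0v.
- by rewrite tvecE mul0mx mem0v.
have mF : minkowski_norm (F p) by case: finF.
pose K := B *m tvec_mx c p.
have Ku : K \in unitmx by rewrite unitmx_mul Bu tvec_mx_unit.
have mE w : model_norm w = F p (w *m K) by rewrite -fB in_chartE// tvecE mulmxA.
have [m m0 mP] := minkowski_coercive n0 mF.
have [d d0 dP] := minkowski_small mF.
pose s (K : 'M[R]_n) := \sum_i \sum_j `|K i j|.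
have s0 K' : 0 <= s K' by apply: sumr_ge0 => i _; apply: sumr_ge0.
apply: (@volume_fin_pos _ _ n0 _ (d / 2 / (s K + 1)) (m^-1 * s (invmx K) + 1)).
- by rewrite !divr_gt0// ltr_wpDl.
- by rewrite ltr_wpDl// mulr_ge0// invr_ge0 ltW.
- move=> w wi /=; rewrite mE; apply: dP; apply: (@le_lt_trans _ _ (d / 2)); last by lra.
  apply/row_norm_le; first by rewrite divr_ge0// ltW.
  move=> j; apply: le_trans (row_mul_bound (e := d / 2 / (s K + 1)) _ _ _) _.
    by move=> i; have /andP[h1 h2] := wi i; rewrite ger0_norm.
  rewrite -/(s K) mulrAC ler_pdivrMr ?ltr_wpDl//.
  by rewrite ler_wpM2l ?lerDl// divr_ge0// ltW.
- move=> w /=; rewrite mE => wF i.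
  have wK : `|w *m K| <= m^-1.
    by rewrite -[m^-1]mul1r ler_pdivlMr// mulrC (le_trans (mP _))// ltW.
  rewrite -[w](mulmxK Ku).
  apply: le_trans (row_mul_bound (e := m^-1) _ _ _) _; last by rewrite lerDl.
  by apply/row_norm_le => //; rewrite invr_ge0 ltW.
Qed.

(** The constant quotient of the Busemann-Hausdorff density by the Riemannian density of alpha. *)
Definition model_density : R :=
  fine (volume [set y : 'rV[R]_n | \sum_(i < n) y 0 i ^+ 2 < 1]) /
  fine (volume [set w | model_norm w < 1]).

Lemma model_density_gt0 p : cdom c p -> 0 < model_density.
Proof.
move=> cp; have kn := dim_ranks p.
have n0 : (0 < n)%N by rewrite -kn addn_gt0 k1_gt0.
have [v0 _] := model_ball_volume cp.
apply: divr_gt0 v0.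
have [] // := @volume_fin_pos _ _ n0 [set y : 'rV[R]_n | \sum_(i < n) y 0 i ^+ 2 < 1]
  (n.+1%:R^-1) 1.
- move=> y yi /=; apply: (@le_lt_trans _ _ (\sum_(i < n) n.+1%:R^-1)).
    apply: ler_sum => i _; have /andP[h1 h2] := yi i.
    rewrite expr2 (le_trans _ h2)// ler_piMr// (le_trans h2)//.
    by rewrite invf_le1// ler1n.
  rewrite sumr_const card_ord -[ltLHS]mulr_natl.
  by rewrite ltr_pdivrMr// mul1r ltr_nat.
- move=> y /= y1 i; rewrite -(@expr_le1 _ 2)// -normrX ger0_norm ?sqr_ge0//.
  apply/ltW/(le_lt_trans _ y1).
  by rewrite (bigD1 i)//= lerDl sumr_ge0// => j _; rewrite sqr_ge0.
Qed.

Lemma sigma_BH_gram p : cdom c p ->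
  sigma_BH f (c p) = model_density * Num.sqrt (\det (gram (c p))).
Proof.
move=> cp; have kn := dim_ranks p.
have n0 : (0 < n)%N by rewrite -kn addn_gt0 k1_gt0.
have i2P : (k1 < n)%N by rewrite -kn -[X in (X < _)%N]addn0 ltn_add2l.
have [||B [[Bu dB fB _ _] _]] := @chart_frame p 0 0 (Ordinal n0) (Ordinal i2P) cp erefl erefl.
- by rewrite tvecE mul0mx mem0v.
- by rewrite tvecE mul0mx mem0v.
have [v0 vE] := model_ball_volume cp.
have -> : sigma_BH f (c p) =
    fine (volume [set y : 'rV[R]_n | \sum_(i < n) y 0 i ^+ 2 < 1]) /
    (`|\det B| * fine (volume [set w | model_norm w < 1])).
  rewrite /sigma_BH; congr (_ / _).
  have -> : [set y | f (c p, y) < 1] = (fun w => w *m B) @` [set w | model_norm w < 1].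
    apply/seteqP; split => [y /= fy|_ [w /= wN <-]]; last by rewrite fB.
    by exists (y *m invmx B); rewrite /= -?fB mulmxKV.
  by rewrite volume_linear// vE.
have -> : Num.sqrt (\det (gram (c p))) = `|\det B|^-1.
  have bn : \det B != 0 by move: Bu; rewrite unitmxE unitfE.
  have -> : \det (gram (c p)) = (\det B ^+ 2)^-1.
    by apply: (mulfI (expf_neq0 2 bn)); rewrite dB mulfV ?expf_neq0.
  by rewrite -exprVn sqrtr_sqr normfV.
by rewrite invfM /model_density -mulrA [_^-1 * _^-1]mulrC.
Qed.

Let oC : open (cimg c) := @cimg_open _ _ _ c.

Lemma smooth_on_gram i j : smooth_on (cimg c) (fun x => gram x i j : R^o).
Proof.
have [_ /(_ c ac i j) sg] := riema.
by apply: eq_smooth_on oC _ sg => x _; rewrite mxE.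
Qed.

Lemma smooth_on_det_gram : smooth_on (cimg c) (fun x => \det (gram x) : R^o).
Proof. exact: smooth_on_det oC smooth_on_gram. Qed.

Local Notation det_gram := (fun x => \det (gram x) : R^o).

Lemma derive_ln_sigma p v : cdom c p ->
  'D_v (fun x => ln (sigma_BH f x) : R^o) (c p) =
  2^-1 * 'D_v det_gram (c p) / \det (gram (c p)).
Proof.
move=> cp; have C0 := model_density_gt0 cp.
have D0 := gram_det_gt0 cp.
have e1 : 'D_v (fun x => ln (sigma_BH f x) : R^o) (c p) =
    'D_v (fun x => ln model_density + 2^-1 * ln (\det (gram x)) : R^o) (c p).
  apply: near_eq_derive; have := near_chart_dom cp; apply: filterS => _ [q -> cq].
  have Dq := gram_det_gt0 cq.
  rewrite (sigma_BH_gram cq) lnM ?posrE ?sqrtr_gt0//.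
  by rewrite (ln_sqrtr Dq).
have cimgp : cimg c (c p) by exists p.
have dD : differentiable det_gram (c p).
  exact: smooth_on_differentiable smooth_on_det_gram cimgp.
have dDl : is_derive (0 : R) 1 (fun t : R => \det (gram (c p + t *: v)) : R^o) ('D_v det_gram (c p)).
  have := @is_derive_line _ _ _ det_gram (c p) v 0.
  by rewrite scale0r addr0; apply.
have D0' : 0 < \det (gram (c p + 0 *: v)) by rewrite scale0r addr0.
have H := is_derive1_comp (is_derive1_ln D0') dDl.
have H2 : is_derive (0 : R) 1
    (fun t : R => ln model_density + 2^-1 * ln (\det (gram (c p + t *: v))) : R^o)
    (2^-1 * 'D_v det_gram (c p) / \det (gram (c p))).
  have H3 := is_deriveD (is_derive_cst (ln model_density : R^o) (0 : R) 1) (is_deriveZ (2^-1) H).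
  apply: is_derive_eq H3 _.
  by rewrite add0r scale0r addr0 /GRing.scale /= mulrA mulrAC.
have E := (derive_line
  (fun x => ln model_density + 2^-1 * ln (\det (gram x)) : R^o) (c p) v 0).2.
rewrite scale0r addr0 in E; rewrite e1 -E.
exact: (@derive_val _ _ _ _ _ _ _ H2).
Qed.

(** The subtracted term is linear in [y], so parity and affinity on vertical lines pass between
    [spray_div] and the S-curvature. *)
Lemma S_curvature_gram p y : cdom c p ->
  S_curvature f (c p, y) =
  spray_div f (c p, y) - 2^-1 * 'D_y det_gram (c p) / \det (gram (c p)).
Proof.
move=> cp; rewrite /S_curvature /spray_div; apply: congr2; first by [].
have cimgp : cimg c (c p) by exists p.
rewrite (derive_row _ (smooth_on_differentiable smooth_on_det_gram cimgp)).
apply: (congr1 (fun t => - t)); rewrite mulr_sumr mulr_suml.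
apply: eq_bigr => i _; rewrite (derive_ln_sigma _ cp) /=.
have alg (u t g : R) : u * (2^-1 * t / g) = 2^-1 * (u * t) / g by ring.
exact: alg.
Qed.

Lemma fundamental_unit z : chart_tangent z -> fundamental_tensor f z \in unitmx.
Proof.
case: z => x y [[p cp /= <-] /= y0].
have mF : minkowski_norm (F p) by case: finF.
have [_ _ sF _ _] := mF.
have sF2 : smooth_on [set y : 'rV[R]_n | y != 0] (fun w => F p w ^+ 2 : R^o).
  exact: (smooth_onM open_nonzero sF sF).
have Ju := tvec_mx_unit ac cp.
have -> : fundamental_tensor f (c p, y) =
    1 *: (tvec_mx c p *m vhess (fun w => F p w ^+ 2) (y *m tvec_mx c p) *m (tvec_mx c p)^T).
  rewrite [LHS]fundamental_vhess -(vhess_mulmx _ sF2 Ju y0).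
  apply: (congr1 (fun h => vhess h y)); apply/funext => w.
  by rewrite in_chartE// tvecE mul1r.
rewrite scale1r !unitmx_mul unitmx_tr Ju andbT /=.
apply: minkowski_vhess_unit => //.
by apply: contra y0 => /eqP e; rewrite -[y](mulmxK Ju) e mul0mx.
Qed.

(** Meant for [s = |t|]: coordinates of size O(t) against bounded coefficients give the squared
    length O(t^2). *)
Lemma quadratic_form_bound (w : 'rV[R]_n) (G : 'M[R]_n) (b : 'I_n -> R)
    (A : 'M[R]_n) (s : R) : 0 <= s ->
  (forall i, `|w 0 i| <= b i * s) -> (forall i j, `|G i j| <= A i j) ->
  (w *m G *m w^T) 0 0 <= (\sum_j \sum_i b i * A i j * b j) * s ^+ 2.
Proof.
move=> s0 wb GA; rewrite mxE mulr_suml; apply: ler_sum => j _.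
rewrite [w^T j 0]mxE [X in X * _]mxE !mulr_suml; apply: ler_sum => i _.
apply: le_trans (ler_norm _) _; rewrite !normrM.
have -> : b i * A i j * b j * s ^+ 2 = (b i * s) * A i j * (b j * s) by ring.
by rewrite !ler_pM// ?mulr_ge0.
Qed.

Lemma derivable_quadratic_form (w : R -> 'rV[R]_n) (G : R -> 'M[R]_n) :
  (forall i, derivable (fun t => w t 0 i : R^o) 0 1) ->
  (forall i j, derivable (fun t => G t i j : R^o) 0 1) ->
  derivable (fun t => (w t *m G t *m (w t)^T) 0 0 : R^o) 0 1.
Proof.
move=> dw dG.
have H : is_derive (0 : R) 1
    (fun t => \sum_j (\sum_i w t 0 i * G t i j) * w t 0 j : R^o)
    (\sum_j ((\sum_i w 0 0 i * G 0 i j) * 'D_1 (fun t => w t 0 j : R^o) 0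
       + w 0 0 j * (\sum_i (w 0 0 i * 'D_1 (fun t => G t i j : R^o) 0
                       + G 0 i j * 'D_1 (fun t => w t 0 i : R^o) 0)))).
  apply: is_derive_bigsum => j _; apply: is_derive_mul; last exact: derivableP.
  apply: is_derive_bigsum => i _; apply: is_derive_mul; exact: derivableP.
have -> : (fun t => (w t *m G t *m (w t)^T) 0 0 : R^o) =
    (fun t => \sum_j (\sum_i w t 0 i * G t i j) * w t 0 j : R^o).
  apply/funext => t; rewrite mxE; apply: eq_bigr => j _.
  by rewrite [_^T j 0]mxE [X in X * _]mxE.
by case: H.
Qed.

Lemma alpha_pythagoras q u w : u \in V1 q -> w \in V2 q ->
  a q (u + w) (u + w) = a q u u + a q w w.
Proof.
move=> uV wV; have uw := orthV uV wV.
have Dr x : a q x (u + w) = a q x u + a q x w.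
  by rewrite !(ipC (ipa q) x) (ipD (ipa q)).
by rewrite (ipD (ipa q)) !Dr (ipC (ipa q) w u) uw addr0 add0r.
Qed.

(* Along the spray line through a vector of [V1] the ratio of the two components
   is O(t), by comparison with a section of [V1]. *)
Lemma ratio_near (p : M) (y eta : 'rV[R]_n) : cdom c p -> y != 0 ->
  tvec c p y \in V1 p ->
  exists2 C : R, 0 < C & \forall t \near (0 : R),
    exists q y1 y2, [/\ c p + t *: y = c q, cdom c q, y + t *: eta = y1 + y2 &
      [/\ tvec c q y1 \in V1 q, tvec c q y2 \in V2 q, y1 != 0 &
       Num.sqrt (a q (tvec c q y2) (tvec c q y2)) /
       Num.sqrt (a q (tvec c q y1) (tvec c q y1)) <= C * `|t|]].
Proof.
move=> cp y0 yV1.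
have [v [dv vp vV]] := subbundle_section sub1 ac cp yV1.
have cimgp : cimg c (c p) by exists p.
have lineD (u : 'rV[R]_n -> R^o) x w : differentiable u x ->
    derivable (fun t : R => u (x + t *: w) : R^o) 0 1.
  move=> du; have := @is_derive_line _ _ _ u x w 0.
  by rewrite scale0r addr0 => /(_ du)[].
have nearx (P : set 'rV[R]_n) : (\forall x \near c p, P x) ->
    \forall t \near (0 : R), P (c p + t *: y).
  move=> nP.
  have did : differentiable (@id 'rV[R]_n) (c p + (0 : R) *: y) by [].
  have [/derivable1_diffP/differentiable_continuous cl _] := is_derive_line did.
  have := cl P; rewrite /= scale0r addr0 => clP.
  exact: clP nP.
pose x t := c p + t *: y; pose z t := y + t *: eta; pose d t := z t - v (x t).
have dG i j : derivable (fun t => gram (x t) i j : R^o) 0 1.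
  exact: (lineD (fun x => gram x i j : R^o) _ y
    (smooth_on_differentiable (smooth_on_gram i j) cimgp)).
have dz i : derivable (fun t => z t 0 i : R^o) 0 1.
  exact: (lineD (fun w => w 0 i : R^o) _ _ (differentiable_coord _ _ _)).
have dd i : derivable (fun t => d t 0 i : R^o) 0 1.
  have -> : (fun t => d t 0 i : R^o) =
      (fun t => z t 0 i : R^o) - (fun t => v (x t) 0 i : R^o).
    by apply/funext => t; rewrite /d mxE [X in _ + X]mxE.
  apply: derivableB; first exact: dz.
  exact: (lineD (fun x => v x 0 i : R^o) _ y (dv i)).
have x0E : x 0 = c p by rewrite /x scale0r addr0.
have d0 i : d 0 0 i = 0.
  by rewrite /d /z /x !scale0r !addr0 vp subrr mxE.
(* Squared alpha lengths: [E] of the deviation [d] of the spray line from the section [v] of [V1],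
   which vanishes at 0, and [Q] of the vector itself. *)
pose E t := (d t *m gram (x t) *m (d t)^T) 0 0.
pose Q t := (z t *m gram (x t) *m (z t)^T) 0 0.
have dE : derivable (E : R -> R^o) 0 1 by exact: (derivable_quadratic_form dd dG).
have dQ : derivable (Q : R -> R^o) 0 1 by exact: (derivable_quadratic_form dz dG).
have E0 : E 0 = 0.
  rewrite /E (_ : d 0 = 0) ?mul0mx ?mxE//.
  by apply/rowP => i; rewrite d0 mxE.
have Q0 : 0 < Q 0.
  have [_ _ pos] := ipa p.
  rewrite /Q /z /x !scale0r !addr0 gramE//; apply: pos.
  apply: contra y0 => /eqP T0; rewrite -(tvecK y ac cp) T0.
  by rewrite /tvec_inv linear0.
(* With both errors below a quarter of [Q 0], the [V1] part of the squared length stays above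
   [3/4 - 1/4 = 1/2] of it. *)
have Q4 : 0 < Q 0 / 4 by rewrite divr_gt0.
pose b i := `|'D_1 (fun t => d t 0 i : R^o) 0| + 1.
pose A : 'M[R]_n := \matrix_(i, j) (`|gram (c p) i j| + 1).
pose K := \sum_j \sum_i b i * A i j * b j.
have K0 : 0 <= K.
  apply: sumr_ge0 => j _; apply: sumr_ge0 => i _.
  by rewrite !mulr_ge0 ?mxE ?addr_ge0.
(* The squared numerator is at most [K * t ^ 2] and the squared denominator at least [Q 0 / 2]; the
   1 keeps the constant positive. *)
exists (Num.sqrt ((K + 1) / (Q 0 / 2))).
  by rewrite sqrtr_gt0 divr_gt0 ?ltr_wpDl// divr_gt0.
have n1 := nearx _ (near_chart_dom cp).
have n2 := nearx _ vV.
have n3 : \forall t \near (0 : R), forall i, `|d t 0 i| <= b i * `|t|.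
  apply: (@filter_forall _ _ (fun i (t : R) => `|d t 0 i| <= b i * `|t|) _
    (nbhs_filter (0 : R))) => i.
  exact: derive_near_lipschitz (derivableP (dd i)) (d0 i).
have n4 : \forall t \near (0 : R), forall i j, `|gram (x t) i j| <= A i j.
  apply: (@filter_forall _ _ (fun i (t : R) => forall j, `|gram (x t) i j| <= A i j) _
    (nbhs_filter (0 : R))) => i.
  apply: (@filter_forall _ _ (fun j (t : R) => `|gram (x t) i j| <= A i j) _
    (nbhs_filter (0 : R))) => j.
  have AE : A i j = `|gram (c p) i j| + 1 by rewrite mxE.
  have add1 (u w : R) : `|u - w| < 1 -> `|u| <= `|w| + 1.
    by move=> uw; rewrite -[u](subrK w) (le_trans (ler_normD _ _))// addrC lerD2l ltW.
  have := derive_near_cont (derivableP (dG i j)) ltr01; apply: filterS => t.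
  by rewrite x0E AE; apply: add1.
have n5 := derive_near_cont (derivableP dE) Q4.
have n6 := derive_near_cont (derivableP dQ) Q4.
near=> t.
have [q xq cq] : exists2 q, x t = c q & cdom c q by near: t.
have vVq : tvec c q (v (x t)) \in V1 q.
  have : tvec c (cinv c (x t)) (v (x t)) \in V1 (cinv c (x t)) by near: t.
  by rewrite xq cmapK.
have dt : forall i, `|d t 0 i| <= b i * `|t| by near: t.
have Gt : forall i j, `|gram (x t) i j| <= A i j by near: t.
have Et : `|E t - E 0| < Q 0 / 4 by near: t.
have Qt : `|Q t - Q 0| < Q 0 / 4 by near: t.
have /memv_addP[u1 u1V [u2 u2V zE]] : tvec c q (z t) \in (V1 q + V2 q)%VS.
  by rewrite V12 memvf.
exists q, (tvec_inv c q u1), (tvec_inv c q u2).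
have zsum : z t = tvec_inv c q u1 + tvec_inv c q u2.
  by rewrite /tvec_inv -linearD -zE; symmetry; apply: tvecK.
rewrite !tvec_invK//; split=> //.
(* Subtracting a vector of [V1] does not change the [V2] component, whose length is at most that of
   [d t] by Pythagoras. *)
have a2E : a q u2 u2 <= E t.
  rewrite /E xq (gramE _ _ cq).
  have -> : tvec c q (d t) = (u1 - tvec c q (v (x t))) + u2.
    by rewrite /d tvecE mulmxBl -!tvecE zE addrAC.
  set u1' := u1 - _; have u1'V : u1' \in V1 q by rewrite memvB.
  by rewrite (alpha_pythagoras u1'V u2V) lerDr (ip_ge0 (ipa q)).
have aQ : Q t = a q u1 u1 + a q u2 u2.
  by rewrite /Q xq (gramE _ _ cq) zE (alpha_pythagoras u1V u2V).
have EK : E t <= K * `|t| ^+ 2 by apply: quadratic_form_bound.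
have a1 : Q 0 / 2 <= a q u1 u1.
  move: Et Qt a2E; rewrite E0 subr0 ltr_norml ltr_norml.
  move=> /andP[_ h1] /andP[h2 _] h3; move: aQ; lra.
have Q2 : 0 < Q 0 / 2 by rewrite divr_gt0.
have a10 : 0 < a q u1 u1 by apply: lt_le_trans a1.
split=> //.
  apply/eqP => u10; have := tvec_invK u1 ac cq; rewrite u10 tvecE mul0mx => u1z.
  by move: a10; rewrite -u1z (ip0 (ipa q)) ltxx.
rewrite -sqrtr_sqr -sqrtrV ?ip_ge0// -!sqrtrM ?ip_ge0//; last first.
  by rewrite divr_ge0 ?addr_ge0// ltW.
apply: ler_wsqrtr; rewrite ler_pdivrMr// (le_trans a2E)// (le_trans EK)//.
rewrite -normrX ger0_norm ?sqr_ge0// mulrAC.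
apply: (@le_trans _ _ ((K + 1) * t ^+ 2)).
  by rewrite ler_wpM2r ?sqr_ge0// lerDl.
rewrite ler_wpM2r ?sqr_ge0// mulrAC ler_pdivlMr// ler_wpM2l//.
by rewrite addr_ge0.
Unshelve. all: by end_near. Qed.

(** Twice the divergence is the logarithmic derivative of [\det g] along the spray. It agrees with
    that of the Gram determinant because the quotient of the two determinants is stationary at a
    vector of [V1]. *)
Lemma spray_div_V1 p y : cdom c p -> y != 0 -> tvec c p y \in V1 p ->
  spray_div f (c p, y) = 2^-1 * 'D_y det_gram (c p) / \det (gram (c p)).
Proof.
move=> cp y0 yV1; have kn := dim_ranks p.
have n0 : (0 < n)%N by rewrite -kn addn_gt0 k1_gt0.
have i2P : (k1 < n)%N by rewrite -kn -[X in (X < _)%N]addn0 ltn_add2l.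
pose i1 := Ordinal n0; pose i2 := Ordinal i2P.
have zV2 : tvec c p 0 \in V2 p by rewrite tvecE mul0mx mem0v.
have [B [[Bu dB fB _ _] [BV Bo]]] :=
  @chart_frame p y 0 i1 i2 cp erefl erefl yV1 zV2.
have cimgp : cimg c (c p) by exists p.
pose q (r : R) : R := \det (fundamental_tensor f (c p, row i1 B + r *: row i2 B)).
pose A0 := \det (gram (c p)).
have A00 : 0 < A0 by exact: gram_det_gt0.
have star p' y1 y2 (cp' : cdom c p') (yV : tvec c p' y1 \in V1 p')
    (yV' : tvec c p' y2 \in V2 p') (y10 : y1 != 0) :=
  det_fundamental_star (i1 := i1) (i2 := i2) cp cp' erefl erefl Bu dB fB yV yV' y10.
have tvec0 : tvec c p 0 = 0 by rewrite tvecE mul0mx.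
have rV1 : tvec c p (row i1 B) \in V1 p by have := BV i1; rewrite /= k1_gt0.
have rV2 : tvec c p (row i2 B) \in V2 p by have := BV i2; rewrite /= ltnn.
have r10 : row i1 B != 0.
  apply/eqP => r0; have := Bo i1 i1; rewrite r0 tvec0 (ip0 (ipa p)) eqxx => /eqP.
  by rewrite eq_sym oner_eq0.
(* The comparison is applied at [p] to its own frame: the vector with components 1 and [s] has ratio
   [|s|]. *)
have qabs s : q s = q `|s|.
  have sV2 : tvec c p (s *: row i2 B) \in V2 p.
    by rewrite tvecE -scalemxAl -tvecE memvZ.
  have := star p _ _ cp rV1 sV2 r10.
  rewrite !Bo eqxx sqrtr1 divr1 (tvecE c p (s *: _)) -scalemxAl -tvecE.
  rewrite (ipZ (ipa p)) Bo eqxx mulr1 -expr2 sqrtr_sqr.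
  exact: (mulIf (lt0r_neq0 A00)).
have even_of_abs (g : R -> R) : (forall s, g s = g `|s|) -> forall r, g (- r) = g r.
  by move=> gabs r; rewrite gabs normrN -gabs.
have q_even := even_of_abs q qabs.
pose dg (z : 'rV[R]_n * 'rV[R]_n) : R^o := \det (fundamental_tensor f z).
have sdg : smooth_on chart_tangent dg.
  exact: (@smooth_on_det _ _ _ _ (fundamental_tensor f) open_chart_tangent
    (smooth_on_fundamental open_chart_tangent smooth_on_in_chart)).
have dq : is_derive (0 : R) 1 q ('D_(0, row i2 B) dg (c p, row i1 B)).
  have qE : q = fun t : R => dg ((c p, row i1 B) + t *: ((0, row i2 B) : 'rV[R]_n * 'rV[R]_n)).
    apply/funext => t; rewrite /q /dg; congr (\det (fundamental_tensor f _)).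
    by apply/pair_eqP/andP; split; apply/eqP; rewrite /= ?scaler0 ?addr0.
  rewrite qE; apply: is_derive_line0.
  by apply: (smooth_on_differentiable sdg); split.
pose z0 : 'rV[R]_n * 'rV[R]_n := (c p, y).
have z0t : chart_tangent z0 by [].
pose X := spray_vector f z0.
pose h (t : R) : R := dg (z0 + t *: X).
pose D (t : R) : R := \det (gram (c p + t *: y)).
have dh : is_derive (0 : R) 1 h (2 * dg z0 * spray_div f z0).
  have := is_derive_line0 X (smooth_on_differentiable sdg z0t).
  have H := is_derive_det_fundamental open_chart_tangent smooth_on_in_chart
              fundamental_unit z0t.
  by rewrite (@derive_val _ _ _ _ _ _ _ H).
have dD : is_derive (0 : R) 1 D ('D_y det_gram (c p)).
  exact: is_derive_line0 y (smooth_on_differentiable smooth_on_det_gram cimgp).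
have h0 : h 0 = dg z0 by rewrite /h scale0r addr0.
have D0 : D 0 = A0 by rewrite /D scale0r addr0.
have q0 : q 0 = h 0.
  have := star p y 0 cp yV1 zV2 y0; rewrite tvec0 (ip0 (ipa p)) sqrtr0 mul0r addr0.
  by move=> e; rewrite h0; apply: esym; exact: (mulIf (lt0r_neq0 A00) e).
(* The defect, with denominators cleared, of the quotient [h / D] from its value at 0. It equals
   [(q r - q 0) * D t], hence is o(t), and its derivative at 0 is the identity sought. *)
pose phi (t : R) : R := h t * A0 - D t * h 0.
have dphi : is_derive (0 : R) 1 phi
    (2 * dg z0 * spray_div f z0 * A0 - 'D_y det_gram (c p) * h 0).
  apply: is_deriveB.
    apply: (is_derive_eq (is_derive_mul dh (is_derive_cst (A0 : R^o) _ _))).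
    by rewrite mulr0 add0r mulrC.
  apply: (is_derive_eq (is_derive_mul dD (is_derive_cst (h 0 : R^o) _ _))).
  by rewrite mulr0 add0r mulrC.
have phi0 : phi 0 = 0 by rewrite /phi D0 mulrC subrr.
have [C C0 nC] := @ratio_near p y X.2 cp y0 yV1.
have small e : 0 < e -> \forall t \near (0 : R), `|phi t| <= e * `|t|.
  move=> e0; have AC : 0 < (A0 + 1) * C by rewrite mulr_gt0 ?addr_gt0.
  have [d d0 dP] := even_near_bound dq (divr_gt0 e0 AC) q_even.
  have nD := derive_near_cont dD ltr01.
  have nd := near0_scale_lt C0 d0.
  near=> t.
  have [p' [y1 [y2 [xE cp' yE [yV yV' y10 rt]]]]] : exists p' y1 y2,
    [/\ c p + t *: y = c p', cdom c p', y + t *: X.2 = y1 + y2 &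
      [/\ tvec c p' y1 \in V1 p', tvec c p' y2 \in V2 p', y1 != 0 &
       Num.sqrt (a p' (tvec c p' y2) (tvec c p' y2)) /
       Num.sqrt (a p' (tvec c p' y1) (tvec c p' y1)) <= C * `|t|]] by near: t.
  have Dt : `|D t - D 0| < 1 by near: t.
  have td : C * `|t| < d by near: t.
  set r := (Num.sqrt _ / Num.sqrt _ : R) in rt.
  have r0 : 0 <= r by exact: divr_ge0 (sqrtr_ge0 _) (sqrtr_ge0 _).
  have zE : z0 + t *: X = (c p', y1 + y2) by exact: (f_equal2 pair xE yE).
  have hs : dg (c p', y1 + y2) * A0 = q r * det_gram (c p').
    exact (star p' y1 y2 cp' yV yV' y10).
  have hE : h t = dg (c p', y1 + y2) by exact: (congr1 dg zE).
  have DE : D t = det_gram (c p') by exact: (congr1 det_gram xE).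
  have hq : h t * A0 = q r * D t.
    by rewrite hE DE; exact hs.
  have rd : `|r| < d by rewrite (ger0_norm r0); exact (le_lt_trans rt td).
  exact: (ratio_defect_bound hq q0 D0 Dt A00 C0 e0 r0 rt (dP _ rd)).
have phi'0 := derive_eq0 dphi phi0 small.
rewrite h0 in phi'0.
have dg0 : dg z0 != 0 by have := fundamental_unit z0t; rewrite unitmxE unitfE.
exact (solve_linear dg0 (lt0r_neq0 A00) phi'0).
Unshelve. all: by end_near. Qed.

Lemma chart_tangent_chart p y : cdom c p -> y != 0 -> chart_tangent (c p, y).
Proof. by move=> cp y0; split=> //; exists p. Qed.

Lemma flip_chart_tangent z : chart_tangent z -> chart_tangent (flip z).
Proof. by move=> [h1 h2]; split=> //; rewrite /= oppr_eq0. Qed.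

Lemma in_chart_flip z : f (flip z) = f z.
Proof. by rewrite /in_chart /= !tvecE mulNmx alpha_metric_even. Qed.

Lemma spray_div_opp p y : cdom c p -> y != 0 ->
  spray_div f (c p, - y) = - spray_div f (c p, y).
Proof.
move=> cp y0.
have := parity_spray_div open_chart_tangent flip_chart_tangent
  smooth_on_in_chart fundamental_unit in_chart_flip (chart_tangent_chart cp y0).
by rewrite mulN1r.
Qed.

Lemma derive_det_gramD p u v : cdom c p ->
  'D_(u + v) det_gram (c p) = 'D_u det_gram (c p) + 'D_v det_gram (c p).
Proof.
move=> cp; have cimgp : cimg c (c p) by exists p.
have dD := smooth_on_differentiable smooth_on_det_gram cimgp.
by rewrite !deriveE// linearD.
Qed.

Lemma derive_det_gramZ p (r : R) v : cdom c p ->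
  'D_(r *: v) det_gram (c p) = r * 'D_v det_gram (c p).
Proof.
move=> cp; have cimgp : cimg c (c p) by exists p.
have dD := smooth_on_differentiable smooth_on_det_gram cimgp.
by rewrite !deriveE// linearZ.
Qed.

Lemma S_curvature_opp p y : cdom c p -> y != 0 ->
  S_curvature f (c p, - y) = - S_curvature f (c p, y).
Proof.
move=> cp y0; rewrite !S_curvature_gram// spray_div_opp//.
have -> : 'D_(- y) det_gram (c p) = - 'D_y det_gram (c p).
  by rewrite -scaleN1r derive_det_gramZ// mulN1r.
have alg (s v g : R) : - s - 2^-1 * - v / g = - (s - 2^-1 * v / g) by ring.
exact: alg.
Qed.

Lemma S_curvature_V1 p y : cdom c p -> y != 0 -> tvec c p y \in V1 p ->
  S_curvature f (c p, y) = 0.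
Proof. by move=> cp y0 yV; rewrite S_curvature_gram// spray_div_V1// subrr. Qed.

Lemma S_curvature_affine p y w : cdom c p -> (forall t : R, y + t *: w != 0) ->
  (forall t : R, forall i j, E_curvature f i j (c p, y + t *: w) = 0) ->
  exists b, forall t : R,
    S_curvature f (c p, y + t *: w) = S_curvature f (c p, y) + t * b.
Proof.
move=> cp line0 E0.
have tan t := chart_tangent_chart cp (line0 t).
have y0 : y != 0 by have := line0 0; rewrite scale0r addr0.
have [|b bP] := vertical_hessian0_affine open_chart_tangent
  (smooth_on_spray_div open_chart_tangent smooth_on_in_chart fundamental_unit) tan.
  move=> t i j; have := E0 t i j.
  rewrite (E_curvature_spray_div open_chart_tangent smooth_on_in_chart fundamental_unit) //.
  move/eqP; rewrite mulf_eq0 invr_eq0 pnatr_eq0 /= => /eqP; exact.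
exists (b - 2^-1 * 'D_w det_gram (c p) / \det (gram (c p))) => t.
rewrite !S_curvature_gram// bP derive_det_gramD// derive_det_gramZ//.
have alg (s v w' g : R) : s + t * b - 2^-1 * (v + t * w') / g =
  s - 2^-1 * v / g + t * (b - 2^-1 * w' / g) by ring.
exact: alg.
Qed.

(** Where S vanishes, the divergence equals the density term, a linear form on each fibre, so its
    vertical Hessian is 0. *)
Lemma E_curvature_S0 i j p y : cdom c p -> y != 0 ->
  (forall q w, cdom c q -> w != 0 -> S_curvature f (c q, w) = 0) ->
  E_curvature f i j (c p, y) = 0.
Proof.
move=> cp y0 S0; have tz := chart_tangent_chart cp y0.
rewrite (E_curvature_spray_div open_chart_tangent smooth_on_in_chart fundamental_unit) //.
rewrite (vertical_linear_hessian0 _ _ open_chart_tangent (tau :=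
  fun k x => 2^-1 * 'D_(delta_mx 0 k) det_gram x / \det (gram x)))// ?mulr0//.
move=> [_ w] [[q cq /= <-] w0].
have /subr0_eq -> : spray_div f (c q, w) -
    2^-1 * 'D_w det_gram (c q) / \det (gram (c q)) = 0.
  by rewrite -S_curvature_gram ?S0.
have cimgq : cimg c (c q) by exists q.
rewrite (derive_row _ (smooth_on_differentiable smooth_on_det_gram cimgq)).
rewrite mulr_sumr mulr_suml; apply: eq_bigr => k _.
have alg (u t g : R) : 2^-1 * (u * t) / g = u * (2^-1 * t / g) by ring.
exact: alg.
Qed.

Lemma E_curvature_angular0 (kappa : R) i j p y : cdom c p -> y != 0 ->
  (forall w, w != 0 -> E_curvature f i j (c p, w) =
    kappa * (F p (tvec c p w))^-1 * angular_tensor f i j (c p, w)) ->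
  E_curvature f i j (c p, y) = 0.
Proof.
move=> cp y0 Ek; have tz := chart_tangent_chart cp y0.
have e1 := parity_E_curvature open_chart_tangent flip_chart_tangent
  smooth_on_in_chart fundamental_unit in_chart_flip i j tz.
have e2 := parity_angular open_chart_tangent flip_chart_tangent
  smooth_on_in_chart in_chart_flip i j tz.
have Ny0 : - y != 0 by rewrite oppr_eq0.
have eF : F p (tvec c p (- y)) = F p (tvec c p y).
  by rewrite !tvecE mulNmx alpha_metric_even.
have := Ek _ Ny0.
have := Ek _ y0.
rewrite eF; move: e1 e2; rewrite /flip /=.
move: (E_curvature _ _ _ _) (E_curvature _ _ _ _) (angular_tensor _ _ _ _) (angular_tensor _ _ _ _) (F _ _).
move=> u u' v v' g; rewrite mul1r mulN1r => -> -> -> /eqP.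
by rewrite -subr_eq0 -opprD oppr_eq0 -mulr2n mulrn_eq0 /= => /eqP.
Qed.

End AlphaMetric.

(** * Vanishing of the S-curvature from each of the conditions *)

Section Alpha12Metric.
Context {R : realType} {n : nat} {M : manifold R n}.
Variables (F : M -> 'rV[R]_n -> R) (a : M -> 'rV[R]_n -> 'rV[R]_n -> R).
Variables (V1 V2 : M -> {vspace 'rV[R]_n}) (L : R -> R -> R).
Hypotheses (finF : finsler_metric F) (mF : alpha12_metric F a V1 V2 L).
Variable c : chart R n M.
Hypothesis ac : atlas c.
Local Notation S p y := (S_curvature (in_chart c F) (c p, y)).

Lemma alpha12_S_curvature_opp p y : cdom c p -> y != 0 -> S p (- y) = - S p y.
Proof.
case: mF => riema [k1 k10 sub1] [k2 k20 sub2] V12 orthV _ FE.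
exact: (S_curvature_opp finF riema k10 k20 sub1 sub2 V12 orthV FE ac).
Qed.

Lemma alpha12_S_curvature0 p y : cdom c p -> y != 0 ->
  (tvec c p y \in V1 p) || (tvec c p y \in V2 p) -> S p y = 0.
Proof.
case: mF => riema [k1 k10 sub1] [k2 k20 sub2] V12 orthV _ FE cp y0.
case/orP; first exact: (S_curvature_V1 finF riema k10 k20 sub1 sub2 V12 orthV FE ac cp y0).
(* The roles of [V1] and [V2] are exchanged, and with them the arguments of [L]. *)
apply: (@S_curvature_V1 _ _ _ _ _ _ _ (fun s t => L t s) _ _
  finF riema k20 k10 sub2 sub1 _ _ _ _ ac _ _ cp y0).
- by move=> q; rewrite addvC.
- by move=> q u v uV vV; case: riema => /(_ q) ip _; rewrite (ipC ip) orthV.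
- by move=> q u v uV vV; rewrite addrC FE.
Qed.

Lemma alpha12_split p y : cdom c p -> exists y1 y2,
  [/\ y = y1 + y2, tvec c p y1 \in V1 p & tvec c p y2 \in V2 p].
Proof.
move=> cp; have /memv_addP[v1 v1V [v2 v2V vE]] : tvec c p y \in (V1 p + V2 p)%VS.
  by rewrite (alpha12_decomposition mF) memvf.
exists (tvec_inv c p v1), (tvec_inv c p v2); rewrite !tvec_invK//; split=> //.
by rewrite -[y](tvecK _ ac cp) vE /tvec_inv linearD.
Qed.

Lemma S_curvature_linear0 p (eps : 'rV[R]_n -> R) : cdom c p -> scalar eps ->
  (forall y, y != 0 -> S p y = eps (tvec c p y)) -> forall y, y != 0 -> S p y = 0.
Proof.
move=> cp eps_lin SE y y0.
have eps0 : eps 0 = 0.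
  by have := eps_lin (-1) 0 0; rewrite scaler0 add0r mulN1r addNr.
have epsV y' : (tvec c p y' \in V1 p) || (tvec c p y' \in V2 p) ->
    eps (tvec c p y') = 0.
  case: (eqVneq y' 0) => [-> _|y'0 yV]; first by rewrite tvecE mul0mx.
  by rewrite -SE// alpha12_S_curvature0.
have [y1 [y2 [yE yV1 yV2]]] := alpha12_split y cp.
rewrite SE// yE tvecE mulmxDl -!tvecE -[tvec c p y1]scale1r eps_lin.
by rewrite epsV ?yV1// epsV ?yV2 ?orbT// mulr0 addr0.
Qed.

Lemma S_curvature_isotropic0 p (kappa : R) (eps : 'rV[R]_n -> R) : cdom c p ->
  scalar eps ->
  (forall y, y != 0 -> S p y = kappa * F p (tvec c p y) + eps (tvec c p y)) ->
  forall y, y != 0 -> S p y = 0.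
Proof.
move=> cp eps_lin SE; apply: (S_curvature_linear0 cp eps_lin) => y y0.
have Ny0 : - y != 0 by rewrite oppr_eq0.
have tN : tvec c p (- y) = - tvec c p y by rewrite !tvecE mulNmx.
have eN : eps (- tvec c p y) = - eps (tvec c p y).
  have eps0 : eps 0 = 0.
    by have := eps_lin (-1) 0 0; rewrite scaler0 add0r mulN1r addNr.
  by have := eps_lin (-1) (tvec c p y) 0; rewrite scaleN1r !addr0 eps0 addr0 mulN1r.
have FN : F p (- tvec c p y) = F p (tvec c p y).
  by case: mF => riema _ _ V12 _ _ FE; exact: (alpha_metric_even riema V12 FE).
(* With [u] the term in [F] and [v] the form, oddness reads [u - v = - (u + v)], so [u = 0]. *)
have := alpha12_S_curvature_opp cp y0.
rewrite SE// SE// tN FN eN.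
move: (kappa * _) (eps _) => u v e; lra.
Qed.

Lemma S_curvature_E0 p : cdom c p ->
  (forall y, y != 0 -> forall i j, E_curvature (in_chart c F) i j (c p, y) = 0) ->
  forall y, y != 0 -> S p y = 0.
Proof.
move=> cp E0 y y0.
have [y1 [y2 [yE yV1 yV2]]] := alpha12_split y cp.
have [y10|y10] := eqVneq y1 0.
  by apply: alpha12_S_curvature0 => //; rewrite yE y10 add0r yV2 orbT.
have [y20|y20] := eqVneq y2 0.
  by apply: alpha12_S_curvature0 => //; rewrite yE y20 addr0 yV1.
have S1 : S p y1 = 0 by apply: alpha12_S_curvature0; rewrite ?yV1.
have S2 : S p y2 = 0 by apply: alpha12_S_curvature0; rewrite ?yV2 ?orbT.
have cap w : tvec c p w \in V1 p -> tvec c p w \in V2 p -> w = 0.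
  move=> w1 w2; have [[ipa _] _ _ _ orthV _ _] := mF.
  have /eqP := orthV _ _ _ w1 w2; rewrite (ip_eq0 (ipa p)) => /eqP t0.
  by rewrite -[w](tvecK _ ac cp) t0 /tvec_inv linear0.
have VZ (W : {vspace 'rV[R]_n}) (t : R) w : tvec c p w \in W -> tvec c p (t *: w) \in W.
  by rewrite !tvecE -scalemxAl; apply: memvZ.
(* Both components are nonzero here, so neither line meets the zero vector, where the curvatures are
   not controlled. *)
have line1 t : y1 + t *: y2 != 0.
  apply: contra y10; rewrite addr_eq0 -scaleNr => /eqP e.
  by apply/eqP/cap => //; rewrite e; apply: VZ.
have line2 t : y2 + t *: y1 != 0.
  apply: contra y20; rewrite addr_eq0 -scaleNr => /eqP e.
  by apply/eqP/cap => //; rewrite e; apply: VZ.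
case: mF => riema [k1 k10 sub1] [k2 k20 sub2] V12 orthV _ FE.
have aff := S_curvature_affine finF riema k10 k20 sub1 sub2 V12 orthV FE ac.
have [b bP] := aff _ _ _ cp line1 (fun t => E0 _ (line1 t)).
have [b' bP'] := aff _ _ _ cp line2 (fun t => E0 _ (line2 t)).
(* The values at [y1 + y2] give [b = b']; those at [y1 - y2] and [y2 - y1] are [-b] and [-b'], and
   oddness gives [-b = b']. Hence [b = 0]. *)
have e1 := bP 1; have e2 := bP (-1); have e3 := bP' 1; have e4 := bP' (-1).
rewrite S1 in e1 e2; rewrite S2 in e3 e4.
have N0 : y2 - y1 != 0 by have := line2 (-1); rewrite scaleN1r.
have e5 := alpha12_S_curvature_opp cp N0; rewrite opprB in e5.
rewrite scale1r in e1; rewrite scale1r [y2 + y1]addrC in e3.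
rewrite scaleN1r in e2; rewrite scaleN1r in e4.
rewrite e2 e4 in e5; rewrite e1 in e3.
by rewrite yE e1; lra.
Qed.

End Alpha12Metric.

Theorem theorem1p2 (R : realType) (n : nat) (M : manifold R n)
    (F : M -> 'rV[R]_n -> R)
    (F_finsler : finsler_metric F) (F_homogeneous : homogeneous F)
    (F_alpha12 : homogeneous_alpha12_metric F) :
  [<-> weakly_isotropic_S F;
       vanishing_S F;
       isotropic_E F;
       vanishing_E F].
Proof.
case: F_alpha12 => m [G] [action] [base] [a] [V1] [V2] [L] [_ mF _ _ _].
have [riema [k1 k10 sub1] [k2 k20 sub2] V12 orthV _ FE] := mF.
tfae.
- move=> [k [eps [[eps_lin _] SE]]] c ac p cp y y0.
  exact: (S_curvature_isotropic0 F_finsler mF ac cp (eps_lin p) (SE c ac p cp) y0).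
- move=> S0; exists (fun=> 0) => c ac p cp y y0 i j; rewrite mulr0 !mul0r.
  exact: (E_curvature_S0 F_finsler riema k10 k20 sub1 sub2 V12 orthV FE ac i j cp y0
    (fun q w cq w0 => S0 c ac q cq w w0)).
- move=> [k Ek] c ac p cp y y0 i j.
  exact: (E_curvature_angular0 F_finsler riema V12 FE ac cp y0
    (fun w w0 => Ek c ac p cp w w0 i j)).
(* Vanishing E-curvature already forces S to vanish, so the function and the one-form can both be
   0. *)
- move=> E0; exists (fun=> 0), (fun _ _ => 0); split.
    split=> [p r u v|c ac i]; first by rewrite mulr0 addr0.
    exact: smooth_on_cst.
  move=> c ac p cp y y0; rewrite mulr0 mul0r addr0.
  exact: (S_curvature_E0 F_finsler mF ac cp (E0 c ac p cp) y0).
Qed.
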